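(* Let $X$ be a real double-sided si-process determined by a chain of de Branges spaces $\mathcal H(E_t)$, $t\ge0$, of exponential type with diagonal structure function $\mathrm{diag}[\alpha_t,\gamma_t]$ as described in the context, and let $M^e$ be its even fundamental martingale, with second order moments $\mathbb E(M^e_sM^e_t)=\pi\alpha_{s\wedge t}$. Then the process $M_t^e/\sqrt{\alpha_t'}$, $0\le t\le r$, decomposes in the Karhunen–Loève series $$\frac{1}{\sqrt{\alpha_t'}}M_t^e=\sum_{n=1}^\infty\omega_n\varphi_n(t)\,\xi_n ,$$ where the $\xi_n$ are i.i.d. Gaussian random variables, $\{\varphi_n(t)=B_t(\lambda_n)/\sqrt{\alpha_t'}\}$ is an orthonormal basis in $L^2[0,r]$, and $$\omega_n=\frac1{\lambda_n}\sqrt{\frac{2}{\pi K_r(\lambda_n,\lambda_n)}}$$ with the positive zeros $\lambda_n$ of $A_r(z)$.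
   Context: **Karhunen–Loève series.** By this is meant an orthogonal decomposition $\sum_n\omega_n\varphi_n(t)\xi_n$ of a mean-square continuous process on a closed interval, with uncorrelated $\xi_n$, $\mathbb E\,\xi_m\bar\xi_n=\delta_{mn}$, where $|\omega_n|^2$ and $\varphi_n$ are eigenvalues and eigenfunctions of the covariance function; the series converges in mean square uniformly on the interval. **Chain.** $\alpha$ is a continuously differentiable strictly increasing function on $[0,\infty)$ with $\alpha_0=0$, $\alpha_t'>0$, and $\gamma_t=\int_0^tdu/\alpha_u'$. The functions $A_t(z),B_t(z)$ (entire in $z$, continuous in $t$) are the solution of $$1-A_t(z)=z\int_0^tB_u(z)\,d\gamma_u,\qquad B_t(z)=z\int_0^tA_u(z)\,d\alpha_u,$$ and $E_t=A_t-iB_t$. For $t>0$, $E_t$ is a de Branges function ($|E_t(x-iy)|<|E_t(x+iy)|$ for $y>0$); $\mathcal H(E_t)$ is the de Branges space of entire functions $f$ with $\int|f/E_t|^2d\lambda<\infty$ and $f/E_t,f^\sharp/E_t$ of bounded type and non-positive mean type in the upper half-plane ($f^\sharp(z)=\overline{f(\bar z)}$), with reproducing kernel $K_t(w,z)=\frac{A_t(\bar w)B_t(z)-B_t(\bar w)A_t(z)}{\pi(z-\bar w)}$. On the real diagonal $\pi K_r(\lambda,\lambda)=A_r(\lambda)\dot B_r(\lambda)-\dot A_r(\lambda)B_r(\lambda)$, the dot denoting the derivative in $\lambda$. **Process.** $X=(X_t)_{t\in\mathbb R}$ is a real centred mean-square continuous Gaussian process with $\mathbb E(X_sX_t)=\int\frac{(e^{i\lambda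 s}-1)(e^{-i\lambda t}-1)}{\lambda^2}\mu(d\lambda)$, $\mu\ge0$ symmetric with $\int\frac{\mu(d\lambda)}{1+\lambda^2}<\infty$. ''Determined by the chain'' means: for every $t>0$ the space $\mathcal H(E_t)$ is contained isometrically in $L^2(\mu)$ (norms agree) and as a subspace of $L^2(\mu)$ it equals the closed linear span of $\{(e^{izu}-1)/z:|u|\le t\}$. The even part is $X^e_t=\frac12(X_t-X_{-t})$, $t\ge0$. The even fundamental martingale $M^e_t$ is the image of $\lambda\mapsto B_t(\lambda)/\lambda$ under the linear isometry, from the closed real linear span of $\{\sin(u\lambda)/\lambda:u\ge0\}$ in $L^2(\mu)$ onto that of $\{X_u^e\}$ in $L^2(\Omega,P)$, sending $\sin(u\lambda)/\lambda$ to $X_u^e$.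
   Formalization: The φ_n as printed are orthogonal but not orthonormal; √(2/(πK_r(λ_n,λ_n))) φ_n is shown to be the orthonormal basis of L²[0,r]. The i.i.d. Gaussian ξ_n have variance π, so the unit-variance Karhunen–Loève eigenvalues are π/λ_n². *)

(* Defs.v *)
From HB Require Import structures.
From mathcomp Require Import all_boot all_order all_algebra.
From mathcomp Require Import complex.
From mathcomp Require Import all_classical all_reals all_analysis.

Set Implicit Arguments.
Unset Strict Implicit.
Unset Printing Implicit Defensive.

Import Order.TTheory GRing.Theory Num.Theory.
Import numFieldNormedType.Exports.

Local Open Scope classical_set_scope.
Local Open Scope ring_scope.

Notation normc := ComplexField.Normc.normc.

(* [(R[i])^o] carries the norm topology of R[i], so [derivable _ z 1] is
   complex differentiability at z. *)
Definition entire (R : realType) (f : R[i] -> R[i]) : Prop :=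
  forall z : R[i], derivable (f : (R[i])^o -> (R[i])^o) z 1.

Definition cderive (R : realType) (f : R[i] -> R[i]) (z : R[i]) : R[i] :=
  derive1 (f : (R[i])^o -> (R[i])^o) z.

Definition finite_exponential_type (R : realType) (f : R[i] -> R[i]) : Prop :=
  exists c tau : R, forall z : R[i], normc (f z) <= c * expR (tau * normc z).

Definition sharp (R : realType) (f : R[i] -> R[i]) (z : R[i]) : R[i] :=
  (conjc (f (conjc z))).

Definition upper_half_plane (R : realType) : set R[i] :=
  [set z | 0 < complex.Im z].

Definition bounded_holomorphic_on (R : realType) (D : set R[i])
    (f : R[i] -> R[i]) : Prop :=
  (forall z, D z -> derivable (f : (R[i])^o -> (R[i])^o) z 1) /\
  (exists c : R, forall z, D z -> normc (f z) <= c).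

Definition bounded_type (R : realType) (f : R[i] -> R[i]) : Prop :=
  let U := @upper_half_plane R in
  (forall z, U z -> derivable (f : (R[i])^o -> (R[i])^o) z 1) /\
  exists p q : R[i] -> R[i],
    [/\ bounded_holomorphic_on U p, bounded_holomorphic_on U q,
        (exists2 z, U z & q z != 0)
      & forall z, U z -> q z * f z = p z].

Definition mean_type (R : realType) (f : R[i] -> R[i]) : \bar R :=
  limf_esup (fun y : R => lne (normc (f (Complex 0 y)))%:E * (y^-1)%:E)%E
    (pinfty_nbhs R).

Definition deBranges_function (R : realType) (E : R[i] -> R[i]) : Prop :=
  entire E /\
  forall x y : R, 0 < y -> normc (E (Complex x (- y))) < normc (E (Complex x y)).

Definition cL2norm (R : realType) (mu : {measure set (measurableTypeR R) -> \bar R})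
    (f : R -> R[i]) : \bar R :=
  'N[mu]_2%:E[(fun x => (normc (f x))%:E)]%E.

Definition in_deBranges_space (R : realType) (E f : R[i] -> R[i]) : Prop :=
  [/\ entire f,
      (cL2norm lebesgue_measure (fun x => f x%:C%C / E x%:C%C)%R < +oo)%E,
      bounded_type (fun z => f z / E z) /\
        bounded_type (fun z => sharp f z / E z),
      (mean_type (fun z => f z / E z)%R <= 0)%E
    & (mean_type (fun z => sharp f z / E z)%R <= 0)%E].

(* \int_0^t f(u) w(u) du, i.e. the integral of f against dG when G' = w. *)
Definition cintegral_density (R : realType) (w : R -> R) (t : R)
    (f : R -> R[i]) : R[i] :=
  Complex (\int[lebesgue_measure]_(u in `[0, t]) (complex.Re (f u) * w u))
          (\int[lebesgue_measure]_(u in `[0, t]) (complex.Im (f u) * w u)).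

Definition E_of (R : realType) (A B : R -> R[i] -> R[i]) (t : R) (z : R[i]) :
    R[i] := A t z - Complex 0 1 * B t z.

(* [dalpha] is the derivative of alpha on [0, +oo[ (one-sided at 0); since
   gamma_t = \int_0^t du / alpha'_u, the densities of d alpha and d gamma are
   alpha' and 1 / alpha'. *)
Record diagonal_chain (R : realType) (alpha dalpha : R -> R)
    (A B : R -> R[i] -> R[i]) : Prop := {
  alpha_0 : alpha 0 = 0;
  alpha_derive : forall t : R, 0 < t -> is_derive t 1 alpha (dalpha t);
  alpha_derive_0 : h^-1 * (alpha h - alpha 0) @[h --> 0^'+] --> dalpha 0;
  dalpha_continuous : {within `[0, +oo[, continuous dalpha};
  dalpha_gt0 : forall t : R, 0 <= t -> 0 < dalpha t;
  alpha_incr : {in `[0, +oo[ &, {homo alpha : s t / s < t}};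
  chain_entire : forall t : R, 0 <= t -> entire (A t) /\ entire (B t);
  chain_continuous : forall z : R[i],
    {within `[0, +oo[, continuous (fun t => A t z : (R[i])^o)} /\
    {within `[0, +oo[, continuous (fun t => B t z : (R[i])^o)};
  chain_eqA : forall (t : R) (z : R[i]), 0 <= t ->
    1 - A t z = z * cintegral_density (fun u => (dalpha u)^-1) t (fun u => B u z);
  chain_eqB : forall (t : R) (z : R[i]), 0 <= t ->
    B t z = z * cintegral_density dalpha t (fun u => A u z);
  chain_deBranges : forall t : R, 0 < t -> deBranges_function (E_of A B t);
  chain_exp_type : forall t : R, 0 <= t -> finite_exponential_type (E_of A B t) }.

(* The first branch is the continuous extension to z = conj w; at a real point
   w = z = x it gives pi K(x, x) = A(x) B'(x) - A'(x) B(x). *)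
Definition deBranges_kernel (R : realType) (A B : R -> R[i] -> R[i]) (t : R)
    (w z : R[i]) : R[i] :=
  let w' := conjc w in
  if z == w' then
    (A t w' * cderive (B t) z - B t w' * cderive (A t) z) / (pi : R)%:C%C
  else (A t w' * B t z - B t w' * A t z) / ((pi : R)%:C%C * (z - w')).

(* x |-> (e^{iux} - 1) / x and x |-> sin(ux) / x, extended by continuity to
   x = 0 (mu may charge the origin). *)
Definition si_kernel (R : realType) (u x : R) : R[i] :=
  if x == 0 then Complex 0 u
  else (Complex (cos (u * x)) (sin (u * x)) - 1) / x%:C%C.

Definition sin_kernel (R : realType) (u x : R) : R :=
  if x == 0 then u else sin (u * x) / x.

(* x |-> B_t(x) / x, likewise extended (B_t(0) = 0); it is real on the line. *)
Definition martingale_symbol (R : realType) (B : R -> R[i] -> R[i]) (t x : R) : R :=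
  complex.Re (if x == 0 then cderive (B t) 0 else B t x%:C%C / x%:C%C).

(* [normal_prob m 0] is not the Dirac mass at m in the library. *)
Definition gaussian_law (R : realType) (m s : R) (U : set (measurableTypeR R)) :
    \bar R :=
  if s == 0 then \d_m U else normal_prob m s U.

Definition has_gaussian_law d (T : measurableType d) (R : realType)
    (P : probability T R) (Y : T -> R) (m s : R) : Prop :=
  forall U : set (measurableTypeR R), measurable U ->
    P (Y @^-1` U) = gaussian_law m s U.

Definition gaussian_process d (T : measurableType d) (R : realType)
    (P : probability T R) (X : R -> {RV P >-> R}) : Prop :=
  forall (n : nat) (t c : 'I_n -> R), exists m s : R,
    0 <= s /\ has_gaussian_law P (fun w => \sum_(i < n) c i * X (t i) w) m s.

Record si_process d (T : measurableType d) (R : realType) (P : probability T R)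
    (mu : {measure set (measurableTypeR R) -> \bar R})
    (X : R -> {RV P >-> R}) : Prop := {
  mu_symmetric : forall U : set (measurableTypeR R), measurable U ->
    mu [set x | U (- x)] = mu U;
  mu_finite : (\int[mu]_x ((1 + x ^+ 2)^-1)%:E < +oo)%E;
  X_L2 : forall t : R, (X t : T -> R) \in Lfun P 2%:E;
  X_centred : forall t : R, ('E_P[X t] = 0)%E;
  X_ms_continuous : forall t,
    'E_P[(fun w => (X s w - X t w) ^+ 2)%R]%E @[s --> t] --> 0%E;
  X_gaussian : gaussian_process X;
  X_covariance : forall s t,
    (fine 'E_P[(fun w => X s w * X t w)%R]%E)%:C%C =
    Complex
      (\int[mu]_x complex.Re (si_kernel s x * conjc (si_kernel t x)))
      (\int[mu]_x complex.Im (si_kernel s x * conjc (si_kernel t x))) }.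

Definition cclosed_span (R : realType)
    (mu : {measure set (measurableTypeR R) -> \bar R}) (S : set (R -> R[i])) :
    set (R -> R[i]) :=
  [set f | forall e : R, 0 < e ->
    exists (n : nat) (c : 'I_n -> R[i]) (g : 'I_n -> R -> R[i]),
      (forall i, S (g i)) /\
      (cL2norm mu (fun x => f x - \sum_(i < n) c i * g i x)%R < e%:E)%E].

Definition cmeasurable (R : realType) (f : R -> R[i]) : Prop :=
  measurable_fun [set: measurableTypeR R] (fun x => complex.Re (f x)) /\
  measurable_fun [set: measurableTypeR R] (fun x => complex.Im (f x)).

Definition determined_by_chain (R : realType)
    (mu : {measure set (measurableTypeR R) -> \bar R})
    (A B : R -> R[i] -> R[i]) : Prop :=
  forall t : R, 0 < t ->
    let H := in_deBranges_space (E_of A B t) in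
    (forall F, H F ->
      cL2norm mu (fun x => F x%:C%C) =
      cL2norm lebesgue_measure (fun x => F x%:C%C / E_of A B t x%:C%C)) /\
    (forall f : R -> R[i], cmeasurable f ->
      cclosed_span mu [set si_kernel u | u in [set u : R | `|u| <= t]] f <->
      exists2 F, H F & {ae mu, forall x, f x = F x%:C%C}).

Definition closed_span d (T : measurableType d) (R : realType)
    (mu : {measure set T -> \bar R}) (S : set (T -> R)) : set (T -> R) :=
  [set f | f \in Lfun mu 2%:E /\
    forall e : R, 0 < e ->
    exists (n : nat) (c : 'I_n -> R) (g : 'I_n -> T -> R),
      (forall i, S (g i)) /\
      ('N[mu]_2%:E[(fun x => (f x - \sum_(i < n) c i * g i x)%:E)] < e%:E)%E].

(* Linear isometry from D onto C; D and C are sets of representatives, and all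
   identities between L^2 classes hold almost everywhere. *)
Record linear_isometry_onto d1 (T1 : measurableType d1) d2 (T2 : measurableType d2)
    (R : realType) (mu : {measure set T1 -> \bar R}) (nu : {measure set T2 -> \bar R})
    (D : set (T1 -> R)) (C : set (T2 -> R)) (I : (T1 -> R) -> T2 -> R) : Prop := {
  isometry_into : forall f, D f -> C (I f);
  isometry_linear : forall (a : R) f g, D f -> D g ->
    {ae nu, forall w, I (fun x => a * f x + g x) w = a * I f w + I g w};
  isometry_norm : forall f, D f ->
    ('N[nu]_2%:E[EFin \o I f] = 'N[mu]_2%:E[EFin \o f])%E;
  isometry_onto : forall h, C h ->
    exists2 f, D f & {ae nu, forall w, I f w = h w} }.

Definition even_part d (T : measurableType d) (R : realType) (P : probability T R)
    (X : R -> {RV P >-> R}) (t : R) (w : T) : R := (X t w - X (- t) w) / 2.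

Definition even_fundamental_martingale d (T : measurableType d) (R : realType)
    (P : probability T R) (mu : {measure set (measurableTypeR R) -> \bar R})
    (B : R -> R[i] -> R[i]) (X M : R -> {RV P >-> R}) : Prop :=
  let D := closed_span mu [set @sin_kernel R u | u in [set u | 0 <= u]] in
  let C := closed_span P [set even_part X u | u in [set u | 0 <= u]] in
  exists I : (R -> R) -> T -> R,
    [/\ linear_isometry_onto mu P D C I,
        forall u : R, 0 <= u -> {ae P, forall w, I (sin_kernel u) w = even_part X u w}
      & forall t : R, 0 <= t -> D (martingale_symbol B t) /\
          {ae P, forall w, M t w = I (martingale_symbol B t) w}].

Definition orthonormal_basis (R : realType) (r : R) (phi : nat -> R -> R) : Prop :=
  let J : set (measurableTypeR R) := `[0, r]%classic in
  [/\ forall n, (phi n \_ J : measurableTypeR R -> R)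
                  \in Lfun lebesgue_measure 2%:E,
      forall m n, \int[lebesgue_measure]_(t in J) (phi m t * phi n t)
                  = (m == n)%:R
    & forall f : measurableTypeR R -> R, f \in Lfun lebesgue_measure 2%:E ->
        closed_span lebesgue_measure [set phi n \_ J | n in [set: nat]]
          (f \_ J)].

Definition ms_uniform_series d (T : measurableType d) (R : realType)
    (P : probability T R) (r : R) (Y : R -> T -> R)
    (omega : nat -> R) (phi : nat -> R -> R) (xi : nat -> T -> R) : Prop :=
  forall e : R, 0 < e -> \forall N \near \oo, forall t : R, 0 <= t <= r ->
    ('E_P[(fun w => (Y t w - \sum_(n < N) omega n * phi n t * xi n w) ^+ 2)%R]
      < e%:E)%E.

Record karhunen_loeve d (T : measurableType d) (R : realType)
    (P : probability T R) (r : R) (Y : R -> T -> R)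
    (omega : nat -> R) (phi : nat -> R -> R) (xi : nat -> T -> R) : Prop := {
  kl_L2 : forall t : R, 0 <= t <= r -> Y t \in Lfun P 2%:E;
  kl_ms_continuous : forall t : R, 0 <= t <= r ->
    'E_P[(fun w => (Y s w - Y t w) ^+ 2)%R]%E @[s --> within `[0, r] (nbhs t)]
      --> 0%E;
  kl_xi_L2 : forall n, xi n \in Lfun P 2%:E;
  kl_xi_centred : forall n, ('E_P[xi n] = 0)%E;
  kl_xi_orthonormal : forall m n,
    ('E_P[(fun w => xi m w * xi n w)%R] = ((m == n)%:R)%:E)%E;
  kl_basis : orthonormal_basis r phi;
  kl_eigen : forall (n : nat) (s : R), 0 <= s <= r ->
    \int[lebesgue_measure]_(t in `[0, r])
      (fine (covariance P (Y s) (Y t)) * phi n t) = omega n ^+ 2 * phi n s;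
  kl_series : ms_uniform_series P r Y omega phi xi }.

Definition mutually_independent d (T : measurableType d) (R : realType)
    (P : probability T R) (xi : nat -> {RV P >-> R}) : Prop :=
  forall (s : seq nat) (U : nat -> set (measurableTypeR R)), uniq s ->
    (forall n, measurable (U n)) ->
    P [set w | forall n, n \in s -> U n (xi n w)] =
    (\prod_(n <- s) P (xi n @^-1` U n))%E.

(* Main.v *)
Require Import Defs.
From HB Require Import structures.
From mathcomp Require Import all_boot all_order all_algebra.
From mathcomp Require Import complex.
From mathcomp Require Import all_classical all_reals all_analysis.
From mathcomp Require Import measurable_realfun.
From mathcomp Require Import ring lra.
Import Order.TTheory GRing.Theory Num.Theory.
Import numFieldNormedType.Exports.
Local Open Scope classical_set_scope.
Local Open Scope ring_scope.

Set Implicit Arguments.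
Unset Strict Implicit.
Unset Printing Implicit Defensive.

(* placeholder *)

Section Calculus.
Variable R : realType.
Implicit Types (f g : R -> R) (x y t : R).

Lemma drvE f x a b : is_derive x 1 f a -> a = b -> is_derive x 1 f b.
Proof. by move=> + <-. Qed.

Lemma drv_cst (c : R) x : is_derive x 1 (fun=> c) 0.
Proof. exact: is_derive_cst. Qed.

Lemma drv_id x : is_derive x 1 (fun t : R => t) 1.
Proof. exact: is_derive_id. Qed.

Lemma drvD f g x a b : is_derive x 1 f a -> is_derive x 1 g b ->
  is_derive x 1 (fun t => f t + g t) (a + b).
Proof. by move=> fa gb; exact: is_deriveD. Qed.

Lemma drvN f x a : is_derive x 1 f a -> is_derive x 1 (fun t => - f t) (- a).
Proof. by move=> fa; exact: is_deriveN. Qed.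

Lemma drvB f g x a b : is_derive x 1 f a -> is_derive x 1 g b ->
  is_derive x 1 (fun t => f t - g t) (a - b).
Proof. by move=> fa gb; apply: drvD => //; exact: drvN. Qed.

Lemma drvM f g x a b : is_derive x 1 f a -> is_derive x 1 g b ->
  is_derive x 1 (fun t => f t * g t) (a * g x + f x * b).
Proof.
move=> fa gb; have -> : (fun t => f t * g t) = f * g by apply/funext.
apply: is_derive_eq.
by rewrite addrC /GRing.scale/= [g x * _]mulrC.
Qed.

Lemma drvZ (c : R) f x a : is_derive x 1 f a -> is_derive x 1 (fun t => c * f t) (c * a).
Proof.
by move=> fa; apply: (drvE (drvM (drv_cst c x) fa)); rewrite mul0r add0r.
Qed.

Lemma drvX2 f x a : is_derive x 1 f a -> is_derive x 1 (fun t => f t ^+ 2) (2 * f x * a).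
Proof.
move=> fa; under eq_fun do rewrite expr2.
by apply: (drvE (drvM fa fa)); ring.
Qed.

Lemma drvV f x a : f x != 0 -> is_derive x 1 f a ->
  is_derive x 1 (fun t => (f t)^-1) (- a / f x ^+ 2).
Proof.
move=> f0 fa; apply: (drvE (is_deriveV f0 fa)).
by rewrite /GRing.scale/= !mulNr mulrC.
Qed.

Lemma drv_sum n (F : 'I_n -> R -> R) x (d : 'I_n -> R) :
  (forall i, is_derive x 1 (F i) (d i)) ->
  is_derive x 1 (fun t => \sum_(i < n) F i t) (\sum_(i < n) d i).
Proof.
move=> dF; rewrite (_ : (fun t => _) = \sum_(i < n) F i); last first.
  by apply/funext => t; rewrite fct_sumE.
exact: is_derive_sum.
Qed.

Lemma drv_exp f x a : is_derive x 1 f a ->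
  is_derive x 1 (fun t => expR (f t)) (a * expR (f x)).
Proof.
by move=> fa; apply: (drvE (is_derive1_comp (is_derive_expR _) fa)); rewrite mulrC.
Qed.

Lemma drv_cos f x a : is_derive x 1 f a ->
  is_derive x 1 (fun t => cos (f t)) (- a * sin (f x)).
Proof.
by move=> fa; apply: (drvE (is_derive1_comp (is_derive_cos _) fa)); ring.
Qed.

Lemma drv_sin f x a : is_derive x 1 f a ->
  is_derive x 1 (fun t => sin (f t)) (a * cos (f x)).
Proof.
by move=> fa; apply: (drvE (is_derive1_comp (is_derive_sin _) fa)); ring.
Qed.

Lemma drv_continuous f x a : is_derive x 1 f a -> {for x, continuous f}.
Proof.
move=> [df _]; apply: differentiable_continuous.
exact/derivable1_diffP.
Qed.

Lemma drv_near f g x a : is_derive x 1 f a -> (\forall t \near x, f t = g t) ->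
  is_derive x 1 g a.
Proof. by move=> fa fg; exact: near_eq_is_derive fg fa. Qed.

Lemma cont_within f (A : set R) : (forall x, A x -> {for x, continuous f}) ->
  {within A, continuous f}.
Proof. by move=> cf; apply: continuous_in_subspaceT => x /set_mem/cf. Qed.

Lemma ndecr_off_finite (l : seq R) f x y : x <= y ->
  (forall t, x <= t <= y -> {for t, continuous f}) ->
  (forall t, x < t < y -> t \notin l -> exists2 d, 0 <= d & is_derive t 1 f d) ->
  f x <= f y.
Proof.
elim: l x y => [|c l IH] x y xy cf df.
  have dd t : t \in `]x, y[ -> exists2 d, 0 <= d & is_derive t 1 f d.
    by rewrite in_itv/= => /df; exact.
  apply: (@ger0_derive1_ndecr _ f x y) => //.
  - by move=> t /dd[d _ [+ _]].
  - by move=> t /dd[d d0 dft]; rewrite derive1E derive_val.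
  - by apply: cont_within => t /=; rewrite in_itv/= => /cf.
have [cxy|ncxy] := boolP (x < c < y); last first.
  apply: IH => // t txy tl; apply: df => //.
  by rewrite inE negb_or tl andbT; apply: contraNneq ncxy => <-.
have /andP[xc cy] := cxy.
apply: (@le_trans _ _ (f c)); apply: IH; rewrite ?ltW//.
- by move=> t /andP[? tc]; apply: cf; rewrite (le_trans tc (ltW cy)) andbT.
- move=> t /andP[xt tc] tl; apply: df; first by rewrite xt (lt_trans tc).
  by rewrite inE negb_or tl andbT lt_eqF.
- by move=> t /andP[ct ?]; apply: cf; rewrite (le_trans (ltW xc) ct).
- move=> t /andP[ct ty] tl; apply: df; first by rewrite ty (lt_trans xc).
  by rewrite inE negb_or tl andbT gt_eqF.
Qed.

Lemma ndecr_drv f df x y : x <= y -> (forall t, x <= t <= y -> is_derive t 1 f (df t)) ->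
  (forall t, x <= t <= y -> 0 <= df t) -> f x <= f y.
Proof.
move=> xy dfE df0; apply: (@ndecr_off_finite [::]) => // t txy.
  exact: drv_continuous (dfE _ txy).
have {}txy : x <= t <= y by case/andP: txy => *; rewrite !ltW.
by move=> _; exists (df t); [exact: df0|exact: dfE].
Qed.

Lemma drv0_cst f x y : x <= y -> (forall t, x <= t <= y -> is_derive t 1 f 0) -> f x = f y.
Proof.
move=> xy df; apply/eqP; rewrite eq_le (@ndecr_drv f (fun=> 0))//=.
rewrite -lerN2; apply: (@ndecr_drv (fun t => - f t) (fun=> 0)) => // t /df dft.
by apply: (drvE (drvN dft)); rewrite oppr0.
Qed.

Lemma incr_drv f df x y : x < y -> (forall t, x <= t <= y -> is_derive t 1 f (df t)) ->
  (forall t, x <= t <= y -> 0 < df t) -> f x < f y.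
Proof.
move=> xy dfE df0; apply: (@gtr0_derive1_incr _ f x y) => //.
- by move=> t; rewrite in_itv/= => /andP[xt ty]; have [|+ _] := dfE t; rewrite ?(ltW xt) ?ltW.
- move=> t; rewrite in_itv/= => /andP[xt ty].
  have txy : x <= t <= y by rewrite !ltW.
  by have dft := dfE _ txy; rewrite derive1E derive_val df0.
- by apply: cont_within => t /=; rewrite in_itv/= => /dfE/drv_continuous.
Qed.

Local Notation mu := (@lebesgue_measure R).

Definition prim f t : R := if 0 <= t then \int[mu]_(x in `[0, t]) f x
  else - \int[mu]_(x in `[t, 0]) f x.

Lemma cont_integrable f x y : {within `[x, y], continuous f} ->
  mu.-integrable `[x, y] (EFin \o f).
Proof. by move=> cf; apply: continuous_compact_integrable => //; exact: segment_compact. Qed.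

Lemma prim_derive f : continuous f -> forall x, is_derive x 1 (prim f) (f x).
Proof.
move=> cf x.
have intf u v : mu.-integrable `[u, v] (EFin \o f).
  by apply: cont_integrable; exact: continuous_subspaceT.
pose a := - `|x| - 1; pose u := `|x| + 1.
have [lx lNx x0] := And3 (ler_norm x) (ler_norm (- x)) (normr_ge0 x).
rewrite normrN in lNx.
have ax : a < x by rewrite /a; lra.
have a0 : a < 0 by rewrite /a; lra.
have xu : x < u by rewrite /u; lra.
have [d1 d2] := @continuous_FTC1_closed _ f a x u xu (intf _ _) ax (cf x).
pose F y := \int[mu]_(t in `[a, y]) f t.
have dF : is_derive x 1 F (f x) by move: d1 d2; rewrite -/F => d1 <-; rewrite derive1E; exact/derivableP.
have dG : is_derive x 1 (fun y => F y - F 0) (f x).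
  by apply: (drvE (drvB dF (drv_cst _ _))); rewrite subr0.
apply: drv_near dG _; near=> t.
have at_ : a < t by near: t; exact: lt_nbhsr.
rewrite /prim /F; case: ifPn => [t0|]; last rewrite -ltNge => t0.
  rewrite Rintegral_itvB//; [|by rewrite bnd_simp ltW..].
  by rewrite Rintegral_itv_obnd_cbnd//; apply: integrableS (intf 0 t) => //; apply: subset_itvr; rewrite bnd_simp.
rewrite -[LHS]opprB; congr (- _).
rewrite Rintegral_itvB//; [|by rewrite bnd_simp ltW..].
by rewrite Rintegral_itv_obnd_cbnd//; apply: integrableS (intf t 0) => //; apply: subset_itvr; rewrite bnd_simp.
Unshelve. all: end_near. Qed.

Lemma prim0 f : prim f 0 = 0.
Proof. by rewrite /prim lexx set_itv1 Rintegral_set1. Qed.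

Lemma primE f t : 0 <= t -> prim f t = \int[mu]_(x in `[0, t]) f x.
Proof. by rewrite /prim => ->. Qed.

End Calculus.

Section ContNonneg.
Variable R : realType.
Implicit Types (f g : R -> R) (x y t : R).

Definition cnn f := forall t, 0 <= t -> {for t, continuous f}.

Lemma cnn_drv f df : (forall t, 0 <= t -> is_derive t 1 f (df t)) -> cnn f.
Proof. by move=> dfE t /dfE/drv_continuous. Qed.

Lemma cnn_cst (c : R) : cnn (fun=> c).
Proof. by move=> t _; exact: cvg_cst. Qed.

Lemma cnn_cont f : continuous f -> cnn f.
Proof. by move=> cf t _; exact: cf. Qed.

Lemma cnnD f g : cnn f -> cnn g -> cnn (fun t => f t + g t).
Proof. by move=> cf cg t t0; apply: cvgD; [exact: cf|exact: cg]. Qed.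

Lemma cnnN f : cnn f -> cnn (fun t => - f t).
Proof. by move=> cf t t0; apply: cvgN; exact: cf. Qed.

Lemma cnnB f g : cnn f -> cnn g -> cnn (fun t => f t - g t).
Proof. by move=> cf cg; apply: cnnD => //; exact: cnnN. Qed.

Lemma cnnM f g : cnn f -> cnn g -> cnn (fun t => f t * g t).
Proof. by move=> cf cg t t0; apply: cvgM; [exact: cf|exact: cg]. Qed.

Lemma cnnX2 f : cnn f -> cnn (fun t => f t ^+ 2).
Proof. by move=> cf; under eq_fun do rewrite expr2; exact: cnnM. Qed.

Lemma cnnV f : (forall t, 0 <= t -> f t != 0) -> cnn f -> cnn (fun t => (f t)^-1).
Proof. by move=> f0 cf t t0; apply: cvgV; [exact: f0|exact: cf]. Qed.

Lemma cnn_sum n (F : 'I_n -> R -> R) : (forall i, cnn (F i)) ->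
  cnn (fun t => \sum_(i < n) F i t).
Proof.
elim: n F => [|n IH] F cF.
  by under eq_fun do rewrite big_ord0; exact: cnn_cst.
by under eq_fun do rewrite big_ord_recr; apply: cnnD; [exact: IH|exact: cF].
Qed.

Lemma cnn_comp (h : R -> R) f : continuous h -> cnn f -> cnn (fun t => h (f t)).
Proof. by move=> ch cf t t0; apply: continuous_comp; [exact: cf|exact: ch]. Qed.

Definition prim0y f := prim (fun t => f `|t|).

Lemma cnn_normr f : cnn f -> continuous (fun t => f `|t|).
Proof.
by move=> cf t; apply: continuous_comp; [exact: norm_continuous|exact: cf].
Qed.

Lemma prim0y_derive f : cnn f -> forall t, 0 <= t -> is_derive t 1 (prim0y f) (f t).
Proof.
by move=> cf t t0; apply: (drvE (prim_derive (cnn_normr cf) t)); rewrite ger0_norm.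
Qed.

Lemma cnn_prim0y f : cnn f -> cnn (prim0y f).
Proof. by move=> cf; apply: cnn_drv => t; exact: prim0y_derive. Qed.

Lemma prim0y0 f : prim0y f 0 = 0.
Proof. exact: prim0. Qed.

Lemma prim0yE f t : 0 <= t ->
  prim0y f t = \int[lebesgue_measure]_(x in `[0, t]) f x.
Proof.
move=> t0; rewrite /prim0y primE//; apply: eq_Rintegral => x.
by rewrite inE/= in_itv/= => /andP[x0 _]; rewrite ger0_norm.
Qed.

Lemma prim0y_unique f F : cnn f -> (forall t, 0 <= t -> is_derive t 1 F (f t)) ->
  forall t, 0 <= t -> prim0y f t = F t - F 0.
Proof.
move=> cf dF t t0; apply/eqP; rewrite eq_sym subr_eq addrC -subr_eq eq_sym; apply/eqP.
rewrite -[LHS]subr0 -[X in _ - X](prim0y0 f).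
apply: (@drv0_cst _ (fun t => F t - prim0y f t)) => // u /andP[u0 _].
by apply: (drvE (drvB (dF _ u0) (prim0y_derive cf u0))); rewrite subrr.
Qed.

Lemma prim0y_eq f g : {in >= 0, f =1 g} -> {in >= 0, prim0y f =1 prim0y g}.
Proof.
move=> fg t t0; rewrite !prim0yE//; apply: eq_Rintegral => x.
by rewrite inE/= in_itv/= => /andP[x0 _]; exact: fg.
Qed.

Lemma prim0y_le f g t : 0 <= t -> cnn f -> cnn g -> (forall u, 0 <= u <= t -> f u <= g u) ->
  prim0y f t <= prim0y g t.
Proof.
move=> t0 cf cg fg; rewrite -subr_ge0 -(subrr (prim0y f 0)).
have -> : prim0y f 0 - prim0y f 0 = prim0y g 0 - prim0y f 0 by rewrite !prim0y0.
apply: (@ndecr_drv _ (fun u => prim0y g u - prim0y f u) (fun u => g u - f u)) => //.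
  by move=> u /andP[u0 _]; apply: drvB; exact: prim0y_derive.
by move=> u /fg; rewrite subr_ge0.
Qed.

Lemma prim0y_ge0 f t : 0 <= t -> cnn f -> (forall u, 0 <= u <= t -> 0 <= f u) -> 0 <= prim0y f t.
Proof.
move=> t0 cf f0; rewrite -(prim0y0 f).
by apply: (@ndecr_drv _ _ f) => // u /andP[u0 _]; exact: prim0y_derive.
Qed.

Lemma prim0y_gt0 f t : 0 < t -> cnn f -> (forall u, 0 <= u <= t -> 0 < f u) -> 0 < prim0y f t.
Proof.
move=> t0 cf f0; rewrite -(prim0y0 f).
by apply: (@incr_drv _ _ f) => // u /andP[u0 _]; exact: prim0y_derive.
Qed.

Lemma prim0yD f g t : 0 <= t -> cnn f -> cnn g ->
  prim0y (fun u => f u + g u) t = prim0y f t + prim0y g t.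
Proof.
move=> t0 cf cg; rewrite (prim0y_unique (cnnD cf cg)
  (fun u u0 => drvD (prim0y_derive cf u0) (prim0y_derive cg u0)))//.
by rewrite !prim0y0 addr0 subr0.
Qed.

Lemma prim0yZ (c : R) f t : 0 <= t -> cnn f -> prim0y (fun u => c * f u) t = c * prim0y f t.
Proof.
move=> t0 cf; rewrite (prim0y_unique (cnnM (@cnn_cst c) cf)
  (fun u u0 => drvZ c (prim0y_derive cf u0)))//.
by rewrite !prim0y0 mulr0 subr0.
Qed.

Lemma prim0y_sum n (F : 'I_n -> R -> R) t : 0 <= t -> (forall i, cnn (F i)) ->
  prim0y (fun u => \sum_(i < n) F i u) t = \sum_(i < n) prim0y (F i) t.
Proof.
move=> t0 cF; rewrite (prim0y_unique (cnn_sum cF)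
  (fun u u0 => drv_sum (fun i => prim0y_derive (cF i) u0)))//.
by rewrite [X in _ - X]big1 ?subr0// => i _; rewrite prim0y0.
Qed.

(* Gronwall's inequality, through the integrating factor [exp (- int k)]. *)
Lemma gronwall (e de k w : R -> R) : cnn k -> cnn w ->
  (forall t, 0 <= t -> 0 <= k t) -> (forall t, 0 <= t -> 0 <= w t) ->
  (forall t, 0 <= t -> is_derive t 1 e (de t)) ->
  (forall t, 0 <= t -> de t <= k t * e t + w t) ->
  forall t, 0 <= t -> e t <= (e 0 + prim0y w t) * expR (prim0y k t).
Proof.
move=> ck cw k0 w0 dE deb t t0; rewrite -ler_pdivrMr ?expR_gt0// -expRN.
rewrite -lerBlDl.
pose g u := prim0y w u - e u * expR (- prim0y k u).
have dg (u : R) : 0 <= u ->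
    is_derive u 1 g (w u - (de u - k u * e u) * expR (- prim0y k u)).
  move=> u0.
  have H := drvM (dE _ u0) (drv_exp (drvN (prim0y_derive ck u0))).
  by apply: (drvE (drvB (prim0y_derive cw u0) H)); ring.
have : g 0 <= g t.
  apply: (ndecr_drv t0); first by move=> u /andP[u0 _]; exact: dg.
  move=> u /andP[u0 _]; rewrite subr_ge0.
  have ek : expR (- prim0y k u) <= 1.
    rewrite -expR0 ler_expR oppr_le0; apply: prim0y_ge0 => // v /andP[v0 _]; exact: k0.
  apply: (@le_trans _ _ (w u * expR (- prim0y k u))).
    by rewrite ler_wpM2r ?expR_ge0// lerBlDl deb.
  by rewrite ler_piMr// w0.
rewrite /g !prim0y0 oppr0 expR0; lra.
Qed.

Lemma linear_ode0 (v k : R -> R) : cnn k ->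
  (forall t, 0 <= t -> is_derive t 1 v (k t * v t)) -> v 0 = 0 ->
  forall t, 0 <= t -> v t = 0.
Proof.
move=> ck dv v0 t t0.
have : v 0 * expR (- prim0y k 0) = v t * expR (- prim0y k t).
  apply: (@drv0_cst _ (fun u => v u * expR (- prim0y k u))) => // u /andP[u0 _].
  by apply: (drvE (drvM (dv _ u0) (drv_exp (drvN (prim0y_derive ck u0))))); ring.
rewrite v0 mul0r => /esym/eqP; rewrite mulf_eq0 => /orP[/eqP//|].
by rewrite gt_eqF// expR_gt0.
Qed.

End ContNonneg.

Section Sinc.
Variable R : realType.
Implicit Types x y z : R.

Definition sinc z : R := if z == 0 then 1 else sin z / z.

Lemma sincE z : sin z = sinc z * z.
Proof.
rewrite /sinc; case: eqVneq => [->|z0]; first by rewrite sin0 mulr0.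
by rewrite mulfVK.
Qed.

Lemma continuous_sinc : continuous sinc.
Proof.
move=> z; have [->|z0] := eqVneq z 0; last first.
  have h : {for z, continuous (fun u : R => sin u / u)}.
    by apply: cvgM; [exact: continuous_sin|apply: cvgV => //; exact: cvg_id].
  rewrite /prop_for /continuous_at {2}/sinc (negbTE z0).
  apply: cvg_trans h; apply: near_eq_cvg; near=> u.
  have u0 : u != 0 by near: u; apply: open_neq.
  by rewrite /sinc (negbTE u0).
apply/continuous_withinNx; rewrite /sinc eqxx.
have [d0 d1] := is_derive_sin (0 : R).
rewrite /= in d1; move: d0; rewrite /derivable => d0.
have h : h^-1 *: (sin (h *: 1 + 0) - sin 0) @[h --> (0:R)^'] --> cos (0 : R).
  by rewrite -d1 /derive; exact: d0.
rewrite cos0 in h.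
apply: cvg_trans h; apply: near_eq_cvg; near=> u.
have u0 : u != 0 by near: u; exact: nbhs_dnbhs_neq.
by rewrite (negbTE u0) sin0 subr0 addr0 /GRing.scale/= mulr1 mulrC.
Unshelve. all: end_near. Qed.

Lemma sinc_le1 z : `|sinc z| <= 1.
Proof.
rewrite /sinc; case: eqVneq => [_|z0]; first by rewrite normr1.
have key x : 0 < x -> `|sin x| <= x.
  move=> x0; rewrite ler_norml; apply/andP; split.
  - rewrite -subr_ge0 opprK.
    have := @ndecr_drv R (fun t => sin t + t) (fun t => 1 * cos t + 1) 0 x (ltW x0).
    rewrite sin0 add0r; apply=> t _.
      exact: (drvD (drv_sin (drv_id _)) (drv_id _)).
    by rewrite mul1r; have := cos_geN1 t; lra.
  - rewrite -subr_ge0.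
    have := @ndecr_drv R (fun t => t - sin t) (fun t => 1 - 1 * cos t) 0 x (ltW x0).
    rewrite sin0 subr0; apply=> t _.
      exact: (drvB (drv_id _) (drv_sin (drv_id _))).
    by rewrite mul1r; have := cos_le1 t; lra.
rewrite normrM normfV ler_pdivrMr ?normr_gt0// mul1r.
have [zn|zp|zz] := ltrgtP z 0; last by rewrite zz eqxx in z0.
  by rewrite (ltr0_norm zn) -normrN -sinN key// oppr_gt0.
by rewrite (gtr0_norm zp) key.
Qed.

Lemma sin_eq0_nat y : 0 <= y -> sin y = 0 -> exists N : nat, y = N%:R * pi.
Proof.
move=> y0 sy; have pi0 := pi_gt0 R.
have [n] : exists n : nat, y < n%:R * pi.
  exists (Num.bound (y / pi)); rewrite -ltr_pdivrMr//.
  by apply: archi_boundP; rewrite divr_ge0// ltW.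
elim: n y y0 sy => [|n IH] y y0 sy; first by rewrite mul0r ltNge y0.
move=> yn; have [ypi|piy] := ltP y pi.
  exists 0; rewrite mul0r; apply/eqP; rewrite eq_le y0 andbT leNgt.
  by apply/negP => yp; have := @sin_gt0_pi R y; rewrite yp ypi sy ltxx => /(_ isT).
have [|||N e] := IH (y - pi).
- by rewrite subr_ge0.
- by rewrite sinB sinpi cospi sy; ring.
- by rewrite ltrBlDr; move: yn; rewrite -natr1 mulrDl mul1r.
by exists N.+1; rewrite -natr1 mulrDl mul1r -e subrK.
Qed.

Lemma cos_eq0_nat y : 0 <= y -> cos y = 0 -> exists N : nat, y = pi / 2 + N%:R * pi.
Proof.
move=> y0 cy; have pi0 := pi_gt0 R.
have [||[|N] e] := @sin_eq0_nat (y + pi / 2); first by rewrite addr_ge0// divr_ge0// ltW.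
- by rewrite sinDpihalf.
- have h : 0 < y + pi / 2 by rewrite ltr_wpDl// divr_gt0.
  by move: h; rewrite e mul0r ltxx.
by exists N; apply: (addIr (pi / 2)); rewrite e -natr1; field.
Qed.

Lemma sin_natpi (N : nat) : sin (N%:R * pi : R) = 0.
Proof.
elim: N => [|N IH]; first by rewrite mul0r sin0.
by rewrite -natr1 mulrDl mul1r sinD IH sinpi mul0r mulr0 addr0.
Qed.

End Sinc.

Record sturm (R : realType) (p : R -> R) (a b : R -> R -> R) : Prop := {
  sturm_cont : cnn p;
  sturm_gt0 : forall t : R, 0 <= t -> 0 < p t;
  sturm_da : forall x t : R, 0 <= t -> is_derive t 1 (a x) (- (x * b x t / p t));
  sturm_db : forall x t : R, 0 <= t -> is_derive t 1 (b x) (x * (p t * a x t));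
  sturm_a0 : forall x : R, a x 0 = 1;
  sturm_b0 : forall x : R, b x 0 = 0 }.

Section Pruefer.
Variables (R : realType) (p : R -> R) (a b : R -> R -> R).
Hypothesis S : sturm p a b.
Implicit Types x y t : R.

Let p0 t : 0 <= t -> 0 < p t. Proof. exact: (sturm_gt0 S). Qed.
Let pn0 t : 0 <= t -> p t != 0. Proof. by move=> /p0; rewrite lt0r => /andP[]. Qed.
Let cp : cnn p := sturm_cont S.
Lemma sturm_ca x : cnn (a x). Proof. exact: cnn_drv (sturm_da S x). Qed.
Lemma sturm_cb x : cnn (b x). Proof. exact: cnn_drv (sturm_db S x). Qed.
Lemma sturm_cVp : cnn (fun t => (p t)^-1). Proof. exact: cnnV pn0 cp. Qed.
Let ca := sturm_ca. Let cb := sturm_cb. Let cVp := sturm_cVp.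

Definition pruefer_amp x t := a x t ^+ 2 + b x t ^+ 2.
Local Notation e := pruefer_amp.

Definition sturm_bound t := p t + (p t)^-1.
Local Notation q := sturm_bound.

Lemma sturm_boundP t : 0 <= t -> [/\ 0 < q t, p t <= q t, (p t)^-1 <= q t,
  1 <= p t * q t & 1 <= (p t)^-1 * q t].
Proof.
move=> t0; have pt := p0 t0; have pV : 0 < (p t)^-1 by rewrite invr_gt0.
rewrite /q; split; rewrite ?lerDl ?lerDr ?(ltW pt) ?(ltW pV)//; first exact: addr_gt0.
  by rewrite mulrDr mulfV ?pn0// lerDr mulr_ge0// ltW.
by rewrite mulrDr mulVf ?pn0// lerDl mulr_ge0// ltW.
Qed.

Lemma sturm_cbound : cnn q. Proof. exact: cnnD cp cVp. Qed.

Lemma pruefer_amp_derive x t : 0 <= t ->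
  is_derive t 1 (e x) (2 * (x * (a x t * b x t * (p t - (p t)^-1)))).
Proof.
move=> t0; apply: (drvE (drvD (drvX2 (sturm_da S x t0)) (drvX2 (sturm_db S x t0)))).
by field; exact: pn0.
Qed.

Lemma pruefer_amp_gt0 x t : 0 <= t -> 0 < e x t.
Proof.
move=> t0; pose k u := `|x| * q u.
have ck : cnn k by apply: cnnM; [exact: cnn_cst|exact: sturm_cbound].
have H := @ndecr_drv R (fun u => e x u * expR (prim0y k u))
  (fun u => (2 * (x * (a x u * b x u * (p u - (p u)^-1))) + k u * e x u) * expR (prim0y k u))
  0 t t0.
suff : e x 0 * expR (prim0y k 0) <= e x t * expR (prim0y k t).
  rewrite prim0y0 expR0 /e (sturm_a0 S) (sturm_b0 S) => h.
  by have : 0 < e x t * expR (prim0y k t); [apply: lt_le_trans h; lra|rewrite pmulr_lgt0 ?expR_gt0].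
apply: H => u /andP[u0 _].
  apply: (drvE (drvM (pruefer_amp_derive x u0) (drv_exp (prim0y_derive ck u0)))).
  by rewrite mulrDl; ring.
rewrite mulr_ge0 ?expR_ge0// /k /e /q.
have pu := p0 u0; have pV : 0 < (p u)^-1 by rewrite invr_gt0.
set A := a x u; set B := b x u; move: pV; set v := (p u)^-1; move=> pV.
case: (ger0P x) => x0.
  have -> : 2 * (x * (A * B * (p u - v))) + x * (p u + v) * (A ^+ 2 + B ^+ 2) =
    x * (p u * (A + B) ^+ 2 + v * (A - B) ^+ 2) by ring.
  by rewrite mulr_ge0// addr_ge0// mulr_ge0 ?sqr_ge0// ltW.
have -> : 2 * (x * (A * B * (p u - v))) + - x * (p u + v) * (A ^+ 2 + B ^+ 2) =
    - x * (p u * (A - B) ^+ 2 + v * (A + B) ^+ 2) by ring.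
by rewrite mulr_ge0 ?oppr_ge0 ?(ltW x0)// addr_ge0// mulr_ge0 ?sqr_ge0// ltW.
Qed.

Let en0 x t : 0 <= t -> e x t != 0.
Proof. by move=> /(pruefer_amp_gt0 x); rewrite lt0r => /andP[]. Qed.

Let ce x : cnn (e x). Proof. by apply: cnnD; apply: cnnX2. Qed.

Let w x t := x * (p t * a x t ^+ 2 + b x t ^+ 2 / p t) / e x t.

Let cw x : cnn (w x).
Proof.
apply: cnnM; last by apply: cnnV => //; exact: en0.
apply: cnnM; first exact: cnn_cst.
by apply: cnnD; apply: cnnM => //; exact: cnnX2.
Qed.

Definition pruefer_angle x := prim0y (w x).
Local Notation th := pruefer_angle.

Let dth x t : 0 <= t -> is_derive t 1 (th x) (w x t).
Proof. exact: (prim0y_derive (@cw x)). Qed.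

Lemma pruefer_angle0 x : th x 0 = 0. Proof. exact: prim0y0. Qed.

Let cth x : cnn (th x). Proof. by apply: cnn_prim0y; exact: cw. Qed.

Lemma pruefer_polar x t : 0 <= t -> exists2 u, u != 0 &
  a x t = u * cos (th x t) /\ b x t = u * sin (th x t).
Proof.
move=> t0.
pose v s := b x s * cos (th x s) - a x s * sin (th x s).
pose k s := x * a x s * b x s * (p s - (p s)^-1) / e x s.
have ck : cnn k.
  apply: cnnM; last by apply: cnnV => //; exact: en0.
  by apply: cnnM; [apply: cnnM => //; apply: cnnM => //; exact: cnn_cst|exact: cnnB].
have v0 : v t = 0.
  apply: (@linear_ode0 _ v k) => //; last first.
    by rewrite /v pruefer_angle0 sin0 (sturm_b0 S) mulr0 mul0r subrr.
  move=> s s0; apply: (drvE (drvB (drvM (sturm_db S x s0) (drv_cos (dth x s0)))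
                         (drvM (sturm_da S x s0) (drv_sin (dth x s0))))).
  have := en0 x s0; rewrite /v /k /w /e => E0.
  by field; rewrite E0 pn0.
exists (a x t * cos (th x t) + b x t * sin (th x t)).
  apply: contra_neq (en0 x t0) => u0.
  have : e x t = v t ^+ 2 + (a x t * cos (th x t) + b x t * sin (th x t)) ^+ 2.
    rewrite /e /v; have := cos2Dsin2 (th x t); set c := cos _; set s := sin _ => cs.
    transitivity ((a x t ^+ 2 + b x t ^+ 2) * (c ^+ 2 + s ^+ 2)); first by rewrite cs mulr1.
    by ring.
  by rewrite u0 v0 expr0n addr0.
move: v0; rewrite /v => /eqP; rewrite subr_eq0 => /eqP.
have := cos2Dsin2 (th x t); set c := cos _; set s := sin _ => cs vE.
split.
  rewrite mulrDl -(mulrA (b x t)) (mulrC s) mulrA vE -mulrA -mulrA -mulrDr.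
  by rewrite -!expr2 cs mulr1.
rewrite mulrDl -(mulrA (a x t)) (mulrC c) mulrA -vE -mulrA -mulrA -mulrDr.
by rewrite -!expr2 cs mulr1.
Qed.

Let f t z := p t * cos z ^+ 2 + sin z ^+ 2 / p t.

Lemma pruefer_angle_derive x t : 0 <= t -> is_derive t 1 (th x) (x * f t (th x t)).
Proof.
move=> t0; apply: (drvE (dth x t0)).
have [u u0 [aE bE]] := pruefer_polar x t0.
rewrite /w /e /f aE bE; set c := cos _; set s := sin _.
have cs : c ^+ 2 + s ^+ 2 = 1 := cos2Dsin2 _.
have -> : (u * c) ^+ 2 + (u * s) ^+ 2 = u ^+ 2 * (c ^+ 2 + s ^+ 2) by ring.
by rewrite cs mulr1; field; rewrite u0 pn0.
Qed.

Lemma pruefer_speed t z : 0 <= t -> (q t)^-1 <= f t z <= q t.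
Proof.
move=> t0; have [q0 pq vq pq1 vq1] := sturm_boundP t0.
have pt := p0 t0; have pV : 0 < (p t)^-1 by rewrite invr_gt0.
rewrite /f; have : cos z ^+ 2 + sin z ^+ 2 = 1 := cos2Dsin2 _.
have := sqr_ge0 (cos z); have := sqr_ge0 (sin z).
set c := cos z ^+ 2; set s := sin z ^+ 2 => s0 c0 cs.
have sE : s = 1 - c by rewrite -cs; ring.
rewrite -[X in X <= _]mul1r ler_pdivrMr//; apply/andP; split.
  rewrite mulrDl -mulrA [c * _]mulrC mulrA -[s / _ * _]mulrA.
  rewrite -[X in X <= _]cs; apply: lerD; first by rewrite ler_peMl.
  by rewrite ler_peMr.
apply: (@le_trans _ _ (q t * c + s * q t)).
  by apply: lerD; [rewrite ler_wpM2r|rewrite ler_wpM2l].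
by rewrite [s * _]mulrC -mulrDr cs mulr1.
Qed.

Lemma pruefer_angle_incr x s t : 0 < x -> 0 <= s -> s < t -> th x s < th x t.
Proof.
move=> x0 s0 st; apply: (incr_drv st (df := fun t => x * f t (th x t))).
  by move=> u /andP[su _]; apply: pruefer_angle_derive; exact: le_trans su.
move=> u /andP[su _]; have u0 : 0 <= u by exact: le_trans su.
have [q0 _ _ _ _] := sturm_boundP u0.
have /andP[h _] := pruefer_speed (th x u) u0.
by rewrite mulr_gt0// (lt_le_trans _ h)// invr_gt0.
Qed.

Let qV_cont : cnn (fun t => (q t)^-1).
Proof.
by apply: cnnV sturm_cbound => t /sturm_boundP[+ _ _ _ _]; rewrite lt0r => /andP[].
Qed.

Let cf x : cnn (fun t => x * f t (th x t)).
Proof.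
apply: cnnM; first exact: cnn_cst.
apply: cnnD; apply: cnnM => //; apply: cnnX2; apply: cnn_comp => //.
  exact: continuous_cos.
exact: continuous_sin.
Qed.

Lemma pruefer_angle_ge x t : 0 <= x -> 0 <= t -> x * prim0y (fun u => (q u)^-1) t <= th x t.
Proof.
move=> x0 t0; rewrite -prim0yZ//.
rewrite -[th x t]subr0 -[X in _ - X](pruefer_angle0 x).
rewrite -(prim0y_unique (@cf x) (pruefer_angle_derive x))//.
apply: prim0y_le => //; first by apply: cnnM => //; exact: cnn_cst.
by move=> u /andP[u0 _]; rewrite ler_wpM2l//; have /andP[] := pruefer_speed (th x u) u0.
Qed.

Lemma pruefer_angle_le x t : 0 <= x -> 0 <= t -> th x t <= x * prim0y q t.
Proof.
move=> x0 t0; have cq := sturm_cbound; rewrite -prim0yZ//.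
rewrite -[th x t]subr0 -[X in _ - X](pruefer_angle0 x).
rewrite -(prim0y_unique (@cf x) (pruefer_angle_derive x))//.
apply: prim0y_le => //; first by apply: cnnM => //; exact: cnn_cst.
by move=> u /andP[u0 _]; rewrite ler_wpM2l//; have /andP[] := pruefer_speed (th x u) u0.
Qed.

(* [sin^2 A - sin^2 B = sin (A - B) sin (A + B)], so the difference of two
   angles solves a linear equation with a positive source term. *)
Lemma pruefer_angle_diff x y t : 0 <= x -> x < y -> 0 <= t ->
  let d s := th y s - th x s in
  (0 < t -> 0 < d t) /\
  d t <= (y - x) * prim0y q t * expR (prim0y (fun s => y * q s) t).
Proof.
move=> x0 xy t0 d.
pose k s := x * ((p s)^-1 - p s) * sin (th y s + th x s) * sinc (d s).
pose g s := (y - x) * f s (th y s).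
have yx : 0 < y - x by rewrite subr_gt0.
have cd : cnn d by exact: cnnB.
have ck : cnn k.
  apply: cnnM; last by apply: cnn_comp => //; exact: continuous_sinc.
  apply: cnnM; last by apply: cnn_comp; [exact: continuous_sin|exact: cnnD].
  by apply: cnnM; [exact: cnn_cst|exact: cnnB].
have dd (s : R) : 0 <= s -> is_derive s 1 d (k s * d s + g s).
  move=> s0; apply: (drvE (drvB (pruefer_angle_derive y s0) (pruefer_angle_derive x s0))).
  rewrite /k -mulrA -mulrA -sincE /d sinB sinD /g /f.
  have := cos2Dsin2 (th y s); have := cos2Dsin2 (th x s).
  set c1 := cos (th x s); set s1 := sin (th x s); set c2 := cos _; set s2 := sin _.
  move=> h1 h2; have -> : c1 ^+ 2 = 1 - s1 ^+ 2 by rewrite -h1; ring.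
  have -> : c2 ^+ 2 = 1 - s2 ^+ 2 by rewrite -h2; ring.
  have -> : (s2 * c1 + c2 * s1) * (s2 * c1 - c2 * s1) = s2 ^+ 2 * c1 ^+ 2 - c2 ^+ 2 * s1 ^+ 2 by ring.
  have -> : c1 ^+ 2 = 1 - s1 ^+ 2 by rewrite -h1; ring.
  have -> : c2 ^+ 2 = 1 - s2 ^+ 2 by rewrite -h2; ring.
  by ring.
have g0 s : 0 <= s -> 0 < g s.
  move=> s0; have [qs _ _ _ _] := sturm_boundP s0.
  have /andP[h _] := pruefer_speed (th y s) s0.
  by rewrite mulr_gt0// (lt_le_trans _ h)// invr_gt0.
have d0 : d 0 = 0 by rewrite /d !pruefer_angle0 subrr.
have dpos s : 0 < s -> 0 < d s.
  move=> s0.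
  have : d 0 * expR (- prim0y k 0) < d s * expR (- prim0y k s).
    apply: (incr_drv (f := fun u => d u * expR (- prim0y k u))
      (df := fun u => g u * expR (- prim0y k u))) => // u /andP[u0 _].
      by apply: (drvE (drvM (dd _ u0) (drv_exp (drvN (prim0y_derive ck u0))))); ring.
    by rewrite mulr_gt0 ?expR_gt0// g0.
  by rewrite d0 mul0r pmulr_lgt0// expR_gt0.
split; first exact: dpos.
have cq := sturm_cbound.
have cK (z : R) : cnn (fun s => z * q s) by apply: cnnM => //; exact: cnn_cst.
have H := gronwall (e := d) (de := fun s => k s * d s + g s)
  (k := fun s => y * q s) (w := fun s => (y - x) * q s) (@cK y) (@cK (y - x)).
have := H _ _ dd _ t t0; rewrite d0 add0r prim0yZ//; apply.
- move=> s s0; have [qs _ _ _ _] := sturm_boundP s0.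
  by rewrite mulr_ge0 ?(ltW qs)// (le_trans x0 (ltW xy)).
- move=> s s0; have [qs _ _ _ _] := sturm_boundP s0.
  by rewrite mulr_ge0 ?(ltW qs)// ltW.
move=> s s0; have [qs pq vq _ _] := sturm_boundP s0.
have pt := p0 s0; have pV : 0 < (p s)^-1 by rewrite invr_gt0.
have ds : 0 <= d s.
  by move: s0; rewrite le_eqVlt => /predU1P[<-|/dpos/ltW//]; rewrite d0.
apply: lerD; last first.
  by rewrite /g ler_wpM2l ?(ltW yx)//; have /andP[] := pruefer_speed (th y s) s0.
rewrite ler_wpM2r//; apply: (le_trans (ler_norm _)).
rewrite /k !normrM (ger0_norm x0).
apply: (@le_trans _ _ (x * `|(p s)^-1 - p s|)).
  rewrite -[leRHS]mulr1; apply: ler_pM; rewrite ?sinc_le1 ?mulr_ge0//.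
  by rewrite -[leRHS]mulr1 ler_wpM2l ?mulr_ge0// sin_max.
apply: ler_pM; rewrite ?(ltW xy)// /q ler_norml.
by apply/andP; split; move: pt pV; set v := _^-1; lra.
Qed.

End Pruefer.

Section Eigenvalues.
Variables (R : realType) (p : R -> R) (a b : R -> R -> R).
Hypothesis S : sturm p a b.
Variable r : R.
Hypothesis r0 : 0 < r.
Implicit Types x y t : R.
Local Notation th := (pruefer_angle p a b).
Local Notation q := (sturm_bound p).

Lemma pruefer_angle_homo x y : 0 <= x -> x < y -> th x r < th y r.
Proof.
move=> x0 xy; have [+ _] := pruefer_angle_diff S x0 xy (ltW r0).
by rewrite r0 subr_gt0; apply.
Qed.

Lemma pruefer_angle0l : th 0 r = 0.
Proof.
apply/eqP; rewrite eq_le.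
have := pruefer_angle_le S (lexx 0) (ltW r0).
have := pruefer_angle_ge S (lexx 0) (ltW r0).
by rewrite !mul0r => -> ->.
Qed.

Lemma prim_bound_gt0 : 0 < prim0y q r.
Proof.
apply: prim0y_gt0 => //; first exact: sturm_cbound S.
by move=> u /andP[u0 _]; have [] := sturm_boundP S u0.
Qed.

Lemma prim_boundV_gt0 : 0 < prim0y (fun u => (q u)^-1) r.
Proof.
apply: prim0y_gt0 => //.
  apply: cnnV (sturm_cbound S) => t /(sturm_boundP S)[].
  by rewrite lt0r => /andP[].
by move=> u /andP[u0 _]; rewrite invr_gt0; have [] := sturm_boundP S u0.
Qed.

Lemma pruefer_angle_continuous X : {within `[0, X], continuous (fun x => th x r)}.
Proof.
pose C := prim0y q r * expR (prim0y (fun s => X * q s) r).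
have lip x y : 0 <= x -> x <= y -> y <= X -> `|th y r - th x r| <= C * (y - x).
  move=> x0; rewrite le_eqVlt => /predU1P[->|xy yX].
    by rewrite !subrr normr0 mulr0.
  rewrite ger0_norm; last by rewrite subr_ge0 ltW// pruefer_angle_homo.
  have [_ H] := pruefer_angle_diff S x0 xy (ltW r0); apply: (le_trans H).
  rewrite /C -mulrA [leRHS]mulrC ler_wpM2l ?subr_ge0 ?(ltW xy)//.
  rewrite ler_wpM2l ?(ltW prim_bound_gt0)// ler_expR.
  have cK z : cnn (fun s => z * q s).
    by apply: cnnM; [exact: cnn_cst|exact: sturm_cbound S].
  apply: prim0y_le => //; first exact: ltW.
  move=> u /andP[u0 _]; rewrite ler_wpM2r//.
  by have [/ltW] := sturm_boundP S u0.
have C0 : 0 < C by rewrite mulr_gt0 ?expR_gt0// prim_bound_gt0.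
apply/subspace_continuousP => x /=; rewrite in_itv/= => /andP[x0 xX].
apply/cvgrPdist_lt => e e0; have eC : 0 < e / C by rewrite divr_gt0.
rewrite near_withinE; near=> y.
rewrite /= in_itv/= => /andP[y0 yX].
apply: (@le_lt_trans _ _ (C * `|x - y|)).
  case: (leP x y) => xy.
    by rewrite distrC [`|x - y|]distrC (ger0_norm (x := y - x)) ?subr_ge0// lip.
  by rewrite [X in _ <= _ * X]ger0_norm ?subr_ge0 ?(ltW xy)// lip// ltW.
rewrite mulrC -ltr_pdivlMr//.
Unshelve. all: end_near. Qed.

Lemma pruefer_angle_surj v : 0 <= v -> exists2 x, 0 <= x & th x r = v.
Proof.
move=> v0; set c := prim0y (fun u => (q u)^-1) r.
have c0 : 0 < c := prim_boundV_gt0.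
have X0 : 0 <= v / c by rewrite divr_ge0// ltW.
have vX : v <= th (v / c) r.
  by have := pruefer_angle_ge S X0 (ltW r0); rewrite -/c divfK// gt_eqF.
have [] := @IVT R (fun x => th x r) 0 (v / c) v X0 (@pruefer_angle_continuous _).
  by rewrite pruefer_angle0l ge_min le_max v0 vX orbT.
by move=> x; rewrite in_itv/= => /andP[x0 _] e; exists x.
Qed.

Lemma sturm_eigenvalues : exists2 lam : nat -> R,
  (forall n, 0 < lam n /\ th (lam n) r = pi / 2 + n%:R * pi) &
  [/\ {homo lam : m n / (m < n)%N >-> m < n},
      forall x, (0 < x /\ a x r = 0) <-> exists n, lam n = x &
      forall n, pi * n%:R <= lam n * prim0y q r].
Proof.
have pi0 := pi_gt0 R.
pose P n x := 0 <= x /\ th x r = pi / 2 + n%:R * pi.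
have tgt n : 0 < pi / 2 + n%:R * pi :> R.
  by rewrite ltr_wpDr ?divr_gt0// mulr_ge0// ltW.
have exP n : {x | P n x}.
  apply: cid; have [x x0 e] := pruefer_angle_surj (ltW (tgt n)).
  by exists x.
pose lam n := sval (exP n).
have lamP n : 0 < lam n /\ th (lam n) r = pi / 2 + n%:R * pi.
  have [l0 e] := svalP (exP n); split => //.
  rewrite lt_neqAle l0 andbT; apply/eqP => h.
  by have := tgt n; rewrite -e -/(lam n) -h pruefer_angle0l ltxx.
have lamH : {homo lam : m n / (m < n)%N >-> m < n}.
  move=> m n mn; have [m0 em] := lamP m; have [n0 en] := lamP n.
  have [//|nm|e] := ltgtP (lam m) (lam n).
    have := pruefer_angle_homo (ltW n0) nm; rewrite em en ltrD2l ltr_pM2r// ltr_nat => h.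
    by have := ltn_trans mn h; rewrite ltnn.
  by move: em; rewrite e en => /addrI/(mulIf (lt0r_neq0 pi0))/eqP; rewrite eqr_nat gtn_eqF.
exists lam => //; split => // [x|n]; last first.
  have [l0 e] := lamP n; have := pruefer_angle_le S (ltW l0) (ltW r0).
  by apply: le_trans; rewrite e mulrC lerDr divr_ge0// ltW.
split=> [[x0 ax]|[n <-]]; last first.
  have [l0 e] := lamP n; split => //.
  have [u _ [-> _]] := pruefer_polar S (lam n) (ltW r0).
  by rewrite e cosD cos_pihalf sin_natpi mulr0 mul0r subrr mulr0.
have [u u0 [+ _]] := pruefer_polar S x (ltW r0).
rewrite ax => /esym/eqP; rewrite mulf_eq0 (negbTE u0)/= => /eqP/cos_eq0_nat[|n e].
  by rewrite -pruefer_angle0l ltW// pruefer_angle_homo.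
exists n; have [l0 en] := lamP n.
have [h|h|//] := ltgtP (lam n) x.
  by have := pruefer_angle_homo (ltW l0) h; rewrite e en ltxx.
by have := pruefer_angle_homo (ltW x0) h; rewrite e en ltxx.
Qed.

(* The positive zeros in time of the [N]-th eigenfunction are the points where
   the Pruefer angle equals [pi], ..., [N pi]. *)
Lemma sturm_nodes x N : 0 < x -> th x r = pi / 2 + N%:R * pi ->
  exists t : 'I_N -> R, (forall j, 0 <= t j) /\
    forall s, 0 < s -> s <= r -> b x s = 0 -> exists j, s = t j.
Proof.
move=> x0 thr; have pi0 := pi_gt0 R.
pose P (j : nat) s := 0 <= s /\ (forall s', 0 < s' -> s' <= r -> th x s' = j.+1%:R * pi -> s' = s).
have exP (j : 'I_N) : {s | P j s}.
  apply: cid; have [[s [s0 sr e]]|h] := pselect (exists s, [/\ 0 < s, s <= r & th x s = j.+1%:R * pi]).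
    exists s; split; rewrite ?ltW// => s' s'0 s'r e'.
    have [h|h|//] := ltgtP s' s.
      by have := pruefer_angle_incr S x0 (ltW s'0) h; rewrite e e' ltxx.
    by have := pruefer_angle_incr S x0 (ltW s0) h; rewrite e e' ltxx.
  exists 0; split=> // s' ? ? ?; exfalso; apply: h; by exists s'.
exists (fun j => sval (exP j)); split=> [j|s s0 sr bs]; first by have [] := svalP (exP j).
have [u u0 [_ bE]] := pruefer_polar S x (ltW s0).
have sth : th x s > 0.
  by rewrite -(pruefer_angle0 p a b x) (pruefer_angle_incr S).
have [|[|j] e] := @sin_eq0_nat R (th x s) (ltW sth).
- by move: bs; rewrite bE => /eqP; rewrite mulf_eq0 (negbTE u0) => /eqP.
- by move: sth; rewrite e mul0r ltxx.
have jN : (j < N)%N.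
  have : th x s <= th x r.
    by move: sr; rewrite le_eqVlt => /predU1P[->//|sr]; rewrite ltW// (pruefer_angle_incr S)// ltW.
  rewrite e thr => h; rewrite -(ltr_nat R) -(ltr_pM2r pi0).
  by move: h; rewrite -natr1 mulrDl; lra.
by exists (Ordinal jN); have [_] := svalP (exP (Ordinal jN)); apply.
Qed.

End Eigenvalues.

Section LocalLipschitz.
Variable R : realType.
Implicit Types (f g : R -> R) (x t : R).

Definition lip_at f x := exists2 C, 0 <= C & \forall t \near x, `|f t - f x| <= C * `|t - x|.

Lemma drv_near_linear f x d : is_derive x 1 f d -> forall e, 0 < e ->
  \forall t \near x, `|f t - f x - d * (t - x)| <= e * `|t - x|.
Proof.
move=> [df dE] e e0.
have h : h^-1 *: (f (h *: 1 + x) - f x) @[h --> (0:R)^'] --> d by rewrite -dE; exact: df.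
move/cvgrPdist_le : h => /(_ _ e0); rewrite near_withinE => /nbhs_ballP[del /= del0 H].
apply/nbhs_ballP; exists del => //= t; rewrite /ball/= => xt.
have [->|tx] := eqVneq t x; first by rewrite !subrr mulr0 subrr normr0 mulr0.
have tx0 : t - x != 0 by rewrite subr_eq0.
have le : `|d - (t - x)^-1 * (f t - f x)| <= e.
  have := H (t - x); rewrite /GRing.scale/= mulr1 subrK; apply => //.
  by rewrite /ball/= sub0r normrN distrC.
have -> : f t - f x - d * (t - x) = - ((d - (t - x)^-1 * (f t - f x)) * (t - x)) by field.
by rewrite normrN normrM ler_wpM2r.
Qed.

Lemma drv_lip f x d : is_derive x 1 f d -> lip_at f x.
Proof.
move=> /drv_near_linear/(_ 1 ltr01) H; exists (`|d| + 1); first by rewrite addr_ge0.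
apply: filterS H => t le; rewrite mulrDl.
have -> : f t - f x = d * (t - x) + (f t - f x - d * (t - x)) by ring.
by apply: (le_trans (ler_normD _ _)); apply: lerD => //; rewrite normrM.
Qed.

Lemma lip_continuous f x : lip_at f x -> {for x, continuous f}.
Proof.
move=> [C C0 H]; apply/cvgrPdist_le => e e0.
have d0 : 0 < e / (C + 1) by rewrite divr_gt0// ltr_wpDl.
near=> t; rewrite distrC; apply: (@le_trans _ _ (C * `|t - x|)); first by near: t.
apply: (@le_trans _ _ ((C + 1) * `|t - x|)); first by rewrite ler_wpM2r// lerDl.
rewrite mulrC -ler_pdivlMr ?ltr_wpDl// distrC ltW//.
Unshelve. all: end_near. Qed.

Lemma lipD f g x : lip_at f x -> lip_at g x -> lip_at (fun t => f t + g t) x.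
Proof.
move=> [C C0 fC] [D D0 gD]; exists (C + D); first exact: addr_ge0.
near=> t; rewrite opprD addrACA mulrDl.
apply: (le_trans (ler_normD _ _)); apply: lerD; first by near: t.
by near: t.
Unshelve. all: end_near. Qed.

Lemma lipZ (c : R) f x : lip_at f x -> lip_at (fun t => c * f t) x.
Proof.
move=> [C C0 fC]; exists (`|c| * C); first exact: mulr_ge0.
by apply: filterS fC => t; rewrite -mulrBr normrM -mulrA; exact: ler_wpM2l.
Qed.

Lemma lip_sum n (F : 'I_n -> R -> R) x : (forall i, lip_at (F i) x) ->
  lip_at (fun t => \sum_(i < n) F i t) x.
Proof.
elim: n F => [|n IH] F FC.
  by exists 0 => //; near=> t; rewrite !big_ord0 subrr normr0 mul0r.
under eq_fun do rewrite big_ord_recr.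
by apply: lipD; [exact: IH|exact: FC].
Unshelve. all: end_near. Qed.

Lemma min_lip s x t : `|Num.min s t - Num.min s x| <= `|t - x|.
Proof.
case: (leP s t) => st; case: (leP s x) => sx.
- by rewrite subrr normr0.
- rewrite ger0_norm; last by rewrite subr_ge0 ltW.
  rewrite ger0_norm; last by rewrite subr_ge0 (le_trans (ltW sx)).
  by rewrite lerD2r.
- rewrite ler0_norm; last by rewrite subr_le0 ltW.
  rewrite ler0_norm; last by rewrite subr_le0 (le_trans (ltW st)).
  by rewrite lerN2 lerD2l lerN2.
- by [].
Qed.

Lemma lip_min f s x : lip_at f (Num.min s x) -> lip_at (fun t => f (Num.min s t)) x.
Proof.
move=> [C C0 /nbhs_ballP[e /= e0 H]]; exists C => //.
apply/nbhs_ballP; exists e => //= t; rewrite /ball/= distrC => te.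
apply: (@le_trans _ _ (C * `|Num.min s t - Num.min s x|)); last first.
  by rewrite ler_wpM2l// min_lip.
by apply: H; rewrite /ball/= distrC (le_lt_trans (min_lip _ _ _)).
Qed.

Lemma lip_quot (W B A : R -> R) x k : B x = 0 -> k != 0 -> is_derive x 1 B k ->
  W x = 0 -> lip_at W x -> {for x, continuous A} ->
  {for x, continuous (fun t => W t ^+ 2 * A t / B t)}.
Proof.
move=> Bx k0 dB Wx [C C0 WC] cA; apply: lip_continuous.
have k2 : 0 < `|k| / 2 by rewrite divr_gt0 ?normr_gt0.
exists (C ^+ 2 * (`|A x| + 1) / (`|k| / 2)).
  by rewrite divr_ge0 ?(ltW k2)// mulr_ge0 ?sqr_ge0// addr_ge0.
near=> t; rewrite Wx expr0n mul0r mul0r subr0.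
have [->|tx] := eqVneq t x; first by rewrite Wx expr0n !mul0r normr0 subrr normr0 mulr0.
have tx0 : 0 < `|t - x| by rewrite normr_gt0 subr_eq0.
have Bt : `|k| / 2 * `|t - x| <= `|B t|.
  have : `|B t - B x - k * (t - x)| <= `|k| / 2 * `|t - x|.
    by near: t; exact: (drv_near_linear dB).
  rewrite Bx subr0 => h.
  have : `|k * (t - x)| <= `|B t| + `|B t - k * (t - x)|.
    rewrite -[X in _ <= X + _]normrN (le_trans _ (ler_normD _ _))//.
    by rewrite (_ : - B t + (B t - k * (t - x)) = - (k * (t - x))) ?normrN//; ring.
  by rewrite normrM; lra.
have Wt : `|W t| <= C * `|t - x|.
  by have : `|W t - W x| <= C * `|t - x|; [near: t|rewrite Wx subr0].
have At : `|A t| <= `|A x| + 1.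
  have : `|A x - A t| <= 1 by near: t; move/cvgrPdist_le : cA; apply.
  move=> h; rewrite -[X in `|X|](subKr (A x)) (le_trans (ler_normB _ _))//.
  by rewrite lerD2l.
rewrite normrM normfV ler_pdivrMr; last first.
  by apply: lt_le_trans Bt; rewrite mulr_gt0.
apply: (@le_trans _ _ (C ^+ 2 * (`|A x| + 1) * `|t - x| ^+ 2)).
  rewrite normrM normrX [leRHS]mulrAC.
  have W2 : `|W t| ^+ 2 <= C ^+ 2 * `|t - x| ^+ 2.
    by rewrite -exprMn lerXn2r// nnegrE// mulr_ge0.
  by apply: ler_pM => //; exact: exprn_ge0.
set X := C ^+ 2 * _.
have X0 : 0 <= X by rewrite mulr_ge0 ?sqr_ge0// addr_ge0.
apply: (@le_trans _ _ (X / (`|k| / 2) * `|t - x| * (`|k| / 2 * `|t - x|))).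
  rewrite le_eqVlt; apply/orP; left; apply/eqP; field.
  by rewrite normr_eq0.
by rewrite ler_wpM2l// mulr_ge0// divr_ge0// ltW.
Unshelve. all: end_near. Qed.

Lemma drv_min_lt f (s t d : R) : t < s -> is_derive t 1 f d ->
  is_derive t 1 (fun u => f (Num.min s u)) d.
Proof.
move=> ts df; apply: drv_near df _; near=> u.
by rewrite min_r// ltW//; near: u; exact: lt_nbhsl.
Unshelve. all: end_near. Qed.

Lemma drv_min_gt f (s t : R) : s < t -> is_derive t 1 (fun u => f (Num.min s u)) 0.
Proof.
move=> st; apply: drv_near (drv_cst (f s) t) _; near=> u.
by rewrite min_l// ltW//; near: u; exact: lt_nbhsr.
Unshelve. all: end_near. Qed.

Lemma cnn_min f s : 0 <= s -> cnn f -> cnn (fun t => f (Num.min s t)).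
Proof.
move=> s0 cf t t0; apply: continuous_comp.
  by apply: lip_continuous; exists 1 => //; near=> u; rewrite mul1r min_lip.
by apply: cf; rewrite le_min s0.
Unshelve. all: end_near. Qed.

Lemma cst_off_finite (l : seq R) f x y : x <= y ->
  (forall t, x <= t <= y -> {for t, continuous f}) ->
  (forall t, x < t < y -> t \notin l -> is_derive t 1 f 0) ->
  f x = f y.
Proof.
move=> xy cf df; apply/eqP; rewrite eq_le (@ndecr_off_finite _ l)//=; last first.
  by move=> t txy tl; exists 0 => //; exact: df.
rewrite -lerN2; apply: (@ndecr_off_finite _ l (fun t => - f t)) => //.
  by move=> t txy; apply: cvgN; exact: cf.
move=> t txy tl; exists 0 => //.
by apply: (drvE (drvN (df _ txy tl))); rewrite oppr0.
Qed.

End LocalLipschitz.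

Lemma homogeneous_solution (F : fieldType) N (f : 'I_N.+1 -> 'I_N -> F) :
  exists2 v : 'I_N.+1 -> F, (exists i, v i != 0) &
    forall j, \sum_i v i * f i j = 0.
Proof.
pose M := \matrix_(i, j) f i j.
have : kermx M != 0.
  rewrite kermx_eq0; apply/negP => /eqP h.
  by have := rank_leq_col M; rewrite h ltnn.
move=> /rowV0Pn[v /sub_kermxP vM v0].
exists (fun i => v 0 i).
  have [[i hi]|h] := pselect (exists i, v 0 i != 0); first by exists i.
  case/negP: v0; apply/eqP/rowP => i; rewrite mxE.
  by apply/eqP/negPn/negP => vi; apply: h; exists i.
move=> j; have := congr1 (fun A : 'rV_N => A 0 j) vM.
rewrite mxE [in RHS]mxE => h; rewrite -[RHS]h.
by apply: eq_bigr => i _; rewrite mxE.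
Qed.

Section Jacobi.
Variables (R : realType) (p : R -> R) (a b : R -> R -> R).
Hypothesis S : sturm p a b.
Variables (r x : R).
Hypotheses (r0 : 0 < r) (x0 : 0 < x) (ar0 : a x r = 0).
Implicit Types t : R.

Let p0 t : 0 <= t -> 0 < p t. Proof. exact: (sturm_gt0 S). Qed.
Let pn0 t : 0 <= t -> p t != 0. Proof. by move=> /p0; rewrite lt0r => /andP[]. Qed.

(* Where [b] vanishes, [W ^+ 2 * (x * a) / b] is [0] by convention, which is
   its limit there because [W] vanishes at the same point. *)
Lemma jacobi_ge0 (l : seq R) (W w D : R -> R) :
  cnn W -> W 0 = 0 -> (forall t, 0 <= t -> lip_at W t) ->
  (forall t : R, 0 < t -> t \notin l -> is_derive t 1 W (w t)) ->
  (exists l' : seq R, forall t, 0 < t -> t <= r -> b x t = 0 -> W t = 0 /\ t \in l') ->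
  cnn D -> D 0 = 0 ->
  (forall t : R, 0 < t -> t \notin l -> is_derive t 1 D (w t ^+ 2 / p t)) ->
  x ^+ 2 * prim0y (fun t => W t ^+ 2 / p t) r <= D r.
Proof.
move=> cW W0 lW dW [l' bz] cD D0 dD.
have cVp := sturm_cVp S.
have cQ : cnn (fun t => W t ^+ 2 / p t) by apply: cnnM => //; exact: cnnX2.
pose Phi t := W t ^+ 2 * (x * a x t) / b x t.
pose Psi t := D t - x ^+ 2 * prim0y (fun t => W t ^+ 2 / p t) t - Phi t.
have bz' t : 0 <= t -> t <= r -> b x t = 0 -> W t = 0.
  rewrite le_eqVlt => /predU1P[<-//|t0] tr bt.
  by have [] := bz _ t0 tr bt.
have cxa : cnn (fun t => x * a x t) by apply: cnnM; [exact: cnn_cst|exact: (@sturm_ca _ _ _ _ S x)].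
have cPhi t : 0 <= t <= r -> {for t, continuous Phi}.
  move=> /andP[t0 tr].
  have [bt|bt] := eqVneq (b x t) 0; last first.
    apply: cvgM; last by apply: cvgV => //; exact: (sturm_cb S).
    exact: (cnnM (cnnX2 cW) cxa).
  apply: (lip_quot bt _ (sturm_db S x t0)) => //; last 3 first.
  - exact: bz'.
  - exact: lW.
  - exact: cxa.
  rewrite !mulf_neq0 ?pn0// ?(gt_eqF x0)//; apply/eqP => at0.
  by have := pruefer_amp_gt0 S x t0; rewrite /pruefer_amp at0 bt expr0n addr0 ltxx.
suff : Psi 0 <= Psi r.
  by rewrite /Psi /Phi D0 prim0y0 W0 ar0 !(mulr0, expr0n, mul0r, subr0) subr_ge0.
apply: (@ndecr_off_finite _ (l ++ l')) => //; first exact: ltW.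
  move=> t t0r; have /andP[t0 _] := t0r.
  apply: cvgB; last exact: cPhi.
  apply: cvgB; first exact: cD.
  by apply: (cnnM (@cnn_cst _ (x ^+ 2)) (cnn_prim0y cQ)).
move=> t /andP[t0 tr]; rewrite mem_cat negb_or => /andP[tl tl'].
have bt : b x t != 0.
  by apply: contra tl' => /eqP bt; have [] := bz t t0 (ltW tr) bt.
have t0' := ltW t0.
pose z := w t / p t - W t * (x * a x t) / b x t.
exists (p t * z ^+ 2); first by rewrite mulr_ge0 ?sqr_ge0// ltW// p0.
have dPhi := drvM (drvM (drvX2 (dW t t0 tl)) (drvZ x (sturm_da S x t0')))
  (drvV bt (sturm_db S x t0')).
apply: (drvE (drvB (drvB (dD t t0 tl) (drvZ (x ^+ 2) (prim0y_derive cQ t0'))) dPhi)).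
by rewrite /z; field; rewrite bt pn0.
Qed.

End Jacobi.

Section Spectral.
Variables (R : realType) (p : R -> R) (a b : R -> R -> R).
Hypothesis S : sturm p a b.
Variables (r : R) (lam : nat -> R).
Hypothesis r0 : 0 < r.
Hypothesis lamP : forall n, 0 < lam n /\ pruefer_angle p a b (lam n) r = pi / 2 + n%:R * pi.
Hypothesis lamH : {homo lam : m n / (m < n)%N >-> m < n}.
Hypothesis lam_ar : forall n, a (lam n) r = 0.
Implicit Types (s t : R) (n : nat).

Let p0 t : 0 <= t -> 0 < p t. Proof. exact: (sturm_gt0 S). Qed.
Let pn0 t : 0 <= t -> p t != 0. Proof. by move=> /p0; rewrite lt0r => /andP[]. Qed.
Let r0' : 0 <= r := ltW r0.
Let lam0 n : 0 < lam n. Proof. by have [] := lamP n. Qed.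
Let lamn0 n : lam n != 0. Proof. by rewrite gt_eqF. Qed.
Let cp : cnn p := sturm_cont S.
Let ca x : cnn (a x). Proof. exact: (@sturm_ca _ _ _ _ S x). Qed.
Let cb x : cnn (b x). Proof. exact: (@sturm_cb _ _ _ _ S x). Qed.
Let cVp : cnn (fun t => (p t)^-1). Proof. exact: (@sturm_cVp _ _ _ _ S). Qed.
Local Notation A n := (a (lam n)).
Local Notation B n := (b (lam n)).
Local Notation al := (prim0y p).

Let cbb m n : cnn (fun t => B m t * B n t / p t).
Proof. by apply: cnnM => //; exact: cnnM. Qed.
Let caa m n : cnn (fun t => p t * (A m t * A n t)).
Proof. by apply: cnnM => //; exact: cnnM. Qed.

Definition sturm_norm n := prim0y (fun t => B n t * B n t / p t) r.
Local Notation Q := sturm_norm.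

Let exchange m n : lam m * prim0y (fun t => B m t * B n t / p t) r =
  lam n * prim0y (fun t => p t * (A m t * A n t)) r.
Proof.
apply/eqP; rewrite -subr_eq0; apply/eqP.
have H t : 0 <= t -> is_derive t 1 (fun t => lam m * prim0y (fun t => B m t * B n t / p t) t
     - lam n * prim0y (fun t => p t * (A m t * A n t)) t + A m t * B n t) 0.
  move=> t0; have := drvB (drvZ (lam m) (prim0y_derive (@cbb m n) t0))
    (drvZ (lam n) (prim0y_derive (@caa m n) t0)).
  move=> /drvD /(_ (drvM (sturm_da S (lam m) t0) (sturm_db S (lam n) t0))) H.
  by apply: (drvE H); ring.
have := drv0_cst r0' (fun t ht => H t (proj1 (andP ht))).
by rewrite !prim0y0 (sturm_b0 S) (lam_ar m) mul0r !mulr0 !addr0 subrr => <-.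
Qed.

Lemma sturm_orthogonal m n : prim0y (fun t => B m t * B n t / p t) r = (m == n)%:R * Q n.
Proof.
have [->|mn] := eqVneq m n; first by rewrite mul1r.
rewrite mul0r; set X := LHS.
pose Y := prim0y (fun t => p t * (A m t * A n t)) r.
have e1 : lam m * X = lam n * Y := exchange m n.
have e2 : lam n * X = lam m * Y.
  have := exchange n m.
  rewrite (prim0y_eq (g := fun t => B m t * B n t / p t))// => [|t _]; last by rewrite [B n t * _]mulrC.
  by rewrite [RHS](_ : _ = lam m * Y)// /Y; congr (_ * _); apply: prim0y_eq => // t _; rewrite [A n t * _]mulrC.
have : (lam m ^+ 2 - lam n ^+ 2) * X = 0.
  by rewrite mulrBl !expr2 -!mulrA e1 e2; ring.
move/eqP; rewrite mulf_eq0 => /orP[|/eqP//].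
rewrite subr_eq0 eqrXn2 ?ltW// => /eqP e.
by move: mn; rewrite neq_ltn => /orP[] /lamH; rewrite e ltxx.
Qed.

Lemma sturm_orthogonal_dual m n :
  prim0y (fun t => p t * (A m t * A n t)) r = (m == n)%:R * Q n.
Proof.
apply: (mulfI (lamn0 n)); rewrite -exchange sturm_orthogonal.
by have [->|_] := eqVneq m n; rewrite ?mul0r ?mulr0.
Qed.

Lemma sturm_norm_gt0 n : 0 < Q n.
Proof.
have F t : 0 <= t <= r -> 0 <= B n t * B n t / p t.
  by move=> /andP[t0 _]; rewrite divr_ge0 -?expr2 ?sqr_ge0// ltW// p0.
have F' t : 0 <= t <= r -> 0 <= p t * (A n t * A n t).
  by move=> /andP[t0 _]; rewrite mulr_ge0 -?expr2 ?sqr_ge0// ltW// p0.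
suff : 0 < Q n + Q n by rewrite -mulr2n pmulrn_lgt0.
rewrite {1}/Q; have := sturm_orthogonal_dual n n; rewrite eqxx mul1r => <-.
rewrite -prim0yD//; apply: prim0y_gt0 => //; first exact: cnnD.
move=> t /andP[t0 _]; rewrite -!expr2.
have := pruefer_amp_gt0 S (lam n) t0; rewrite /pruefer_amp => h.
have pt := p0 t0; have pV : 0 < (p t)^-1 by rewrite invr_gt0.
have [at0|at0] := eqVneq (A n t) 0.
  move: h; rewrite at0 expr0n add0r mulr0 addr0 => h.
  by rewrite divr_gt0.
apply: ltr_wpDl; first by rewrite divr_ge0 ?sqr_ge0// ltW.
by rewrite mulr_gt0// exprn_even_gt0.
Qed.

Let Qn0 n : Q n != 0. Proof. by rewrite gt_eqF// sturm_norm_gt0. Qed.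

Lemma prim_eigenfun n s : 0 <= s ->
  lam n * prim0y (fun t => p t * A n t) s = B n s.
Proof.
move=> s0; have c : cnn (fun t => p t * A n t) by exact: cnnM.
have := prim0y_unique (cnnM (@cnn_cst _ (lam n)) c) (sturm_db S (lam n)) s0.
by rewrite prim0yZ// (sturm_b0 S) subr0.
Qed.

Section Evaluation.
Variable s : R.
Hypothesis sr : 0 <= s <= r.
Let s0 : 0 <= s. Proof. by case/andP: sr. Qed.

Definition green t := al (Num.min s t).

Let dal t : 0 <= t -> is_derive t 1 al (p t). Proof. exact: prim0y_derive. Qed.
Lemma cnn_green : cnn green.
Proof. by apply: cnn_min => //; exact: cnn_prim0y. Qed.

Let cgb n : cnn (fun t => green t * B n t / p t).
Proof. by apply: cnnM => //; apply: cnnM => //; exact: cnn_green. Qed.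

Lemma green_eigen n :
  prim0y (fun t => green t * B n t / p t) r = B n s / lam n ^+ 2.
Proof.
pose F t := lam n * prim0y (fun t => green t * B n t / p t) t
   + (green t * A n t - (lam n)^-1 * B n (Num.min s t)).
have : F 0 = F r.
  apply: (@cst_off_finite _ [:: s]) => //.
    have c1 : cnn (fun t => green t * A n t) by apply: cnnM => //; exact: cnn_green.
    have c2 := cnnM (@cnn_cst _ (lam n)^-1) (@cnn_min _ (B n) s s0 (@cb _)).
    have c3 := cnnM (@cnn_cst _ (lam n)) (cnn_prim0y (@cgb n)).
    by move=> t /andP[t0 _]; exact: (cnnD c3 (cnnB c1 c2)).
  move=> t /andP[t0 _]; rewrite inE => ts; have t0' := ltW t0.
  have d1 := drvZ (lam n) (prim0y_derive (@cgb n) t0').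
  have [tls|tgs|e] := ltgtP t s; last by rewrite e eqxx in ts.
    have d2 := drvM (drv_min_lt tls (dal t0')) (sturm_da S (lam n) t0').
    have d3 := drv_min_lt tls (sturm_db S (lam n) t0').
    apply: (drvE (drvD d1 (drvB d2 (drvZ (lam n)^-1 d3)))).
    by rewrite /green min_r ?(ltW tls)//; field; rewrite pn0// lamn0.
  have d2 := drvM (drv_min_gt al tgs) (sturm_da S (lam n) t0').
  have d3 := drv_min_gt (B n) tgs.
  apply: (drvE (drvD d1 (drvB d2 (drvZ (lam n)^-1 d3)))).
  by rewrite /green; ring.
rewrite /F /green prim0y0 min_r// prim0y0 (sturm_b0 S) lam_ar !mulr0 mul0r add0r subrr.
rewrite min_l; last by case/andP: sr.
by move/eqP; rewrite eq_sym sub0r subr_eq0 => /eqP e; rewrite -[LHS](mulKf (lamn0 n)) e; field.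
Qed.

Variable N : nat.
Definition mercer_coef (n : nat) := B n s / (lam n ^+ 2 * Q n).
Local Notation e := mercer_coef.
Definition mercer_rem t := green t - \sum_(n < N) e n * B n t.
Local Notation U := mercer_rem.

Section Trial.
Variables (c : R) (d : 'I_N -> R).
Definition trial t := c * green t - \sum_(n < N) d n * B n t.
Local Notation W := trial.
Definition trial_dual t := \sum_(n < N) d n * (lam n * A n t).
Local Notation g := trial_dual.
Let w t := p t * (c * (t < s)%R%:R - g t).
Let D t := c ^+ 2 * al (Num.min s t) - 2 * c * prim0y (fun t => p t * g t) (Num.min s t)
  + prim0y (fun t => p t * g t ^+ 2) t.

Lemma cnn_trial_dual : cnn g.
Proof. by apply: cnn_sum => i; apply: cnnM; [exact: cnn_cst|apply: cnnM => //; exact: cnn_cst]. Qed.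
Let cg := cnn_trial_dual.
Let cpg : cnn (fun t => p t * g t). Proof. exact: cnnM. Qed.
Let cpg2 : cnn (fun t => p t * g t ^+ 2). Proof. by apply: cnnM => //; exact: cnnX2. Qed.
Lemma cnn_trial : cnn W.
Proof.
apply: cnnB; first by apply: cnnM; [exact: cnn_cst|exact: cnn_green].
by apply: cnn_sum => i; apply: cnnM => //; exact: cnn_cst.
Qed.
Let cW := cnn_trial.
Let W0 : W 0 = 0.
Proof.
rewrite /trial /green min_r// prim0y0 mulr0 big1 ?subrr// => i _.
by rewrite (sturm_b0 S) mulr0.
Qed.
Let lW t : 0 <= t -> lip_at W t.
Proof.
move=> t0; rewrite /trial.
under eq_fun do rewrite -mulN1r.
apply: lipD; last first.
  by apply: lipZ; apply: lip_sum => i; apply: lipZ; exact: drv_lip (sturm_db S _ t0).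
by apply: lipZ; apply: lip_min; apply: drv_lip (dal _); rewrite le_min s0.
Qed.
Let dW t : 0 < t -> t \notin [:: s] -> is_derive t 1 W (w t).
Proof.
rewrite inE => t0 ts; have t0' := ltW t0.
have dS := drv_sum (fun i : 'I_N => drvZ (d i) (sturm_db S (lam i) t0')).
have sE : \sum_(i < N) d i * (lam i * (p t * A i t)) = p t * g t.
  by rewrite /trial_dual mulr_sumr; apply: eq_bigr => i _; ring.
have [tls|tgs|h] := ltgtP t s; last by rewrite h eqxx in ts.
  apply: (drvE (drvB (drvZ c (drv_min_lt tls (dal t0'))) dS)).
  by rewrite sE /w tls /=; ring.
apply: (drvE (drvB (drvZ c (drv_min_gt al tgs)) dS)).
by rewrite sE /w ltNge (ltW tgs)/=; ring.
Qed.
Let cD : cnn D.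
Proof.
apply: cnnD; last exact: cnn_prim0y.
apply: cnnB; first by apply: cnnM; [exact: cnn_cst|exact: cnn_green].
by apply: cnnM; [exact: cnn_cst|apply: (cnn_min s0); exact: cnn_prim0y].
Qed.
Let D0 : D 0 = 0.
Proof. by rewrite /D min_r// !prim0y0 !mulr0 subrr addr0. Qed.
Let dD t : 0 < t -> t \notin [:: s] -> is_derive t 1 D (w t ^+ 2 / p t).
Proof.
rewrite inE => t0 ts; have t0' := ltW t0.
have [tls|tgs|h] := ltgtP t s; last by rewrite h eqxx in ts.
  have d1 := drv_min_lt tls (dal t0').
  have d2 := drv_min_lt tls (prim0y_derive cpg t0').
  apply: (drvE (drvD (drvB (drvZ (c ^+ 2) d1) (drvZ (2 * c) d2)) (prim0y_derive cpg2 t0'))).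
  by rewrite /w tls /=; field; exact: pn0.
have d1 := drv_min_gt al tgs.
have d2 := drv_min_gt (prim0y (fun t => p t * g t)) tgs.
apply: (drvE (drvD (drvB (drvZ (c ^+ 2) d1) (drvZ (2 * c) d2)) (prim0y_derive cpg2 t0'))).
by rewrite /w ltNge (ltW tgs)/=; field; exact: pn0.
Qed.

Definition trial_energy := c ^+ 2 * al s - 2 * c * (\sum_(n < N) d n * B n s)
   + \sum_(n < N) d n ^+ 2 * (lam n ^+ 2 * Q n).

Let Dr : D r = trial_energy.
Proof.
have /andP[_ sr'] := sr.
rewrite /D min_l//; congr (_ - _ * _ + _).
  rewrite (prim0y_eq (g := fun t => \sum_(n < N) d n * lam n * (p t * A n t)))//; last first.
    by move=> t _; rewrite /trial_dual mulr_sumr; apply: eq_bigr => i _; ring.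
  rewrite prim0y_sum//; last by move=> i; apply: cnnM; [exact: cnn_cst|exact: cnnM].
  apply: eq_bigr => i _; rewrite prim0yZ//; last exact: cnnM.
  by rewrite -mulrA prim_eigenfun.
rewrite (prim0y_eq (g := fun t => \sum_(m < N) \sum_(n < N)
    (d m * lam m * (d n * lam n)) * (p t * (A m t * A n t))))//; last first.
  move=> t _; rewrite /trial_dual expr2 mulr_suml mulr_sumr; apply: eq_bigr => i _.
  by rewrite mulr_sumr mulr_sumr; apply: eq_bigr => j _; ring.
have cmn (m n : 'I_N) : cnn (fun t => (d m * lam m * (d n * lam n)) * (p t * (A m t * A n t))).
  by apply: cnnM => //; exact: cnn_cst.
rewrite prim0y_sum//; last by move=> m; apply: cnn_sum => n; exact: cmn.
apply: eq_bigr => m _; rewrite prim0y_sum//.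
rewrite (bigD1 m)//= big1 ?addr0 => [|n nm].
  by rewrite prim0yZ// sturm_orthogonal_dual eqxx mul1r; ring.
rewrite prim0yZ// sturm_orthogonal_dual (_ : (_ == _) = false) ?mul0r ?mulr0//.
by apply/negbTE; rewrite eq_sym.
Qed.

Lemma trial_norm : prim0y (fun t => W t ^+ 2 / p t) r =
  c ^+ 2 * prim0y (fun t => green t ^+ 2 / p t) r
  - 2 * c * (\sum_(n < N) d n * (B n s / lam n ^+ 2)) + \sum_(n < N) d n ^+ 2 * Q n.
Proof.
have cm2 : cnn (fun t => green t ^+ 2 / p t).
  by apply: cnnM => //; apply: cnnX2; exact: cnn_green.
have cmn (m n : 'I_N) : cnn (fun t => (d m * d n) * (B m t * B n t / p t)).
  by apply: cnnM => //; exact: cnn_cst.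
have cn (n : 'I_N) : cnn (fun t => d n * (green t * B n t / p t)).
  by apply: cnnM => //; exact: cnn_cst.
rewrite (prim0y_eq (g := fun t => c ^+ 2 * (green t ^+ 2 / p t) +
    (- (2 * c)) * (\sum_(n < N) d n * (green t * B n t / p t)) +
    \sum_(m < N) \sum_(n < N) (d m * d n) * (B m t * B n t / p t)))//; last first.
  move=> t t0; rewrite /trial; set X := \sum_(n < N) d n * B n t.
  have -> : \sum_(n < N) d n * (green t * B n t / p t) = green t / p t * X.
    by rewrite mulr_sumr; apply: eq_bigr => i _; ring.
  have -> : \sum_(m < N) \sum_(n < N) (d m * d n) * (B m t * B n t / p t) = X * X / p t.
    rewrite -mulrA [in RHS]/X mulr_suml; apply: eq_bigr => i _.
    by rewrite -[X * _]mulrC 2!mulr_sumr; apply: eq_bigr => j _; ring.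
  by ring.
have c1 := cnnM (@cnn_cst _ (c ^+ 2)) cm2.
have c2 := cnnM (@cnn_cst _ (- (2 * c))) (cnn_sum cn).
have c3 : cnn (fun t => \sum_(m < N) \sum_(n < N) (d m * d n) * (B m t * B n t / p t)).
  by apply: cnn_sum => m; apply: cnn_sum => n; exact: cmn.
rewrite prim0yD//; last exact: cnnD.
rewrite prim0yD// prim0yZ// prim0yZ//; last exact: cnn_sum.
rewrite mulNr; congr (_ - _ * _ + _).
  by rewrite prim0y_sum//; apply: eq_bigr => i _; rewrite prim0yZ// green_eigen.
rewrite prim0y_sum//; last by move=> m; apply: cnn_sum => n; exact: cmn.
apply: eq_bigr => m _; rewrite prim0y_sum//.
rewrite (bigD1 m)//= big1 ?addr0 => [|n nm].
  by rewrite prim0yZ// sturm_orthogonal eqxx mul1r expr2.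
rewrite prim0yZ// sturm_orthogonal (_ : (_ == _) = false) ?mul0r ?mulr0//.
by apply/negbTE; rewrite eq_sym.
Qed.

Lemma trial_jacobi :
  (exists l' : seq R, forall t, 0 < t -> t <= r -> B N t = 0 -> W t = 0 /\ t \in l') ->
  lam N ^+ 2 * prim0y (fun t => W t ^+ 2 / p t) r <= trial_energy.
Proof. by move=> h; rewrite -Dr; apply: (jacobi_ge0 S r0 (lam0 N) (lam_ar N) cW W0 lW dW h cD D0 dD). Qed.

Let cWp : cnn (fun t => W t ^+ 2 / p t).
Proof. by apply: cnnM => //; exact: cnnX2. Qed.

(* Agmon's inequality: [(W ^+ 2)^' = 2 W w <= C (x W ^+ 2 / p + w ^+ 2 / (x p))]. *)
Lemma trial_agmon (C x : R) : (forall t, 0 <= t <= r -> p t <= C) -> 0 < x ->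
  W s ^+ 2 <= C * (x * prim0y (fun t => W t ^+ 2 / p t) r + trial_energy / x).
Proof.
move=> pC x0; have /andP[_ sr'] := sr.
have C0 : 0 <= C by apply: le_trans (pC 0 _); [exact: ltW (p0 _)|rewrite lexx].
pose Y t := x * prim0y (fun t => W t ^+ 2 / p t) t + D t / x.
have cY : cnn Y.
  exact: (cnnD (cnnM (@cnn_cst _ x) (cnn_prim0y cWp)) (cnnM cD (@cnn_cst _ x^-1))).
have dY t : 0 < t -> t \notin [:: s] ->
    is_derive t 1 Y (x * (W t ^+ 2 / p t) + w t ^+ 2 / p t / x).
  move=> t0 ts; apply: (drvE (drvD (drvZ x (prim0y_derive cWp (ltW t0))) (drvM (dD t0 ts) (drv_cst x^-1 t)))).
  by ring.
have E0 t : 0 <= t -> 0 <= x * (W t ^+ 2 / p t) + w t ^+ 2 / p t / x.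
  move=> t0; have pt := ltW (p0 t0); have x0' := ltW x0.
  by apply: addr_ge0; [apply: mulr_ge0 => //|apply: divr_ge0 => //]; apply: divr_ge0 => //; exact: sqr_ge0.
have Y_mono : Y s <= Y r.
  apply: (@ndecr_off_finite _ [:: s]) => //.
    by move=> t /andP[st _]; apply: cY; exact: le_trans st.
  move=> t /andP[st _] ts; have t0 := le_lt_trans s0 st.
  have pt := p0 (ltW t0).
  exists (x * (W t ^+ 2 / p t) + w t ^+ 2 / p t / x); last exact: dY.
  exact: E0 (ltW t0).
rewrite -Dr -[X in _ * X]/(Y r); apply: (@le_trans _ _ (C * Y s)); last by rewrite ler_wpM2l.
have : C * Y 0 - W 0 ^+ 2 <= C * Y s - W s ^+ 2.
  apply: (@ndecr_off_finite _ [:: s] (fun t => C * Y t - W t ^+ 2)) => //.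
    move=> t /andP[t0 _]; exact: (cnnB (cnnM (@cnn_cst _ C) cY) (cnnX2 cW)).
  move=> t /andP[t0 ts'] ts.
  have pt := p0 (ltW t0); have ptC : p t <= C by apply: pC; rewrite ltW//= ltW// (lt_le_trans ts').
  exists (C * (x * (W t ^+ 2 / p t) + w t ^+ 2 / p t / x) - 2 * W t * w t).
    rewrite subr_ge0.
    apply: (@le_trans _ _ (p t * (x * (W t ^+ 2 / p t) + w t ^+ 2 / p t / x))); last first.
      rewrite ler_wpM2r//.
      exact: E0 (ltW t0).
    rewrite -subr_ge0.
    rewrite (_ : _ - _ = x * (W t - w t / x) ^+ 2); first by rewrite mulr_ge0 ?sqr_ge0// ltW.
    by field; rewrite (gt_eqF x0) pn0// ltW.
  exact: (drvB (drvZ C (dY t t0 ts)) (drvX2 (dW t0 ts))).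
by rewrite W0 /Y prim0y0 D0 mul0r mulr0 addr0 mulr0 expr0n subrr subr_ge0.
Qed.

Lemma trial_energyE :
  \int[lebesgue_measure]_(t in `[0, r]) (p t * (c * (t <= s)%R%:R - g t) ^+ 2) = trial_energy.
Proof.
rewrite -Dr; pose h t := c ^+ 2 * p t - 2 * c * (p t * g t).
have c1 := cnnM (@cnn_cst _ (c ^+ 2)) cp; have c2 := cnnM (@cnn_cst _ (2 * c)) cpg.
have ch : cnn h by exact: cnnB.
have int0 f u : cnn f -> lebesgue_measure.-integrable `[0, u] (EFin \o f).
  move=> cf; apply: cont_integrable; apply: cont_within => t.
  by rewrite /= in_itv/= => /andP[t0 _]; exact: cf.
have rs : `[0, s]%classic `<=` `[0, r]%classic.
  by apply: subset_itvl; rewrite bnd_simp; case/andP: sr.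
have hs : \int[lebesgue_measure]_(t in `[0, r]) (h \_ `[0, s]) t = prim0y h s.
  by rewrite -Rintegral_mkcondr setIidr// -prim0yE.
transitivity (\int[lebesgue_measure]_(t in `[0, r]) ((h \_ `[0, s]) t + p t * g t ^+ 2)).
  apply: eq_Rintegral => t; rewrite inE/= in_itv/= => /andP[t0 _].
  rewrite patchE mem_setE/= in_itv/= t0 /=; case: leP => _ /=; first by rewrite /h; ring.
  by rewrite [X in _ = X + _](_ : _ = 0)//; ring.
rewrite RintegralD//=; last 2 first.
- rewrite -restrict_EFin; apply/integrable_restrict => //=.
  by rewrite setIidr//; exact: int0.
- exact: int0.
rewrite [X in X + _]hs -prim0yE// /D min_l; last by case/andP: sr.
congr (_ + _).
have -> : prim0y h s = prim0y (fun t => c ^+ 2 * p t + (- (2 * c)) * (p t * g t)) s.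
  by apply: prim0y_eq => // t _; rewrite /h mulNr.
rewrite prim0yD//; last by apply: cnnM => //; exact: cnn_cst.
by rewrite !prim0yZ// mulNr.
Qed.

End Trial.

Let Uenergy : trial_energy 1 e = U s.
Proof.
rewrite /trial_energy /U /green min_l// expr1n mul1r mulr1.
rewrite (_ : \sum_(n < N) e n ^+ 2 * _ = \sum_(n < N) e n * B n s); last first.
  by apply: eq_bigr => i _; rewrite /e; field; rewrite Qn0 lamn0.
ring.
Qed.

Lemma mercer_remE t : U t = trial 1 (fun n : 'I_N => e n) t.
Proof. by rewrite /U /trial mul1r. Qed.

Let Unorm : prim0y (fun t => U t ^+ 2 / p t) r =
  prim0y (fun t => trial 1 (fun n : 'I_N => e n) t ^+ 2 / p t) r.
Proof. by apply: prim0y_eq => // t _; rewrite mercer_remE. Qed.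

Lemma mercer_energyE :
  \int[lebesgue_measure]_(t in `[0, r])
    (p t * ((t <= s)%R%:R - \sum_(n < N) e n * (lam n * A n t)) ^+ 2) = U s.
Proof.
rewrite -Uenergy -trial_energyE; apply: eq_Rintegral => t _.
by rewrite mul1r.
Qed.

(* A combination of [green] and of the first [N] eigenfunctions vanishes at the
   [N] nodes of the next one; in the identity
   [L(W) = c ^+ 2 * L(U) + sum (d_n - c e_n) ^+ 2 Q_n (lam_n ^+ 2 - lam_N ^+ 2)]
   with [L = energy - lam_N ^+ 2 * norm] the sum is negative and [L(W) >= 0]. *)
Lemma mercer_norm_le :
  lam N ^+ 2 * prim0y (fun t => U t ^+ 2 / p t) r <= U s.
Proof.
have [tau [tau0 tauP]] := sturm_nodes S (lam0 N) (proj2 (lamP N)).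
pose F (i : 'I_N.+1) j := if unlift ord0 i is Some n then - B n (tau j) else green (tau j).
have [v [i0 vi0] vF] := homogeneous_solution F.
pose c := v ord0; pose d (n : 'I_N) := v (lift ord0 n).
have Wtau j : trial c d (tau j) = 0.
  have := vF j; rewrite big_ord_recl /F unlift_none => h.
  rewrite -[RHS]h /trial -sumrN; congr (_ + _).
  by apply: eq_bigr => i _; rewrite liftK mulrN.
have h' : exists l' : seq R, forall t, 0 < t -> t <= r -> B N t = 0 ->
    trial c d t = 0 /\ t \in l'.
  exists (codom tau) => t t0 tr bt; have [j ->] := tauP _ t0 tr bt.
  by split; [exact: Wtau|exact: codom_f].
have := trial_jacobi h'; rewrite trial_norm.
pose Y := \sum_(n < N) (d n - c * e n) ^+ 2 * (Q n * (lam n ^+ 2 - lam N ^+ 2)).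
set X := prim0y (fun t => green t ^+ 2 / p t) r.
have key : trial_energy c d - lam N ^+ 2 * (c ^+ 2 * X - 2 * c * (\sum_(n < N) d n * (B n s / lam n ^+ 2))
    + \sum_(n < N) d n ^+ 2 * Q n) =
  c ^+ 2 * (U s - lam N ^+ 2 * prim0y (fun t => U t ^+ 2 / p t) r) + Y.
  rewrite Unorm trial_norm -/X -Uenergy /trial_energy expr1n !mul1r mulr1.
  rewrite (_ : Y = \sum_(n < N) (d n ^+ 2 * (lam n ^+ 2 * Q n)) - lam N ^+ 2 * \sum_(n < N) d n ^+ 2 * Q n
    - 2 * c * (\sum_(n < N) d n * B n s) + lam N ^+ 2 * 2 * c * (\sum_(n < N) d n * (B n s / lam n ^+ 2))
    + c ^+ 2 * (\sum_(n < N) e n ^+ 2 * (lam n ^+ 2 * Q n) - lam N ^+ 2 * \sum_(n < N) e n ^+ 2 * Q n)).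
    rewrite (_ : \sum_(n < N) e n * B n s = \sum_(n < N) e n ^+ 2 * (lam n ^+ 2 * Q n)); last first.
      by apply: eq_bigr => i _; rewrite /e; field; rewrite Qn0 lamn0.
    rewrite (_ : \sum_(n < N) e n * (B n s / lam n ^+ 2) = \sum_(n < N) e n ^+ 2 * Q n); last first.
      by apply: eq_bigr => i _; rewrite /e; field; rewrite Qn0 lamn0.
    ring.
  rewrite /Y !mulr_sumr -!sumrN -!big_split/= !mulr_sumr -!big_split/=.
  apply: eq_bigr => i _; rewrite /e; field; rewrite Qn0 lamn0//.
rewrite -subr_ge0 key => cY; rewrite -subr_ge0.
have Yle (n : 'I_N) : (d n - c * e n) ^+ 2 * (Q n * (lam n ^+ 2 - lam N ^+ 2)) <= 0.
  apply: mulr_ge0_le0; first exact: sqr_ge0.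
  apply: mulr_ge0_le0; first exact: ltW (sturm_norm_gt0 _).
  by rewrite subr_le0 lerXn2r ?nnegrE ?ltW// lamH.
have Y0 : Y <= 0 by rewrite /Y; apply: sumr_le0 => i _; exact: Yle.
have [c0|c0] := eqVneq c 0; last first.
  have c2 : 0 < c ^+ 2 by rewrite exprn_even_gt0.
  by rewrite -(pmulr_rge0 _ c2); lra.
exfalso; move: cY; rewrite c0 expr0n mul0r add0r => Yge.
have Yz : Y = 0 by apply/eqP; rewrite eq_le Y0.
have Yn (n : 'I_N) : 0 <= - ((d n - c * e n) ^+ 2 * (Q n * (lam n ^+ 2 - lam N ^+ 2))) by rewrite oppr_ge0.
have : \sum_(n < N) - ((d n - c * e n) ^+ 2 * (Q n * (lam n ^+ 2 - lam N ^+ 2))) == 0.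
  by rewrite sumrN -/Y Yz oppr0.
rewrite psumr_eq0 => [/allP h|n _]; last exact: Yn.
move: vi0; case: (unliftP ord0 i0) => [n ->|->]; last by rewrite -/c c0 eqxx.
have := h n; rewrite mem_index_enum => /(_ isT); rewrite oppr_eq0 c0 mul0r subr0.
rewrite mulf_eq0 => /orP[|].
  by rewrite expf_eq0/= => /eqP dn0; rewrite -/(d n) dn0 eqxx.
rewrite mulf_eq0 (negbTE (Qn0 _))/= subr_eq0 => /eqP h2.
have : lam n ^+ 2 < lam N ^+ 2 by rewrite ltrXn2r ?nnegrE ?(ltW (lam0 _))//= lamH.
by rewrite h2 ltxx.
Qed.

Lemma mercer_rem_ge0 : 0 <= U s.
Proof.
apply: le_trans mercer_norm_le; rewrite mulr_ge0 ?sqr_ge0// Unorm.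
apply: prim0y_ge0 => //.
  by apply: cnnM => //; apply: cnnX2; exact: cnn_trial.
by move=> t /andP[t0 _]; rewrite divr_ge0 ?sqr_ge0// ltW// p0.
Qed.

Lemma mercer_rem_le (C : R) : (forall t, 0 <= t <= r -> p t <= C) ->
  U s <= 2 * C / lam N.
Proof.
move=> pC; have C0 : 0 <= C by apply: le_trans (pC 0 _); [exact: ltW (p0 _)|rewrite lexx].
have := trial_agmon 1 (fun n : 'I_N => e n) pC (lam0 N).
rewrite -mercer_remE -Unorm Uenergy => h.
have := mercer_rem_ge0; rewrite le_eqVlt => /predU1P[<-|U0].
  by rewrite divr_ge0 ?mulr_ge0// ltW.
have l0 := lam0 N.
rewrite -(ler_pM2l U0) -expr2; apply: (le_trans h).
rewrite [leRHS](_ : _ = C * (U s / lam N + U s / lam N)); last by ring.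
rewrite ler_wpM2l// lerD2r ler_pdivlMr// mulrC mulrA -expr2.
exact: mercer_norm_le.
Qed.

End Evaluation.
End Spectral.

Section SquareIntegrable.
Context d (T : measurableType d) (R : realType).
Variable mu : {measure set T -> \bar R}.
Implicit Types f g h : T -> R.
Local Notation L2 := (Lfun mu 2%:E).

Lemma Lnorm2E f : ('N[mu]_2%:E[EFin \o f] = (\int[mu]_x (f x ^+ 2)%:E) `^ 2^-1)%E.
Proof.
rewrite unlock/=; congr (_ `^ _)%E; apply: eq_integral => x _ /=.
by rewrite -[2]/(2%:R) powR_mulrn// real_normK ?num_real.
Qed.

Lemma L2P f : f \in L2 <-> measurable_fun setT f /\ (\int[mu]_x (f x ^+ 2)%:E < +oo)%E.
Proof.
split=> [fL|[mf fi]].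
  have := Lfun2_integrable_sqr fL => /integrableP[_].
  under eq_integral do rewrite /= ger0_norm ?sqr_ge0//.
  by move=> h; split=> //; move: fL; rewrite inE => /andP[/[!inE]].
apply/andP; split; rewrite inE//=.
by rewrite /finite_norm Lnorm2E poweR_lty.
Qed.

Lemma L2_measurable f : f \in L2 -> measurable_fun setT f.
Proof. by move=> /L2P[]. Qed.

Lemma L2_dom f g : measurable_fun setT f -> mu.-integrable setT (EFin \o g) ->
  (forall x, f x ^+ 2 <= g x) -> f \in L2.
Proof.
move=> mf ig fg; apply/L2P; split => //.
have /integrableP[mg] := ig; apply: le_lt_trans.
apply: ge0_le_integral => //.
- by move=> x _; rewrite lee_fin sqr_ge0.
- by apply/measurable_EFinP; exact: measurable_funX.
- exact: measurableT_comp.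
- by move=> x _ /=; rewrite lee_fin (le_trans (fg x))// ler_norm.
Qed.

Lemma L2_sqr f : f \in L2 -> mu.-integrable setT (EFin \o (fun x => f x ^+ 2)).
Proof. exact: Lfun2_integrable_sqr. Qed.

Lemma L2M f g : f \in L2 -> g \in L2 -> mu.-integrable setT (EFin \o (fun x => f x * g x)).
Proof. by move=> fL gL; apply/Lfun1_integrable; exact: Lfun2_mul_Lfun1. Qed.

Lemma integrable_add f g : mu.-integrable setT (EFin \o f) -> mu.-integrable setT (EFin \o g) ->
  mu.-integrable setT (EFin \o (fun x => f x + g x)).
Proof. by move=> fi gi; exact: (integrableD measurableT fi gi). Qed.

Lemma integrable_scale (c : R) f : mu.-integrable setT (EFin \o f) ->
  mu.-integrable setT (EFin \o (fun x => c * f x)).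
Proof. by move=> fi; exact: (integrableZl measurableT c fi). Qed.

Lemma sqrD_le (x y : R) : (x + y) ^+ 2 <= 2 * x ^+ 2 + 2 * y ^+ 2.
Proof.
rewrite -subr_ge0 (_ : _ - _ = (x - y) ^+ 2) ?sqr_ge0//; ring.
Qed.

Lemma L2D f g : f \in L2 -> g \in L2 -> (fun x => f x + g x) \in L2.
Proof.
move=> fL gL; apply: (@L2_dom _ (fun x => 2 * f x ^+ 2 + 2 * g x ^+ 2)).
- by apply: measurable_funD; exact: L2_measurable.
- by apply: integrable_add; apply: integrable_scale; exact: L2_sqr.
- by move=> x; exact: sqrD_le.
Qed.

Lemma L2Z (c : R) f : f \in L2 -> (fun x => c * f x) \in L2.
Proof.
move=> fL; apply: (@L2_dom _ (fun x => c ^+ 2 * f x ^+ 2)).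
- by apply: measurable_funM => //; exact: L2_measurable.
- by apply: integrable_scale; exact: L2_sqr.
- by move=> x; rewrite exprMn.
Qed.

Lemma L2B f g : f \in L2 -> g \in L2 -> (fun x => f x - g x) \in L2.
Proof.
move=> fL gL; rewrite (_ : (fun x => _) = (fun x => f x + -1 * g x)); last first.
  by apply/funext => x; rewrite mulN1r.
by apply: L2D => //; exact: L2Z.
Qed.

Lemma L2_0 : (fun=> 0 : R) \in L2.
Proof.
apply/L2P; split => //.
by under eq_integral do rewrite expr0n; rewrite integral0.
Qed.

Lemma L2_sum n (F : 'I_n -> T -> R) : (forall i, F i \in L2) ->
  (fun x => \sum_(i < n) F i x) \in L2.
Proof.
elim: n F => [|n IH] F FL.
  by rewrite (_ : (fun x => _) = fun=> 0) ?L2_0//; apply/funext => x; rewrite big_ord0.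
rewrite (_ : (fun x => _) = fun x => \sum_(i < n) F (widen_ord (leqnSn n) i) x + F ord_max x).
  by apply: L2D => //; exact: IH.
by apply/funext => x; rewrite big_ord_recr.
Qed.

Definition nrm2 f := \int[mu]_x (f x ^+ 2).

Lemma nrm2_ge0 f : 0 <= nrm2 f.
Proof. by apply: Rintegral_ge0 => x _; exact: sqr_ge0. Qed.

Lemma nrm2E f : f \in L2 -> (\int[mu]_x (f x ^+ 2)%:E)%E = (nrm2 f)%:E.
Proof.
by move=> fL; rewrite /nrm2 /Rintegral fineK//; apply: integrable_fin_num => //; exact: L2_sqr.
Qed.

Lemma nrm2_le f g : f \in L2 -> mu.-integrable setT (EFin \o g) ->
  (forall x, f x ^+ 2 <= g x) -> nrm2 f <= \int[mu]_x g x.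
Proof. by move=> fL gi fg; apply: le_Rintegral => //; exact: L2_sqr. Qed.

Lemma nrm2D f g : f \in L2 -> g \in L2 ->
  nrm2 (fun x => f x + g x) <= 2 * nrm2 f + 2 * nrm2 g.
Proof.
move=> fL gL; have f2 := L2_sqr fL; have g2 := L2_sqr gL.
rewrite /nrm2 -!RintegralZl// -RintegralD//; last 2 first.
- exact: integrable_scale.
- exact: integrable_scale.
apply: nrm2_le; first exact: L2D.
  by apply: integrable_add; exact: integrable_scale.
by move=> x; exact: sqrD_le.
Qed.

Lemma nrm2Z (c : R) f : f \in L2 -> nrm2 (fun x => c * f x) = c ^+ 2 * nrm2 f.
Proof.
move=> fL; rewrite /nrm2 -RintegralZl//; last exact: L2_sqr.
by apply: eq_Rintegral => x _; rewrite exprMn.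
Qed.

Lemma nrm2N f g : nrm2 (fun x => f x - g x) = nrm2 (fun x => g x - f x).
Proof. by apply: eq_Rintegral => x _; rewrite -opprB sqrrN. Qed.

Lemma nrm2B f g h : f \in L2 -> g \in L2 -> h \in L2 ->
  nrm2 (fun x => f x - h x) <= 2 * nrm2 (fun x => f x - g x) + 2 * nrm2 (fun x => g x - h x).
Proof.
move=> fL gL hL; have := nrm2D (L2B fL gL) (L2B gL hL).
by under [in X in X <= _ -> _]eq_fun do rewrite addrA subrK.
Qed.

(* [f^2 <= (1 + e) g^2 + (1 + e^-1) (f - g)^2] *)
Lemma nrm2_close f g (e : R) : 0 < e -> f \in L2 -> g \in L2 ->
  nrm2 f <= (1 + e) * nrm2 g + (1 + e^-1) * nrm2 (fun x => f x - g x).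
Proof.
move=> e0 fL gL; have fgL := L2B fL gL.
have g2 := L2_sqr gL; have fg2 := L2_sqr fgL.
rewrite /nrm2 -!RintegralZl// -RintegralD//; last 2 first.
- exact: integrable_scale.
- exact: integrable_scale.
apply: nrm2_le => //; first by apply: integrable_add; exact: integrable_scale.
move=> x; rewrite -subr_ge0; set u := f x; set v := g x.
rewrite (_ : _ - _ = e * (v - (u - v) / e) ^+ 2); first by rewrite mulr_ge0 ?sqr_ge0// ltW.
by field; rewrite gt_eqF.
Qed.

Lemma nrm2_unique f (v : R) : f \in L2 ->
  (forall e, 0 < e -> exists2 g, g \in L2 & nrm2 (fun x => f x - g x) < e /\ `|nrm2 g - v| < e) ->
  nrm2 f = v.
Proof.
move=> fL H; apply/eqP; rewrite eq_le; apply/andP; split; apply/ler_addgt0Pr => e e0.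
  have v0 : 0 <= v.
    apply/ler_addgt0Pr => k k0; have [g gL [_ gv]] := H _ k0.
    have := nrm2_ge0 g; move: gv; rewrite ltr_norml => /andP[_]; lra.
  pose k := Num.min 1 (e / (2 * (v + 2))).
  have vp : 0 < 2 * (v + 2) by lra.
  have k0 : 0 < k by rewrite lt_min ltr01 divr_gt0.
  have k1 : k <= 1 by rewrite ge_min lexx.
  have ke : k * (2 * (v + 2)) <= e by rewrite -ler_pdivlMr// ge_min lexx orbT.
  have kk : 0 < k ^+ 2 by rewrite exprn_gt0.
  have [g gL [fg gv]] := H _ kk.
  apply: (le_trans (nrm2_close k0 fL gL)).
  have k2 : k ^+ 2 <= k by rewrite expr2 ler_piMr// ltW.
  have h1 : (1 + k) * nrm2 g <= (1 + k) * (v + k).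
    rewrite ler_wpM2l//; first lra.
    by move: gv; rewrite ltr_norml => /andP[_]; lra.
  have h2 : (1 + k^-1) * nrm2 (fun x => f x - g x) <= k ^+ 2 + k.
    apply: (@le_trans _ _ ((1 + k^-1) * k ^+ 2)).
      by rewrite ler_wpM2l ?(ltW fg)// addr_ge0// invr_ge0 ltW.
    by rewrite le_eqVlt; apply/orP; left; apply/eqP; field; rewrite gt_eqF.
  apply: (le_trans (lerD h1 h2)).
  rewrite [leLHS](_ : _ = v + k * v + 2 * k + 2 * k ^+ 2); last by ring.
  have kv : 0 <= k * v by rewrite mulr_ge0// ltW.
  have kE : k * (2 * (v + 2)) = 2 * (k * v) + 4 * k by ring.
  by rewrite kE in ke; lra.
pose F := nrm2 f; have F0 : 0 <= F := nrm2_ge0 f.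
pose k := Num.min 1 (e / (F + 4)).
have vp : 0 < F + 4 by lra.
have k0 : 0 < k by rewrite lt_min ltr01 divr_gt0.
have k1 : k <= 1 by rewrite ge_min lexx.
have ke : k * (F + 4) <= e by rewrite -ler_pdivlMr// ge_min lexx orbT.
have kk : 0 < k ^+ 2 by rewrite exprn_gt0.
have [g gL [fg gv]] := H _ kk.
have h := nrm2_close k0 gL fL.
have k2 : k ^+ 2 <= k by rewrite expr2 ler_piMr// ltW.
have h2 : (1 + k^-1) * nrm2 (fun x => g x - f x) <= k ^+ 2 + k.
  apply: (@le_trans _ _ ((1 + k^-1) * k ^+ 2)).
    by rewrite nrm2N ler_wpM2l ?(ltW fg)// addr_ge0// invr_ge0 ltW.
  by rewrite le_eqVlt; apply/orP; left; apply/eqP; field; rewrite gt_eqF.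
rewrite -/F; move: gv; rewrite ltr_norml => /andP[gv _].
rewrite -/F in h; move: ke; rewrite mulrDr; move: h; rewrite mulrDl mul1r; lra.
Qed.

Lemma Lnorm2_lt f (e : R) : 0 < e -> f \in L2 ->
  ('N[mu]_2%:E[EFin \o f] < e%:E)%E = (nrm2 f < e ^+ 2).
Proof.
move=> e0 fL; rewrite Lnorm2E nrm2E// poweR_EFin lte_fin.
have -> : (nrm2 f) `^ 2^-1 = Num.sqrt (nrm2 f) by rewrite powR12_sqrt// nrm2_ge0.
by rewrite -[in RHS](sqr_sqrtr (nrm2_ge0 f)) ltr_pXn2r ?nnegrE ?sqrtr_ge0// ltW.
Qed.

End SquareIntegrable.

Section ClosedSpan.
Context d (T : measurableType d) (R : realType).
Variable mu : {measure set T -> \bar R}.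
Variable S : set (T -> R).
Hypothesis S_L2 : forall g, S g -> g \in Lfun mu 2%:E.
Implicit Types f g h : T -> R.
Local Notation L2 := (Lfun mu 2%:E).
Local Notation nrm2 := (nrm2 mu).

Definition lin_comb (f : T -> R) := exists (n : nat) (c : 'I_n -> R) (g : 'I_n -> T -> R),
  (forall i, S (g i)) /\ f = (fun x => \sum_(i < n) c i * g i x).

Lemma lin_comb_L2 f : lin_comb f -> f \in L2.
Proof. by move=> [n [c [g [Sg ->]]]]; apply: L2_sum => i; apply: L2Z; exact: S_L2. Qed.

Lemma lin_combD f g : lin_comb f -> lin_comb g -> lin_comb (fun x => f x + g x).
Proof.
move=> [n [c [u [Su ->]]]] [m [e [v [Sv ->]]]].
exists (n + m)%N, (fun i : 'I_(n + m) => match fintype.split i with inl j => c j | inr j => e j end),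
  (fun i : 'I_(n + m) => match fintype.split i with inl j => u j | inr j => v j end); split.
  by move=> i; case: fintype.split.
apply/funext => x; rewrite big_split_ord/=; congr (_ + _); apply: eq_bigr => i _.
  by rewrite (unsplitK (inl i)).
by rewrite (unsplitK (inr i)).
Qed.

Lemma lin_combZ (k : R) f : lin_comb f -> lin_comb (fun x => k * f x).
Proof.
move=> [n [c [u [Su ->]]]]; exists n, (fun i => k * c i), u; split=> //.
by apply/funext => x; rewrite mulr_sumr; apply: eq_bigr => i _; rewrite mulrA.
Qed.

Lemma lin_comb_incl f : S f -> lin_comb f.
Proof.
move=> Sf; exists 1%N, (fun=> 1), (fun=> f); split=> //.
by apply/funext => x; rewrite big_ord1 mul1r.
Qed.

Lemma closed_spanP f : closed_span mu S f <->
  f \in L2 /\ forall e, 0 < e -> exists2 h, lin_comb h & nrm2 (fun x => f x - h x) < e.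
Proof.
split=> -[fL H]; split => // e e0.
  have s0 : 0 < Num.sqrt e by rewrite sqrtr_gt0.
  have [n [c [g [Sg Hg]]]] := H _ s0.
  pose h x := \sum_(i < n) c i * g i x.
  have hc : lin_comb h by exists n, c, g.
  exists h => //; move: Hg.
  rewrite (@Lnorm2_lt _ _ _ mu (fun x => f x - h x)) ?sqr_sqrtr ?ltW//.
  by apply: L2B => //; exact: lin_comb_L2.
have e2 : 0 < e ^+ 2 by rewrite exprn_gt0.
have [h [n [c [g [Sg hE]]]] fh] := H _ e2.
exists n, c, g; split=> //; rewrite (@Lnorm2_lt _ _ _ mu (fun x => f x - \sum_(i < n) c i * g i x))//.
  by rewrite hE in fh.
apply: L2B => //; apply: lin_comb_L2; by exists n, c, g.
Qed.

Local Notation CS := (closed_span mu S).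

Lemma closed_span_L2 f : CS f -> f \in L2. Proof. by case. Qed.

Lemma closed_span_comb f : lin_comb f -> CS f.
Proof.
move=> fc; apply/closed_spanP; split; first exact: lin_comb_L2.
move=> e e0; exists f => //.
rewrite /nrm2; under eq_Rintegral do rewrite subrr expr0n.
by rewrite /Rintegral integral0.
Qed.

Lemma closed_span_incl f : S f -> CS f.
Proof. by move=> /lin_comb_incl/closed_span_comb. Qed.

Lemma closed_span_lim f : f \in L2 ->
  (forall e, 0 < e -> exists2 h, CS h & nrm2 (fun x => f x - h x) < e) -> CS f.
Proof.
move=> fL H; apply/closed_spanP; split=> // e e0.
have e4 : 0 < e / 4 by rewrite divr_gt0.
have [h hC fh] := H _ e4.
have /closed_spanP[hL /(_ _ e4) [g gc hg]] := hC.
exists g => //; have := nrm2B fL hL (lin_comb_L2 gc); lra.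
Qed.

Lemma closed_spanD f g : CS f -> CS g -> CS (fun x => f x + g x).
Proof.
move=> /closed_spanP[fL Hf] /closed_spanP[gL Hg]; apply/closed_spanP; split; first exact: L2D.
move=> e e0; have e4 : 0 < e / 4 by rewrite divr_gt0.
have [h hc fh] := Hf _ e4; have [k kc gk] := Hg _ e4.
exists (fun x => h x + k x); first exact: lin_combD.
have := nrm2D (L2B fL (lin_comb_L2 hc)) (L2B gL (lin_comb_L2 kc)).
by under [in X in X <= _ -> _]eq_fun do rewrite addrACA -opprD; lra.
Qed.

Lemma closed_spanZ (k : R) f : CS f -> CS (fun x => k * f x).
Proof.
move=> /closed_spanP[fL Hf]; apply/closed_spanP; split; first exact: L2Z.
have [->|k0] := eqVneq k 0.
  move=> e e0; exists (fun x => 0 * f x) => //.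
    have [h hc _] := Hf 1 ltr01; rewrite (_ : (fun x => _) = (fun x => 0 * h x)).
      exact: lin_combZ.
    by apply/funext => x; rewrite !mul0r.
  rewrite /nrm2; under eq_Rintegral do rewrite subrr expr0n.
  by rewrite /Rintegral integral0.
move=> e e0; have k2 : 0 < k ^+ 2 by rewrite exprn_even_gt0.
have [h hc fh] := Hf (e / k ^+ 2) (divr_gt0 e0 k2).
exists (fun x => k * h x); first exact: lin_combZ.
under [in X in X < _]eq_fun do rewrite -mulrBr.
rewrite nrm2Z; last by apply: L2B => //; exact: lin_comb_L2.
by rewrite mulrC -ltr_pdivlMr.
Qed.

Lemma closed_spanB f g : CS f -> CS g -> CS (fun x => f x - g x).
Proof.
move=> fC gC; have := closed_spanD fC (closed_spanZ (-1) gC).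
by under [in X in X -> _]eq_fun do rewrite mulN1r.
Qed.

Lemma nrm2_0 f : (forall x, f x = 0) -> nrm2 f = 0.
Proof.
move=> f0; rewrite /nrm2; under eq_Rintegral do rewrite f0 expr0n.
by rewrite /Rintegral integral0.
Qed.

Lemma closed_span0 f : CS f -> CS (fun=> 0).
Proof. by move=> /(closed_spanZ 0); under [in X in X -> _]eq_fun do rewrite mul0r. Qed.

Lemma closed_span_sum (I : Type) (s : seq I) (F : I -> T -> R) : CS (fun=> 0) ->
  (forall i, CS (F i)) -> CS (fun x => \sum_(i <- s) F i x).
Proof.
move=> C0 CF; elim: s => [|i s IH].
  by under eq_fun do rewrite big_nil.
by under eq_fun do rewrite big_cons; exact: closed_spanD.
Qed.

Lemma nrm2_cvg0 (F : nat -> T -> R) (G : T -> R) :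
  (forall n, measurable_fun setT (F n)) -> mu.-integrable setT (EFin \o G) ->
  (forall n x, F n x ^+ 2 <= G x) -> (forall x, F n x @[n --> \oo] --> 0) ->
  forall e, 0 < e -> exists n, nrm2 (F n) < e.
Proof.
move=> mF iG FG F0 e e0.
have FL n : F n \in L2 by apply: (L2_dom (mF n) iG).
have H : (\int[mu]_x (F n x ^+ 2)%:E)%E @[n --> \oo] --> (\int[mu]_x (cst 0 x))%E.
  apply: (@dominated_cvg _ _ _ mu setT _ _ _ (EFin \o G)) => //.
  - by move=> n; apply/measurable_EFinP; exact: measurable_funX.
  - move=> x _; apply/fine_cvgP; split; first by near=> n.
    have H2 : F n x * F n x @[n --> \oo] --> (0 : R).
      by rewrite -[X in _ --> X](mulr0 0); apply: cvgM; exact: F0.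
    by apply: cvg_trans H2; apply: near_eq_cvg; near=> n; rewrite /= expr2.
  - by move=> n x _; rewrite /= lee_fin ger0_norm ?sqr_ge0.
move: H; rewrite integral0 => H.
have : (nrm2 (F n))%:E @[n --> \oo] --> 0%E.
  by under eq_cvg do rewrite -nrm2E//; exact: H.
move=> /fine_cvg /cvgrPdist_lt /(_ _ e0) [n _ /(_ n (leqnn n))]/=.
by rewrite sub0r normrN ger0_norm ?nrm2_ge0// => h; exists n.
Unshelve. all: end_near. Qed.

End ClosedSpan.

Section RieszFischer.
Context d (T : measurableType d) (R : realType).
Variable mu : {measure set T -> \bar R}.
Local Notation L2 := (Lfun mu 2%:E).
Local Notation nrm2 := (nrm2 mu).

Lemma nrm2_cvg (h : nat -> T -> R) Z : Z \in L2 -> (forall n, h n \in L2) ->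
  nrm2 (fun w => Z w - h n w) @[n --> \oo] --> (0 : R) ->
  nrm2 (h n) @[n --> \oo] --> nrm2 Z.
Proof.
move=> ZL hL h0; apply/cvgrPdist_lt => e e0.
set K := nrm2 Z + 1; have K0 : 0 < K by rewrite /K ltr_wpDl ?nrm2_ge0.
pose dl := Num.min 1 (e / (8 * K)).
have dl0 : 0 < dl by rewrite lt_min ltr01 divr_gt0// mulr_gt0.
have dl1 : dl <= 1 by rewrite ge_min lexx.
have dle : dl * K <= e / 8.
  have : dl <= e / (8 * K) by rewrite ge_min lexx orbT.
  by rewrite invfM mulrA ler_pdivlMr.
have C0 : 0 < 1 + dl^-1 by rewrite addr_gt0 ?invr_gt0.
have ev : \forall n \near \oo, `|0 - nrm2 (fun w => Z w - h n w)| < Num.min (e / 8 / (1 + dl^-1)) (dl / 8).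
  by move/cvgrPdist_lt : h0; apply; rewrite lt_min !divr_gt0.
near=> n.
have : `|0 - nrm2 (fun w => Z w - h n w)| < Num.min (e / 8 / (1 + dl^-1)) (dl / 8) by near: n.
rewrite sub0r normrN ger0_norm ?nrm2_ge0// lt_min => /andP[n1 n2].
set x := nrm2 (fun w => Z w - h n w) in n1 n2.
have {}n1 : (1 + dl^-1) * x < e / 8 by rewrite mulrC -ltr_pdivlMr.
have x0 : 0 <= x by exact: nrm2_ge0.
have c1 : nrm2 Z <= (1 + dl) * nrm2 (h n) + (1 + dl^-1) * x := nrm2_close dl0 ZL (hL n).
have c2 : nrm2 (h n) <= (1 + dl) * nrm2 Z + (1 + dl^-1) * x.
  by have := nrm2_close dl0 (hL n) ZL; rewrite nrm2N.
have Z0 := nrm2_ge0 mu Z; have hn0 := nrm2_ge0 mu (h n).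
have ZK : nrm2 Z = K - 1 by rewrite /K addrK.
have dlZ : dl * nrm2 Z = dl * K - dl by rewrite ZK; ring.
have a1 : dl * nrm2 (h n) <= dl * ((1 + dl) * nrm2 Z + (1 + dl^-1) * x).
  by rewrite ler_wpM2l// ltW.
have a2 : dl * ((1 + dl) * nrm2 Z + (1 + dl^-1) * x) <= (1 + dl) * (dl * nrm2 Z) + (1 + dl^-1) * x.
  rewrite mulrDr; apply: lerD; first by rewrite mulrCA.
  by rewrite -[leRHS]mul1r ler_wpM2r// mulr_ge0// ltW.
have a3 : (1 + dl) * (dl * nrm2 Z) <= 2 * (dl * nrm2 Z).
  by apply: ler_wpM2r; [rewrite mulr_ge0// ltW|lra].
have c1' : nrm2 Z <= nrm2 (h n) + dl * nrm2 (h n) + (1 + dl^-1) * x.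
  by rewrite -[X in X + _ + _]mul1r -mulrDl.
have c2' : nrm2 (h n) <= nrm2 Z + dl * nrm2 Z + (1 + dl^-1) * x.
  by rewrite -[X in X + _ + _]mul1r -mulrDl.
by rewrite ltr_norml; apply/andP; split; lra.
Unshelve. all: by end_near. Qed.

(* Where [g w] bounds every [4 ^ k * (z (k + 1) - z k) ^ 2], the sequence is Cauchy at rate 2 ^ - k. *)
Lemma dyadic_cauchy (z : nat -> R) (g : R) :
  (forall k, 4 ^+ k * (z k.+1 - z k) ^+ 2 <= g) ->
  cvgn z /\ forall m, (limn z - z m) ^+ 2 <= 4 * g * 4^-1 ^+ m.
Proof.
move=> zg; have g0 : 0 <= g by apply: le_trans (zg 0%N); rewrite mulr_ge0// sqr_ge0.
set s := Num.sqrt g; have s0 : 0 <= s by exact: sqrtr_ge0.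
have sg : s ^+ 2 = g by rewrite sqr_sqrtr.
have dz k : `|z k.+1 - z k| <= s * 2^-1 ^+ k.
  rewrite -(@ler_pXn2r _ 2) ?nnegrE ?normr_ge0 ?mulr_ge0 ?exprn_ge0 ?invr_ge0//.
  rewrite real_normK ?num_real// exprMn sg -exprM mulnC exprM exprVn.
  have -> : (2 ^+ 2)^-1 = 4^-1 :> R by congr (_^-1); ring.
  by rewrite exprVn ler_pdivlMr ?exprn_gt0// mulrC.
have dm m n : `|z (m + n)%N - z m| <= s * 2^-1 ^+ m * (2 - 2 * 2^-1 ^+ n).
  elim: n => [|n IH]; first by rewrite addn0 subrr normr0 expr0 mulr1 subrr mulr0.
  have -> : z (m + n.+1)%N - z m = (z (m + n).+1 - z (m + n)%N) + (z (m + n)%N - z m).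
    by rewrite addnS; ring.
  apply: le_trans (ler_normD _ _) _; apply: le_trans (lerD (dz _) IH) _.
  by rewrite exprD exprS le_eqVlt; apply/orP; left; apply/eqP; field.
have zc : cvgn z.
  have : cvgn [normed series (telescope z)].
    apply: (@series_le_cvg _ _ (geometric s 2^-1)).
    - by move=> n /=; exact: normr_ge0.
    - by move=> n /=; rewrite mulr_ge0// exprn_ge0// invr_ge0.
    - by move=> n; exact: dz.
    - by apply: is_cvg_geometric_series; rewrite ger0_norm ?invr_ge0//; lra.
  move/normed_cvg; rewrite telescopeK => c.
  have -> : z = (fun n => (z n - z 0%N) + z 0%N) by apply/funext => n; rewrite subrK.
  by apply: is_cvgD => //; exact: is_cvg_cst.
split=> // m.
have : `|limn z - z m| <= s * 2^-1 ^+ m * 2.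
  have c : `|z (n + m)%N - z m| @[n --> \oo] --> `|limn z - z m|.
    apply: cvg_norm; apply: cvgB; last exact: cvg_cst.
    by have := zc; rewrite -(cvg_shiftn m).
  apply: (cvgr_to_le c); apply: nearW => n; rewrite addnC.
  apply: le_trans (dm m n) _; apply: ler_wpM2l.
    by rewrite mulr_ge0// exprn_ge0// invr_ge0.
  by have : 0 <= 2^-1 ^+ n :> R; [rewrite exprn_ge0// invr_ge0|lra].
have p0 : 0 <= s * 2^-1 ^+ m * 2 by rewrite mulr_ge0 ?ler0n// mulr_ge0 ?exprn_ge0 ?invr_ge0.
rewrite -(@ler_pXn2r _ 2) ?nnegrE ?normr_ge0//.
rewrite real_normK ?num_real// !exprMn sg -exprM mulnC exprM !exprVn.
have -> : (2 ^+ 2) = 4 :> R by ring.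
by move=> h; apply: le_trans h _; rewrite mulrAC [4 * g]mulrC -!mulrA [4 * _]mulrC.
Qed.

Lemma riesz_fischer (Z : nat -> T -> R) : (forall n, Z n \in L2) ->
  (forall n, nrm2 (fun w => Z n.+1 w - Z n w) <= 8^-1 ^+ n) ->
  exists2 Y, Y \in L2 & nrm2 (fun w => Y w - Z n w) @[n --> \oo] --> (0 : R).
Proof.
move=> ZL Zn.
have mZ n := L2_measurable (ZL n).
pose D k w := 4 ^+ k * (Z k.+1 w - Z k w) ^+ 2.
have D0 k w : 0 <= D k w by rewrite mulr_ge0 ?sqr_ge0// exprn_ge0.
have mD k : measurable_fun setT (D k).
  by apply: measurable_funM => //; apply: measurable_funX; apply: measurable_funB.
pose G w := (\sum_(k <oo) (D k w)%:E)%E.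
have mG : measurable_fun setT G.
  apply: (@ge0_emeasurable_sum _ _ _ _ (fun k w => (D k w)%:E) xpredT) => //.
    by move=> k w _ _; rewrite lee_fin.
  by move=> k _; exact/measurable_EFinP.
have G0 w : (0 <= G w)%E by apply: nneseries_ge0 => k _ _; rewrite lee_fin.
have iD k : (\int[mu]_w (D k w)%:E = (4 ^+ k * nrm2 (fun w => Z k.+1 w - Z k w))%:E)%E.
  under eq_integral do rewrite EFinM.
  rewrite ge0_integralZl_EFin//; first by rewrite nrm2E ?EFinM//; exact: L2B.
  - by move=> w _; rewrite lee_fin sqr_ge0.
  - by apply/measurable_EFinP; apply: measurable_funX; apply: measurable_funB.
have iG : (\int[mu]_w G w <= 2%:E)%E.
  rewrite integral_nneseries//; last 2 first.
  - by move=> k; exact/measurable_EFinP.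
  - by move=> k w _; rewrite lee_fin.
  - apply: lime_le.
      by apply: is_cvg_nneseries => k _ _; apply: integral_ge0 => w _; rewrite lee_fin.
    apply: nearW => n; under eq_bigr do rewrite iD.
    rewrite sumEFin lee_fin.
    apply: (@le_trans _ _ (series (geometric 1 2^-1) n)).
      rewrite /series/= !big_mkord; apply: ler_sum => k _.
      apply: le_trans (ler_wpM2l (exprn_ge0 _ _) (Zn k)) _ => //.
      by rewrite mul1r -exprMn le_eqVlt; apply/orP; left; apply/eqP; congr (_ ^+ _); field.
    have hf : `|2^-1 : R| < 1 by rewrite ger0_norm ?invr_ge0//; lra.
    have := @geometric_le_lim R n 1 2^-1 ler01 _ hf; rewrite invr_gt0 ltr0n => /(_ isT).
    by rewrite mul1r (_ : 1 - 2^-1 = 2^-1 :> R) ?invrK//; field.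
have intG : mu.-integrable setT G.
  apply/integrableP; split=> //; under eq_integral do rewrite gee0_abs//.
  by apply: le_lt_trans iG _; exact: ltry.
pose F := [set w | G w \is a fin_num].
have mF : measurable F.
  by rewrite -[F]setTI; exact: emeasurable_fin_num.
pose g w := fine (G w).
have mg : measurable_fun setT g by exact: measurableT_comp.
have ig : mu.-integrable setT (EFin \o g).
  apply: (@le_integrable _ _ _ _ _ measurableT _ G) => //; first exact/measurable_EFinP.
  move=> w _.
  by rewrite /g /=; case: (G w) => //= *; rewrite normr0 leey.
have g0 w : 0 <= g w by exact: fine_ge0.
have Dg w k : F w -> D k w <= g w.
  move=> Fw; rewrite -lee_fin /g fineK//.
  apply: le_trans (nneseries_lim_ge k.+1 _) => [|n _ _]; last by rewrite lee_fin.
  by rewrite big_mkord big_ord_recr/= leeDr// sume_ge0// => i _; rewrite lee_fin.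
pose Z' n w := \1_F w * Z n w.
have mZ' n : measurable_fun setT (Z' n) by apply: measurable_funM => //; exact: measurable_indic.
have Z'c w : cvgn (Z' ^~ w) /\ forall m, (limn (Z' ^~ w) - Z' m w) ^+ 2 <= 4 * g w * 4^-1 ^+ m.
  apply: dyadic_cauchy => k; rewrite /Z' indicE; have [wF|wF] := boolP (w \in F).
    by rewrite !mul1r; exact: Dg (set_mem wF).
  by rewrite !mul0r subrr expr0n mulr0.
pose Y w := limn (Z' ^~ w).
have mY : measurable_fun setT Y.
  by apply: (measurable_fun_cvg mZ') => w _; have [] := Z'c w.
have nE (h : T -> R) : nrm2 h = fine (\int[mu]_w ((h w) ^+ 2)%R%:E)%E by [].
have aeZ (H : T -> R) n : measurable_fun setT H -> nrm2 (fun w => H w - Z n w) = nrm2 (fun w => H w - Z' n w).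
  move=> mH; rewrite !nE; congr fine; apply: ae_eq_integral => //.
  - by apply/measurable_EFinP; apply: measurable_funX; apply: measurable_funB.
  - by apply/measurable_EFinP; apply: measurable_funX; apply: measurable_funB.
  have := integrable_ae measurableT intG; apply: filterS => w Gw _.
  by rewrite /Z' indicE mem_set ?mul1r//; exact: Gw.
have ig4 m : mu.-integrable setT (EFin \o (fun w => 4 * 4^-1 ^+ m * g w)) by exact: integrable_scale.
have YB m : (fun w => Y w - Z' m w) \in L2.
  apply: (L2_dom _ (ig4 m)); first by apply: measurable_funB.
  by move=> w; have [_ /(_ m)] := Z'c w; rewrite -!mulrA [g w * _]mulrC.
have Z'L n : Z' n \in L2.
  apply: (L2_dom (mZ' n) (L2_sqr (ZL n))) => w; rewrite /Z' indicE exprMn.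
  by case: (_ \in _); rewrite ?expr1n ?mul1r// expr0n mul0r sqr_ge0.
exists Y.
  have -> : Y = (fun w => (Y w - Z' 0%N w) + Z' 0%N w) by apply/funext => w; rewrite subrK.
  exact: (L2D (YB 0%N) (Z'L 0%N)).
apply: (@squeeze_cvgr _ _ _ _ (fun=> 0) (fun m => 4 * (\int[mu]_w g w) * 4^-1 ^+ m)); first last.
- by apply: cvg_geometric; rewrite ger0_norm ?invr_ge0//; lra.
- exact: cvg_cst.
apply: nearW => m; rewrite nrm2_ge0/= (aeZ _ _ mY).
have := nrm2_le (YB m) (ig4 m); rewrite (RintegralZl _ measurableT ig) mulrAC; apply.
by move=> w; have [_ /(_ m)] := Z'c w; rewrite -!mulrA [g w * _]mulrC.
Qed.

End RieszFischer.

Section WeightedIndicators.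
Import HBNNSimple.
Variable R : realType.
Local Notation TR := (measurableTypeR R).
Variable mu : {measure set TR -> \bar R}.
Variable S : set (TR -> R).
Hypothesis S_L2 : forall g, S g -> g \in Lfun mu 2%:E.
Variable psi : TR -> R.
Local Notation CS := (closed_span mu S).
Hypothesis psiC : CS psi.
Hypothesis rayC : forall s : R, CS (fun x => \1_(`]s, +oo[%classic) x * psi x).

Let psiL : psi \in Lfun mu 2%:E. Proof. exact: closed_span_L2 psiC. Qed.
Let mpsi : measurable_fun setT psi. Proof. exact: L2_measurable psiL. Qed.
Let ipsi : mu.-integrable setT (EFin \o (fun x => psi x ^+ 2)). Proof. exact: L2_sqr. Qed.

Let indic_psi_L2 U : measurable U -> (fun x => \1_U x * psi x) \in Lfun mu 2%:E.
Proof.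
move=> mU; apply: (L2_dom _ ipsi).
  by apply: measurable_funM.
move=> x; rewrite exprMn indicE; case: (x \in U).
  by rewrite expr1n mul1r.
by rewrite expr0n mul0r sqr_ge0.
Qed.

Lemma closed_span_indic U : measurable U -> CS (fun x => \1_U x * psi x).
Proof.
move=> mU.
have := @dynkin_induction _ TR (@RGenOInfty.G R)
  (fun U => CS (fun x => \1_U x * psi x)) (@RGenOInfty.measurableE R).
have sU : (@RGenOInfty.G R).-sigma.-measurable U by rewrite -RGenOInfty.measurableE.
move=> H; apply: (H _ _ _ _ _ U sU) => {U mU sU H}.
- move=> A B [x ->] [y ->]; exists (Num.max x y).
  by apply/seteqP; split=> z; rewrite /= !in_itv/= !andbT gt_max => /andP.
- by rewrite indicT; under eq_fun do rewrite mul1r.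
- by move=> A [s ->]; exact: rayC.
- move=> A mA AC; have := closed_spanB S_L2 psiC AC.
  rewrite (_ : (fun x => psi x - _) = fun x => \1_(~` A) x * psi x)//.
  by apply/funext => x; rewrite !indicE in_setC; case: (x \in A); rewrite /= ?mul1r ?mul0r ?subrr ?subr0.
move=> F mF tF FC.
have mU' : measurable (\bigcup_k F k) by exact: bigcupT_measurable.
apply: (closed_span_lim S_L2); first exact: indic_psi_L2.
have C0 : CS (fun=> 0) by exact: closed_span0 psiC.
pose G n x := \1_(\bigcup_k F k) x * psi x - \sum_(i <- iota 0 n) \1_(F i) x * psi x.
have GE n x : G n x = \1_(\bigcup_(k in [set k | (n <= k)%N]) F k) x * psi x.
  rewrite /G -mulr_suml -mulrBl; congr (_ * _).
  have [[k _ Fk]|nF] := pselect ((\bigcup_k F k) x); last first.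
    have nFn : ~ (\bigcup_(k in [set k | (n <= k)%N]) F k) x.
      by move=> [k _ Fk]; apply: nF; exists k.
    rewrite !indicE (memNset nF) (memNset nFn) big1 ?subr0// => i _.
    by rewrite indicE memNset// => Fi; apply: nF; exists i.
  have uniqk i : F i x -> i = k.
    by move=> Fi; apply: (tF i k) => //; exists x.
  rewrite [X in X - _]indicE mem_set; last by exists k.
  have [nk|kn] := leqP n k.
    rewrite indicE mem_set; last by exists k.
    rewrite big_seq big1 ?subr0// => i; rewrite mem_iota add0n => /andP[_ iltn].
    rewrite indicE memNset// => /uniqk ik; by move: iltn; rewrite ik ltnNge nk.
  rewrite indicE memNset; last first.
    by move=> [j /= nj /uniqk jk]; move: nj; rewrite jk leqNgt kn.
  rewrite (bigD1_seq k) ?iota_uniq ?mem_iota ?add0n//= indicE mem_set//.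
  rewrite big1 ?addr0 ?subrr// => i ik; rewrite indicE memNset// => /uniqk ik'.
  by rewrite ik' eqxx in ik.
move=> e e0.
have [|||n Hn] := @nrm2_cvg0 _ TR R mu G _ _ ipsi _ _ e e0.
- move=> n; apply: measurable_funB; first exact: L2_measurable (indic_psi_L2 mU').
  by apply: measurable_sum => i; exact: L2_measurable (indic_psi_L2 (mF i)).
- move=> n x; rewrite GE exprMn indicE; case: (x \in _).
    by rewrite expr1n mul1r.
  by rewrite expr0n mul0r sqr_ge0.
- move=> x; have [[k _ Fk]|nF] := pselect ((\bigcup_k F k) x); last first.
    apply: cvg_near_cst; apply: nearW => n; rewrite GE indicE memNset ?mul0r//.
    by move=> [k _ Fk]; apply: nF; exists k.
  apply: cvg_near_cst; exists k.+1 => // n /= kn.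
  rewrite GE indicE memNset ?mul0r// => -[j /= nj Fj].
  have jk : j = k by apply: (tF j k) => //; exists x.
  by move: kn; rewrite -jk ltnNge nj.
exists (fun x => \sum_(i <- iota 0 n) \1_(F i) x * psi x) => //.
exact: closed_span_sum.
Qed.

Lemma closed_span_ge0 (g : TR -> R) : measurable_fun setT g -> (forall x, 0 <= g x) ->
  (fun x => g x * psi x) \in Lfun mu 2%:E -> CS (fun x => g x * psi x).
Proof.
move=> mg g0 gL; apply: (closed_span_lim S_L2) => //.
have mg' : measurable_fun setT (EFin \o g) by exact/measurable_EFinP.
pose h n := nnsfun_approx measurableT mg' n.
have g0' x : setT x -> (0%R <= (EFin \o g) x)%E by rewrite /= lee_fin.
have hg n x : h n x <= g x.
  by rewrite -lee_fin /h nnsfun_approxE; exact: le_approx.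
have hcvg x : h n x @[n --> \oo] --> g x.
  have := @cvg_nnsfun_approx _ _ _ _ measurableT _ mg' g0' x I.
  by move/fine_cvg; exact: cvg_trans.
move=> e e0.
have [|||n Hn] := @nrm2_cvg0 _ TR R mu (fun n x => g x * psi x - h n x * psi x) _ _ (L2_sqr gL) _ _ e e0.
- move=> n; apply: measurable_funB; first exact: L2_measurable gL.
  by apply: measurable_funM => //; exact: measurable_funP.
- move=> n x; rewrite -mulrBl !exprMn ler_wpM2r ?sqr_ge0//.
  have h0 : 0 <= h n x by [].
  by rewrite lerXn2r ?nnegrE ?subr_ge0//; have := hg n x; lra.
- move=> x; rewrite -[X in _ --> X](subrr (g x * psi x)); apply: cvgB; first exact: cvg_cst.
  by apply: cvgM => //; exact: cvg_cst.
exists (fun x => h n x * psi x) => //.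
rewrite (_ : (fun x => _) = fun x => \sum_(y <- finmap.enum_fset (fset_set (range (h n))))
    y * (\1_(h n @^-1` [set y]) x * psi x)); last first.
  apply/funext => x; rewrite fimfunE fsbig_finite//= mulr_suml.
  by apply: eq_bigr => y _; rewrite mulrA.
have C0 : CS (fun=> 0) by exact: closed_span0 psiC.
apply: closed_span_sum => // y; apply: closed_spanZ => //.
exact: closed_span_indic.
Qed.

Lemma closed_span_weight (g : TR -> R) : measurable_fun setT g ->
  (fun x => g x * psi x) \in Lfun mu 2%:E -> CS (fun x => g x * psi x).
Proof.
move=> mg gL.
have mp : measurable_fun setT (fun x => Num.max (g x) 0) by exact: measurable_maxr.
have mn : measurable_fun setT (fun x => Num.max (- g x) 0).
  by apply: measurable_maxr => //; exact: measurableT_comp.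
have dom (k : TR -> R) : measurable_fun setT k -> (forall x, `|k x| <= `|g x|) ->
    (fun x => k x * psi x) \in Lfun mu 2%:E.
  move=> mk kg; apply: (L2_dom _ (L2_sqr gL)); first exact: measurable_funM.
  move=> x; rewrite !exprMn ler_wpM2r ?sqr_ge0//.
  by rewrite -[leLHS]real_normK ?num_real// -[leRHS]real_normK ?num_real// lerXn2r ?nnegrE.
rewrite (_ : (fun x => _) = fun x => Num.max (g x) 0 * psi x - Num.max (- g x) 0 * psi x).
  apply: (closed_spanB S_L2); apply: closed_span_ge0 => //.
  - by move=> x; rewrite le_max lexx orbT.
  - by apply: dom => // x; case: (leP (g x) 0) => // _; rewrite normr0.
  - by move=> x; rewrite le_max lexx orbT.
  - by apply: dom => // x; case: (leP (- g x) 0) => // _; rewrite ?normr0 ?normrN.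
apply/funext => x; rewrite -mulrBl; congr (_ * _).
by case: (leP (g x) 0); case: (leP (- g x) 0); lra.
Qed.

End WeightedIndicators.

Section EigenBasis.
Variables (R : realType) (p : R -> R) (a b : R -> R -> R).
Hypothesis S : sturm p a b.
Variables (r : R) (lam : nat -> R).
Hypothesis r0 : 0 < r.
Hypothesis lamP : forall n, 0 < lam n /\ pruefer_angle p a b (lam n) r = pi / 2 + n%:R * pi.
Hypothesis lamH : {homo lam : m n / (m < n)%N >-> m < n}.
Hypothesis lam_ar : forall n, a (lam n) r = 0.
Hypothesis lam_large : forall n, pi * n%:R <= lam n * prim0y (sturm_bound p) r.
Implicit Types (s t : R) (n : nat).

Local Notation TR := (measurableTypeR R).
Local Notation leb := (@lebesgue_measure R).
Local Notation J := (`[0, r]%classic : set TR).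
Local Notation Q := (sturm_norm p b r lam).
Local Notation B n := (b (lam n)).
Local Notation al := (prim0y p).

Let p0 t : 0 <= t -> 0 < p t. Proof. exact: (sturm_gt0 S). Qed.
Let pn0 t : 0 <= t -> p t != 0. Proof. by move=> /p0; rewrite lt0r => /andP[]. Qed.
Let r0' : 0 <= r := ltW r0.
Let cp : cnn p := sturm_cont S.
Let lam0 n : 0 < lam n. Proof. by have [] := lamP n. Qed.
Let Q0 n : 0 < Q n. Proof. exact: (sturm_norm_gt0 S r0 lamP lamH lam_ar). Qed.

Lemma eigen_unbounded (X : R) : exists N, X < lam N.
Proof.
have q0 := prim_bound_gt0 S r0; have pi0 := pi_gt0 R.
have [X0|X0] := leP X 0; first by exists 0%N; exact: le_lt_trans X0 (lam0 0).
exists (Num.bound (X * prim0y (sturm_bound p) r / pi)).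
rewrite -(ltr_pM2r q0); apply: lt_le_trans (lam_large _).
rewrite -ltr_pdivrMl// [ltLHS]mulrC.
apply: archi_boundP.
by rewrite divr_ge0 ?(ltW pi0)// mulr_ge0 ?(ltW q0)// ltW.
Qed.

Lemma sturm_bounded : exists2 C, 0 < C &
  forall t, 0 <= t <= r -> p t <= C /\ (p t)^-1 <= C.
Proof.
have [|c cr qc] := @EVT_max R (sturm_bound p) 0 r r0'.
  by apply: cont_within => t; rewrite /= in_itv/= => /andP[t0 _]; exact: (sturm_cbound S).
exists (sturm_bound p c).
  by move: cr; rewrite in_itv/= => /andP[c0 _]; have [] := sturm_boundP S c0.
move=> t tr; have /andP[t0 _] := tr; have [_ h1 h2 _ _] := sturm_boundP S t0.
have qt : sturm_bound p t <= sturm_bound p c by apply: qc; rewrite in_itv.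
by split; [exact: le_trans h1 qt|exact: le_trans h2 qt].
Qed.

Lemma cnn_within f : cnn f -> {within J, continuous f}.
Proof.
by move=> cf; apply: cont_within => t; rewrite /= in_itv/= => /andP[t0 _]; exact: cf.
Qed.

Lemma restrict_measurable f : cnn f -> measurable_fun setT (f \_ J : TR -> R).
Proof.
move=> /cnn_within cf; apply/(measurable_restrictT _ _).1 => //.
exact: subspace_continuous_measurable_fun.
Qed.

Lemma restrict_integrable f : cnn f -> leb.-integrable setT (EFin \o (f \_ J : TR -> R)).
Proof.
move=> cf; rewrite -restrict_EFin; apply/integrable_restrict => //=.
by rewrite setTI; apply: cont_integrable; exact: cnn_within.
Qed.

Lemma restrict_sqr (f : TR -> R) x : (f \_ J) x ^+ 2 = ((fun t => f t ^+ 2) \_ J) x.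
Proof. by rewrite !patchE; case: ifP => // _; rewrite expr0n. Qed.

Lemma restrict_L2 f : cnn f -> (f \_ J : TR -> R) \in Lfun leb 2%:E.
Proof.
move=> cf; apply: (@L2_dom _ _ _ _ _ ((fun t => f t ^+ 2) \_ J : TR -> R)).
- exact: restrict_measurable.
- exact: restrict_integrable (cnnX2 cf).
- by move=> x; rewrite restrict_sqr.
Qed.

Lemma restrict_nrm2 f : cnn f -> nrm2 leb (f \_ J : TR -> R) = prim0y (fun t => f t ^+ 2) r.
Proof.
move=> cf; rewrite prim0yE// [RHS]Rintegral_mkcond /nrm2.
by apply: eq_Rintegral => x _; rewrite restrict_sqr.
Qed.

Lemma nrm2_indic_le (f : TR -> R) (C u v : R) : f \in Lfun leb 2%:E -> 0 <= C -> u <= v ->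
  (forall x, f x ^+ 2 <= C * \1_(`[u, v]%classic) x) -> nrm2 leb f <= C * (v - u).
Proof.
move=> fL C0 uv fC.
have mi : measurable (`[u, v]%classic : set TR) by [].
have ii : leb.-integrable setT (EFin \o (\1_(`[u, v]%classic) : TR -> R)).
  rewrite (_ : \1_ _ = ((fun _ : TR => 1 : R) \_ (`[u, v]%classic : set TR) : TR -> R)); last first.
    by apply/funext => x; rewrite indicE patchE; case: ifP.
  rewrite -restrict_EFin; apply/integrable_restrict => //=.
  by rewrite setTI; apply: cont_integrable; apply: cont_within => t _; exact: cvg_cst.
have -> : C * (v - u) = \int[leb]_x (C * \1_(`[u, v]%classic) x).
  rewrite RintegralZl//; congr (_ * _).
  rewrite /Rintegral integral_indic// ?setIT ?setTI.
  transitivity (fine (lebesgue_measure ([set` Interval (BLeft u) (BRight v)] : set R))) => //.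
  rewrite lebesgue_measure_itv/= lte_fin.
  by move: uv; rewrite le_eqVlt => /predU1P[->|->]//; rewrite ltxx/= subrr.
by apply: nrm2_le => //; exact: integrable_scale.
Qed.

Definition eigenfun n t := (Num.sqrt (Q n))^-1 * (B n t / Num.sqrt (p t)).
Local Notation phi := eigenfun.

Let csV : cnn (fun t => (Num.sqrt (p t))^-1).
Proof.
apply: cnnV; first by move=> t t0; rewrite gt_eqF// sqrtr_gt0 p0.
by apply: cnn_comp => //; exact: sqrt_continuous.
Qed.
Let cB n : cnn (B n). Proof. exact: (@sturm_cb _ _ _ _ S). Qed.
Let cphi n : cnn (phi n).
Proof. by apply: cnnM; [exact: cnn_cst|exact: cnnM]. Qed.

Let sqp t : 0 <= t -> (Num.sqrt (p t))^-1 * (Num.sqrt (p t))^-1 = (p t)^-1.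
Proof. by move=> t0; rewrite -invfM -expr2 sqr_sqrtr// ltW// p0. Qed.

Lemma eigenfun_orthonormal m n :
  \int[leb]_(t in J) (phi m t * phi n t) = (m == n)%:R.
Proof.
rewrite -prim0yE//.
rewrite (prim0y_eq (g := fun t => ((Num.sqrt (Q m))^-1 * (Num.sqrt (Q n))^-1) * (B m t * B n t / p t)))//.
  rewrite prim0yZ//; last first.
    by apply: cnnM; [exact: cnnM|exact: (@sturm_cVp _ _ _ _ S)].
  rewrite (sturm_orthogonal S r0 lamP lamH lam_ar).
  have [->|_] := eqVneq m n; last by rewrite mul0r mulr0.
  by rewrite mul1r -invfM -expr2 sqr_sqrtr ?(ltW (Q0 _))// mulVf// gt_eqF.
by move=> t t0; rewrite /phi -sqp//; ring.
Qed.

Let SS : set (TR -> R) := [set phi n \_ J | n in [set: nat]].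
Let SL2 g : SS g -> g \in Lfun leb 2%:E.
Proof. by move=> [n _ <-]; exact: restrict_L2. Qed.
Local Notation CS := (closed_span leb SS).

Let psi : TR -> R := (fun t => (Num.sqrt (p t))^-1) \_ J.

Let greenC s : 0 <= s <= r ->
  CS ((fun t => green p s t * (Num.sqrt (p t))^-1) \_ J : TR -> R).
Proof.
move=> sr; have /andP[s0 _] := sr.
have cg : cnn (green p s) by exact: (cnn_green S sr).
apply: (closed_span_lim SL2); first by apply: restrict_L2; exact: cnnM.
move=> e e0; have [C C0 pC] := sturm_bounded.
have [N HN] := eigen_unbounded (Num.max 1 (2 * C / e)).
move: HN; rewrite gt_max => /andP[N1 NC].
pose c (n : 'I_N) := mercer_coef p b r lam s n * Num.sqrt (Q n).
have cU : cnn (mercer_rem p b r lam s N).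
  apply: cnnB => //; apply: cnn_sum => i; apply: cnnM => //; exact: cnn_cst.
exists (fun x => \sum_(n < N) c n * ((phi n) \_ J : TR -> R) x).
  apply: (closed_span_comb SL2); exists N, c, (fun n => phi n \_ J); split => //.
  by move=> i; exists i.
have -> : (fun x => ((fun t => green p s t * (Num.sqrt (p t))^-1) \_ J : TR -> R) x -
    \sum_(n < N) c n * ((phi n) \_ J : TR -> R) x) =
  ((fun t => mercer_rem p b r lam s N t * (Num.sqrt (p t))^-1) \_ J : TR -> R).
  apply/funext => x; rewrite !patchE; case: ifPn => xJ.
    rewrite /mercer_rem mulrBl mulr_suml; congr (_ - _); apply: eq_bigr => i _.
    rewrite patchE xJ /c /phi; have : Num.sqrt (Q i) != 0 by rewrite gt_eqF// sqrtr_gt0.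
    by move=> q0; rewrite mulrA mulfK//; ring.
  by rewrite big1 ?subr0// => i _; rewrite patchE (negbTE xJ) mulr0.
rewrite restrict_nrm2; last exact: cnnM.
rewrite (prim0y_eq (g := fun t => mercer_rem p b r lam s N t ^+ 2 / p t))//; last first.
  by move=> t t0; rewrite exprMn [X in _ * X]expr2 sqp.
have h1 := mercer_norm_le S r0 lamP lamH lam_ar sr N.
have h2 := mercer_rem_le S r0 lamP lamH lam_ar sr N (fun t tr => proj1 (pC t tr)).
set X := prim0y _ _ in h1 *.
have X0 : 0 <= X.
  apply: prim0y_ge0 => //; first by apply: cnnM; [exact: cnnX2|exact: (@sturm_cVp _ _ _ _ S)].
  by move=> t /andP[t0 _]; rewrite divr_ge0 ?sqr_ge0// ltW// p0.
have h3 : X <= lam N ^+ 2 * X by rewrite ler_peMl// exprn_ege1//; exact: ltW.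
apply: (le_lt_trans h3); apply: (le_lt_trans h1); apply: (le_lt_trans h2).
by rewrite ltr_pdivrMr// [ltRHS]mulrC -ltr_pdivrMr.
Qed.

Let psi_sqr_le (C : R) x : (forall t, 0 <= t <= r -> p t <= C /\ (p t)^-1 <= C) -> 0 <= C ->
  psi x ^+ 2 <= C.
Proof.
move=> pC C0; rewrite /psi patchE; case: ifPn => [|_]; last by rewrite expr0n.
rewrite mem_setE/= in_itv/= => xr; have /andP[x0 _] := xr.
by rewrite expr2 sqp//; have [] := pC _ xr.
Qed.

Let psiL2 : psi \in Lfun leb 2%:E. Proof. exact: restrict_L2. Qed.

Let rayL2 s : (fun x => \1_(`]s, +oo[%classic) x * psi x) \in Lfun leb 2%:E.
Proof.
apply: (L2_dom _ (L2_sqr psiL2)).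
  by apply: measurable_funM; [exact: measurable_indic|exact: L2_measurable psiL2].
move=> x; rewrite exprMn indicE; case: (x \in _).
  by rewrite expr1n mul1r.
by rewrite expr0n mul0r sqr_ge0.
Qed.

Let al_incr s t : 0 <= s -> s < t -> al s < al t.
Proof.
move=> s0 st; apply: (incr_drv st (df := p)) => u /andP[su _].
  by apply: prim0y_derive => //; exact: le_trans su.
by apply: p0; exact: le_trans su.
Qed.

Let ray_inside s : 0 <= s -> s < r -> CS (fun x => \1_(`]s, +oo[%classic) x * psi x).
Proof.
move=> s0 sr; have [C C0 pC] := sturm_bounded.
apply: (closed_span_lim SL2); first exact: rayL2.
move=> e e0; pose h := Num.min (r - s) (e / (2 * C)).
have h0 : 0 < h by rewrite lt_min subr_gt0 sr divr_gt0// mulr_gt0.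
have hr : s + h <= r by rewrite -lerBrDl ge_min lexx.
have hC : C * h < e.
  apply: (@le_lt_trans _ _ (C * (e / (2 * C)))).
    by rewrite ler_wpM2l ?(ltW C0)// ge_min lexx orbT.
  rewrite [ltLHS](_ : _ = e / 2); first by lra.
  by field; rewrite gt_eqF.
have ssh : s < s + h by rewrite ltrDl.
have sr1 : 0 <= s <= r by rewrite s0 ltW.
have sr2 : 0 <= s + h <= r by rewrite hr addr_ge0// ltW.
pose D := al (s + h) - al s.
have D0 : 0 < D by rewrite subr_gt0 al_incr.
pose k x := D^-1 * (((fun t => green p (s + h) t * (Num.sqrt (p t))^-1) \_ J : TR -> R) x -
  ((fun t => green p s t * (Num.sqrt (p t))^-1) \_ J : TR -> R) x).
have kC : CS k.
  by apply: (closed_spanZ SL2); apply: (closed_spanB SL2); exact: greenC.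
exists k => //; apply: le_lt_trans hC.
have -> : h = s + h - s by ring.
apply: nrm2_indic_le => //; [|exact: ltW|exact: ltW|].
  by apply: L2B; [exact: rayL2|exact: closed_span_L2 kC].
move=> x.
have kE : k x = (green p (s + h) x - green p s x) / D * psi x.
  by rewrite /k /psi !patchE; case: ifP => _; rewrite ?subrr ?mulr0//; ring.
rewrite kE -mulrBl exprMn.
have [xJ|xJ] := boolP (x \in J); last first.
  rewrite /psi patchE (negbTE xJ) expr0n mulr0 mulr_ge0 ?(ltW C0)//.
move: xJ; rewrite mem_setE/= in_itv/= => /andP[x0 xr].
rewrite mulrC indicE [in X in _ * (X - _) ^+ 2]mem_setE/= in_itv/= andbT /green.
have [xs|sx] := leP x s.
  rewrite !min_r ?(le_trans xs (ltW ssh))// subrr mul0r subrr expr0n mulr0.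
  by rewrite mulr_ge0// ltW.
have [shx|xsh] := leP (s + h) x.
  rewrite divff ?gt_eqF// subrr expr0n mulr0.
  by rewrite mulr_ge0// ltW.
rewrite indicE mem_setE/= in_itv/= (ltW sx) (ltW xsh)/= mulr1.
rewrite -[leRHS]mulr1; apply: ler_pM; rewrite ?sqr_ge0//.
  by apply: psi_sqr_le => //; exact: ltW.
have y0 : 0 <= (al x - al s) / D by rewrite divr_ge0 ?(ltW D0)// subr_ge0 ltW// al_incr.
have y1 : (al x - al s) / D <= 1.
  by rewrite ler_pdivrMr// mul1r lerD2r ltW// al_incr.
by rewrite expr_le1//; lra.
Qed.

Let rayC s : CS (fun x => \1_(`]s, +oo[%classic) x * psi x).
Proof.
have [s0|s0] := leP 0 s.
  have [rs|sr] := leP r s; last exact: ray_inside.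
  rewrite (_ : (fun x => _) = fun=> 0).
    by apply: (closed_span0 SL2 (ray_inside (lexx 0) r0)).
  apply/funext => x; rewrite indicE /psi patchE !mem_setE/= !in_itv/= andbT.
  case: ltP => sx; rewrite ?mul0r// mul1r; case: ifPn => // /andP[_ xr].
  by have := lt_le_trans sx (le_trans xr rs); rewrite ltxx.
have [C C0 pC] := sturm_bounded.
apply: (closed_span_lim SL2); first exact: rayL2.
move=> e e0; exists (fun x => \1_(`]0, +oo[%classic) x * psi x); first exact: ray_inside.
apply: (@le_lt_trans _ _ (C * (0 - 0))); last by rewrite subrr mulr0.
apply: nrm2_indic_le => //; [by apply: L2B; exact: rayL2|exact: ltW|].
move=> x; rewrite -mulrBl exprMn !indicE !mem_setE/= !in_itv/= !andbT -eq_le.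
have [x0|x0|x0] := ltgtP x 0.
- have -> : psi x = 0 by rewrite /psi patchE mem_setE/= in_itv/= leNgt x0.
  by rewrite expr0n !mulr0 ?mulr_ge0// ltW.
- rewrite (lt_trans s0 x0) subrr expr0n mul0r.
  by rewrite mulr_ge0// ltW.
rewrite x0 s0 subr0 expr1n mul1r mulr1.
by apply: psi_sqr_le => //; exact: ltW.
Qed.

Let psiC : CS psi.
Proof.
have := rayC (-1); rewrite (_ : (fun x => _) = psi)//.
apply/funext => x; rewrite indicE /psi patchE !mem_setE/= !in_itv/= andbT.
case: ifPn => [/andP[x0 _]|_]; last by rewrite mulr0.
by rewrite (lt_le_trans _ x0) ?mul1r// oppr_lt0.
Qed.

Lemma eigen_basis : orthonormal_basis r phi.
Proof.
split; first by move=> n; exact: restrict_L2.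
  exact: eigenfun_orthonormal.
move=> f fL.
have mf := L2_measurable fL.
have csq : cnn (fun t => Num.sqrt (p t)).
  by apply: cnn_comp => //; exact: sqrt_continuous.
pose g : TR -> R := fun x => f x * ((fun t => Num.sqrt (p t)) \_ J : TR -> R) x.
have fE : (f \_ J : TR -> R) = fun x => g x * psi x.
  apply/funext => x; rewrite /g /psi !patchE; case: ifPn => xJ; last by rewrite mulr0.
  rewrite mulfK// gt_eqF// sqrtr_gt0 p0//.
  by move: xJ; rewrite mem_setE/= in_itv/= => /andP[].
have fJ : (f \_ J : TR -> R) \in Lfun leb 2%:E.
  apply: (L2_dom _ (L2_sqr fL)).
    by apply/(measurable_restrictT _ _).1 => //; exact: measurable_funTS.
  by move=> x; rewrite restrict_sqr patchE; case: ifP => // _; exact: sqr_ge0.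
rewrite [X in closed_span _ _ X]fE; apply: (closed_span_weight SL2) => //.
  by apply: measurable_funM => //; exact: restrict_measurable.
by rewrite -fE.
Qed.

End EigenBasis.

Section CosineMoments.
Variable R : realType.
Implicit Types (x y v z u phi : R) (f g : R -> R) (n m : nat).

Lemma exprB_le y m : 0 <= y <= 1 -> (1 - y) ^+ m * (1 + m%:R * y) <= 1.
Proof.
move=> /andP[y0 y1]; elim: m => [|m IH]; first by rewrite expr0 mul0r addr0 mulr1.
apply: le_trans IH; rewrite exprSr -mulrA ler_wpM2l//.
  by rewrite exprn_ge0// subr_ge0.
rewrite -subr_ge0 -natr1 (_ : _ - _ = m%:R * y ^+ 2 + y ^+ 2); last by ring.
by rewrite addr_ge0 ?mulr_ge0 ?sqr_ge0.
Qed.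

Lemma exprB_ge y m : 0 <= y <= 1 -> 1 - m%:R * y <= (1 - y) ^+ m.
Proof.
move=> /andP[y0 y1]; elim: m => [|m IH]; first by rewrite expr0 mul0r subr0.
rewrite exprSr; apply: (@le_trans _ _ ((1 - m%:R * y) * (1 - y))); last first.
  by rewrite ler_wpM2r// subr_ge0.
rewrite -subr_ge0 -natr1 (_ : _ - _ = m%:R * y ^+ 2); last by ring.
by rewrite mulr_ge0 ?sqr_ge0.
Qed.

Lemma cvg_nat_expr z : 0 <= z -> z < 1 -> n%:R * z ^+ n @[n --> \oo] --> (0 : R).
Proof.
move=> z0 z1; pose y := Num.sqrt z.
have y0 : 0 <= y by exact: sqrtr_ge0.
have y1 : y < 1 by rewrite -sqrtr1 ltr_sqrt.
have zE : z = y ^+ 2 by rewrite sqr_sqrtr.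
have y1' : 0 < 1 - y by rewrite subr_gt0.
have K n : n%:R * y ^+ n <= (1 - y)^-1.
  rewrite -[leRHS]div1r ler_pdivlMr//.
  have := @exprB_le (1 - y) n; rewrite subKr subr_ge0 (ltW y1) gerBl y0 => /(_ isT).
  move=> h; apply: le_trans h; rewrite [leRHS]mulrDr mulr1 [leLHS](_ : _ = y ^+ n * (n%:R * (1 - y))); last by ring.
  by rewrite lerDr exprn_ge0.
apply: (@squeeze_cvgr _ _ _ _ (fun=> 0) (fun n => (1 - y)^-1 * y ^+ n)).
- near=> n; apply/andP; split; first by rewrite mulr_ge0// exprn_ge0.
  by rewrite zE -exprM mul2n -addnn exprD mulrA ler_wpM2r ?exprn_ge0.
- exact: cvg_cst.
rewrite -[X in _ --> X](mulr0 (1 - y)^-1); apply: cvgM; first exact: cvg_cst.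
by apply: cvg_expr; rewrite ger0_norm.
Unshelve. all: end_near. Qed.

Lemma cvg_threshold v : 0 <= v <= 1 ->
  (1 - v ^+ n) ^+ (n * 2 ^ n) @[n --> \oo] --> ((v < 1 / 2)%R%:R : R).
Proof.
move=> /andP[v0 v1].
have vn n : 0 <= v ^+ n <= 1 by rewrite exprn_ge0// exprn_ile1.
have u0 n : 0 <= (1 - v ^+ n) ^+ (n * 2 ^ n).
  by rewrite exprn_ge0// subr_ge0; have /andP[] := vn n.
case: ltP => vh /=; last first.
  apply: (@squeeze_cvgr _ _ _ _ (fun=> 0) (fun n => n.+1%:R^-1)).
  - near=> n; rewrite u0/= -[leRHS]div1r ler_pdivlMr//.
    apply: le_trans (exprB_le (n * 2 ^ n) (vn n)).
    rewrite ler_wpM2l// -natr1 addrC lerD2l natrM -mulrA ler_peMr// natrX -exprMn.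
    by rewrite exprn_ege1//; lra.
  - exact: cvg_cst.
  - exact: cvg_harmonic.
apply: (@squeeze_cvgr _ _ _ _ (fun n => 1 - n%:R * (2 * v) ^+ n) (fun=> 1)).
- near=> n; apply/andP; split.
    apply: le_trans (exprB_ge (n * 2 ^ n) (vn n)).
    by rewrite natrM natrX exprMn mulrA.
  by apply: exprn_ile1; rewrite ?subr_ge0 ?gerBl; have /andP[] := vn n.
- rewrite -[X in _ --> X](subr0 1); apply: cvgB; first exact: cvg_cst.
  by apply: cvg_nat_expr; [rewrite mulr_ge0|lra].
- exact: cvg_cst.
Unshelve. all: end_near. Qed.

Definition bdd_meas f := measurable_fun setT f /\ exists M, forall x, `|f x| <= M.

Lemma bdd_meas_cst (c : R) : bdd_meas (fun=> c).
Proof. by split=> //; exists `|c|. Qed.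

Lemma bdd_measD f g : bdd_meas f -> bdd_meas g -> bdd_meas (fun x => f x + g x).
Proof.
move=> [mf [M fM]] [mg [N gN]]; split; first exact: measurable_funD.
by exists (M + N) => x; rewrite (le_trans (ler_normD _ _))// lerD.
Qed.

Lemma bdd_measM f g : bdd_meas f -> bdd_meas g -> bdd_meas (fun x => f x * g x).
Proof.
move=> [mf [M fM]] [mg [N gN]]; split; first exact: measurable_funM.
by exists (M * N) => x; rewrite normrM ler_pM.
Qed.

Lemma bdd_meas_cos u phi : bdd_meas (fun x => cos (u * x + phi)).
Proof.
split; last by exists 1 => x; exact: cos_max.
apply: continuous_measurable_fun => x; apply: continuous_comp; last exact: continuous_cos.
by apply: cvgD; [apply: cvgM; [exact: cvg_cst|exact: cvg_id]|exact: cvg_cst].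
Qed.

Variable L : (R -> R) -> R.
Hypothesis L_lin : forall c f g, bdd_meas f -> bdd_meas g ->
  L (fun x => c * f x + g x) = c * L f + L g.
Hypothesis L_lim : forall (F : nat -> R -> R) f (M : R), (forall n, measurable_fun setT (F n)) ->
  (forall n x, `|F n x| <= M) -> (forall x, F n x @[n --> \oo] --> f x) ->
  (forall n, L (F n) = 0) -> L f = 0.
Hypothesis L_cos : forall u phi, L (fun x => cos (u * x + phi)) = 0.

Definition cos_null f := bdd_meas f /\ forall u phi, L (fun x => f x * cos (u * x + phi)) = 0.

Lemma cos_null1 : cos_null (fun=> 1).
Proof.
split; first exact: bdd_meas_cst.
by move=> u phi; under eq_fun do rewrite mul1r; exact: L_cos.
Qed.

Lemma cos_null_lin c f g : cos_null f -> cos_null g -> cos_null (fun x => c * f x + g x).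
Proof.
move=> [bf f0] [bg g0]; split; first by apply: bdd_measD => //; apply: bdd_measM => //; exact: bdd_meas_cst.
move=> u phi; have bc := bdd_meas_cos u phi.
rewrite (_ : (fun x => _) = fun x => c * (f x * cos (u * x + phi)) + g x * cos (u * x + phi)).
  by rewrite L_lin ?f0 ?g0 ?mulr0 ?addr0//; exact: bdd_measM.
by apply/funext => x; ring.
Qed.

Lemma cos_nullM v psi f : cos_null f -> cos_null (fun x => f x * cos (v * x + psi)).
Proof.
move=> [bf f0]; have bv := bdd_meas_cos v psi; split; first exact: bdd_measM.
move=> u phi.
rewrite (_ : (fun x => _) = fun x => 2^-1 * (f x * cos ((u + v) * x + (phi + psi))) +
   (2^-1 * (f x * cos ((u - v) * x + (phi - psi))) + 0)).
  have b1 := bdd_measM bf (bdd_meas_cos (u + v) (phi + psi)).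
  have b2 := bdd_measM bf (bdd_meas_cos (u - v) (phi - psi)).
  have b0 := bdd_meas_cst 0.
  have L0 : L (fun=> 0) = 0.
    have := L_lin (-1) b0 b0; rewrite (_ : (fun x => _) = fun=> 0); first by lra.
    by apply/funext => x; ring.
  rewrite L_lin//; last by apply: bdd_measD => //; apply: bdd_measM => //; exact: bdd_meas_cst.
  by rewrite L_lin// !f0 L0 !mulr0 !addr0.
apply/funext => x.
have -> : (u + v) * x + (phi + psi) = (u * x + phi) + (v * x + psi) by ring.
have -> : (u - v) * x + (phi - psi) = (u * x + phi) - (v * x + psi) by ring.
set y := u * x + phi; set z := v * x + psi.
by rewrite (cosD y z) (cosB y z); field.
Qed.

Lemma cos_null_lim (F : nat -> R -> R) f (M : R) : (forall n, cos_null (F n)) ->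
  (forall n x, `|F n x| <= M) -> (forall x, F n x @[n --> \oo] --> f x) -> cos_null f.
Proof.
move=> F0 FM Ff; have mF n : measurable_fun setT (F n) by have [[]] := F0 n.
have fM x : `|f x| <= M.
  by apply: (cvgr_to_le (cvg_norm (Ff x))); exact: nearW.
split.
  by split; [exact: (measurable_fun_cvg mF (fun x _ => Ff x))|exists M].
move=> u phi; have [mc _] := bdd_meas_cos u phi.
apply: (@L_lim (fun n x => F n x * cos (u * x + phi)) _ M).
- by move=> n; exact: measurable_funM.
- by move=> n x; rewrite normrM -[leRHS]mulr1 ler_pM// cos_max.
- by move=> x; apply: cvgM => //; exact: cvg_cst.
- by move=> n; have [_] := F0 n; apply.
Qed.

Let vv (e x0 x : R) := (1 + cos (e * x + (- (e * x0) - pi / 2))) / 2.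

Let vvE e x0 x : vv e x0 x = (1 + sin (e * (x - x0))) / 2.
Proof.
rewrite /vv; congr ((1 + _) / _).
rewrite (_ : e * x + _ = e * (x - x0) - pi / 2); last by ring.
by rewrite cosBpihalf.
Qed.

Let vv01 e x0 x : 0 <= vv e x0 x <= 1.
Proof. by rewrite vvE; have := sin_geN1 (e * (x - x0)); have := sin_le1 (e * (x - x0)); lra. Qed.

Let vv_null e x0 f : cos_null f -> cos_null (fun x => vv e x0 x * f x).
Proof.
move=> f0; have h := cos_nullM e (- (e * x0) - pi / 2) f0.
have f2 : cos_null (fun x => 2^-1 * f x + 0 * f x).
  rewrite (_ : (fun x => _) = fun x => (-2^-1) * f x + f x); first exact: cos_null_lin.
  by apply/funext => x; field.
rewrite (_ : (fun x => _) = fun x => 2^-1 * (f x * cos (e * x + (- (e * x0) - pi / 2))) +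
   (2^-1 * f x + 0 * f x)); first exact: cos_null_lin.
by apply/funext => x; rewrite /vv; field.
Qed.

Let vvX_null e x0 n f : cos_null f -> cos_null (fun x => vv e x0 x ^+ n * f x).
Proof.
move=> f0; elim: n => [|n IH]; first by under eq_fun do rewrite expr0 mul1r.
by under eq_fun do rewrite exprS -mulrA; exact: vv_null.
Qed.

Let thr_null e x0 n m : cos_null (fun x => (1 - vv e x0 x ^+ n) ^+ m).
Proof.
elim: m => [|m IH]; first by under eq_fun do rewrite expr0; exact: cos_null1.
rewrite (_ : (fun x => _) = fun x => -1 * (vv e x0 x ^+ n * (1 - vv e x0 x ^+ n) ^+ m) +
  (1 - vv e x0 x ^+ n) ^+ m).
  by apply: cos_null_lin => //; exact: vvX_null.
by apply/funext => x; rewrite exprS; ring.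
Qed.

Lemma cos_null_half e x0 : cos_null (fun x => (sin (e * (x - x0)) < 0)%R%:R).
Proof.
rewrite (_ : (fun x => _) = fun x => (vv e x0 x < 1 / 2)%R%:R); last first.
  by apply/funext => x; rewrite vvE; congr (nat_of_bool _)%:R; apply/idP/idP; lra.
apply: (@cos_null_lim (fun n x => (1 - vv e x0 x ^+ n) ^+ (n * 2 ^ n)) _ 1).
- by move=> n; exact: thr_null.
- move=> n x; have /andP[h0 h1] := vv01 e x0 x.
  have w0 : 0 <= 1 - vv e x0 x ^+ n by rewrite subr_ge0 exprn_ile1.
  by rewrite ger0_norm ?exprn_ge0// exprn_ile1// gerBl exprn_ge0.
- by move=> x; exact: cvg_threshold.
Qed.

Lemma cos_null_ray x0 : cos_null (\1_(`]-oo, x0[%classic) : R -> R).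
Proof.
apply: (@cos_null_lim (fun n x => (sin (n.+1%:R^-1 * (x - x0)) < 0)%R%:R) _ 1).
- by move=> n; exact: cos_null_half.
- by move=> n x; case: (_ < _)%R; rewrite ?normr1 ?normr0.
move=> x; apply: cvg_near_cst.
have pi0 := pi_gt0 R.
exists (Num.bound (`|x - x0| / pi)) => // n /= hn.
have small : `|n.+1%:R^-1 * (x - x0)| < pi.
  rewrite normrM ger0_norm ?invr_ge0// mulrC ltr_pdivrMr// mulrC -ltr_pdivrMr//.
  have h := @archi_boundP R (`|x - x0| / pi) (divr_ge0 (normr_ge0 _) (ltW pi0)).
  by apply: (lt_trans h); rewrite ltr_nat ltnS.
rewrite indicE mem_setE/= in_itv/=.
have [xx|xx|->] := ltgtP x x0; last by rewrite subrr mulr0 sin0 ltxx.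
- have z0 : n.+1%:R^-1 * (x - x0) < 0 by rewrite pmulr_rlt0 ?invr_gt0// subr_lt0.
  rewrite -oppr_gt0 -sinN sin_gt0_pi// oppr_gt0 z0/=.
  by move: small; rewrite ltr0_norm.
have z0 : 0 < n.+1%:R^-1 * (x - x0) by rewrite pmulr_rgt0 ?invr_gt0// subr_gt0.
rewrite ltNge ltW// sin_gt0_pi// z0/=.
by move: small; rewrite gtr0_norm.
Qed.

Lemma cos_moments_indic (U : set (measurableTypeR R)) : measurable U ->
  L (\1_U : R -> R) = 0.
Proof.
have b1 (A : set (measurableTypeR R)) : measurable A -> bdd_meas (\1_A : R -> R).
  move=> mA; split; first exact: measurable_indic.
  by exists 1 => x; rewrite indicE; case: (_ \in _); rewrite ?normr1 ?normr0.
move=> mU.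
have H := @dynkin_induction _ (measurableTypeR R) (@RGenInftyO.G R)
  (fun U => L (\1_U : R -> R) = 0) (@RGenInftyO.measurableE R).
have sU : (@RGenInftyO.G R).-sigma.-measurable U by rewrite -RGenInftyO.measurableE.
apply: (H _ _ _ _ _ U sU) => {U mU sU H}.
- move=> A B [x ->] [y ->]; exists (Num.min x y).
  by apply/seteqP; split=> z; rewrite /= !in_itv/= lt_min => /andP.
- have := L_cos 0 0; congr (_ = _); congr L; apply/funext => x.
  by rewrite mul0r addr0 cos0 indicT.
- move=> A [x ->]; have [_ /(_ 0 0)] := cos_null_ray x.
  by under eq_fun do rewrite mul0r addr0 cos0 mulr1.
- move=> A mA LA; have := L_lin (-1) (b1 _ mA) (bdd_meas_cst 1).
  have L1 : L (fun=> 1) = 0.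
    by have := L_cos 0 0; under eq_fun do rewrite mul0r addr0 cos0.
  rewrite LA L1 mulr0 addr0 => <-; congr L; apply/funext => x.
  by rewrite !indicE in_setC; case: (x \in A) => /=; ring.
move=> F mF tF LF.
have Lsum n : bdd_meas (fun x => \sum_(i < n) (\1_(F i) x : R)) /\ L (fun x => \sum_(i < n) \1_(F i) x) = 0.
  elim: n => [|n [IH1 IH2]].
    rewrite (_ : (fun x => _) = fun=> 0); last by apply/funext => x; rewrite big_ord0.
    split; first exact: bdd_meas_cst.
    have := L_lin (-1) (bdd_meas_cst 0) (bdd_meas_cst 0).
    rewrite (_ : (fun x => _) = fun=> 0); first by lra.
    by apply/funext => x; ring.
  rewrite (_ : (fun x => _) = fun x => 1 * \1_(F n) x + \sum_(i < n) \1_(F i) x); last first.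
    by apply/funext => x; rewrite big_ord_recr/= mul1r addrC.
  split; last by rewrite L_lin ?LF ?IH2 ?mulr0 ?addr0//; exact: b1.
  exact: (bdd_measD (bdd_measM (bdd_meas_cst 1) (b1 _ (mF n))) IH1).
have sumE n x : \sum_(i < n) (\1_(F i) x : R) = \1_(\bigcup_(i < n) F i) x.
  have [[k /= kn Fk]|nF] := pselect ((\bigcup_(i < n) F i) x).
    rewrite [RHS]indicE mem_set; last by exists k.
    rewrite (bigD1 (Ordinal kn))//= indicE mem_set// big1 ?addr0// => i ik.
    rewrite indicE memNset// => Fi; move/eqP : ik; apply; apply: val_inj => /=.
    by apply: (tF i k) => //; exists x.
  rewrite [RHS]indicE memNset// big1// => i _; rewrite indicE memNset// => Fi; apply: nF.
  by exists i => /=.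
apply: (@L_lim (fun n x => \sum_(i < n) \1_(F i) x) _ 1).
- by move=> n; have [[]] := Lsum n.
- by move=> n x; rewrite sumE indicE; case: (_ \in _); rewrite ?normr1 ?normr0.
- move=> x; apply: cvg_near_cst.
  have [[k _ Fk]|nF] := pselect ((\bigcup_k F k) x); last first.
    apply: nearW => n; rewrite sumE !indicE !memNset//.
    by move=> [k _ Fk]; apply: nF; exists k.
  exists k.+1 => // n /= kn; rewrite sumE !indicE !mem_set//; first by exists k.
  by exists k.
- by move=> n; have [] := Lsum n.
Qed.

End CosineMoments.

Section UnderIntegral.
Context d (T : measurableType d) (R : realType).
Variable mu : {measure set T -> \bar R}.

Lemma drv_under_integral (f df : R -> T -> R) (G : T -> R) :
  (forall (u : R) w, is_derive u 1 (f ^~ w) (df u w)) ->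
  (forall u, mu.-integrable setT (EFin \o f u)) ->
  mu.-integrable setT (EFin \o G) -> (forall u w, `|df u w| <= G w) ->
  forall u : R, is_derive u 1 (fun u => \int[mu]_w f u w) (\int[mu]_w df u w).
Proof.
move=> fE fi Gi dfG u.
have Iu : `]u - 1, u + 1[%classic u by rewrite /= in_itv/=; apply/andP; split; lra.
have pE x w : partial1of2 f x w = df x w.
  by rewrite /partial1of2 derive1E; have fx := fE x w; rewrite derive_val.
have G0 w : 0 <= G w by apply: le_trans (dfG 0 w).
have hf x : `]u - 1, u + 1[%classic x -> mu.-integrable setT (EFin \o f x) by move=> _; exact: fi.
have hd x w : `]u - 1, u + 1[%classic x -> setT w -> derivable (f ^~ w) x 1.
  by move=> _ _; have [] := fE x w.
have hG x w : `]u - 1, u + 1[%classic x -> setT w -> `|partial1of2 f x w| <= G w.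
  by move=> _ _; rewrite pE.
have d1 := derivable_under_integral measurableT Iu hf hd G0 Gi hG.
have d2 := differentiation_under_integral measurableT Iu hf hd G0 Gi hG.
have -> : \int[mu]_w df u w = derive1 (fun x => \int[mu]_w f x w) u.
  by rewrite d2; apply: eq_Rintegral => w _; rewrite pE.
by rewrite derive1E; exact/derivableP.
Qed.

Lemma integrable_bdd_mul (f g : T -> R) (M : R) : mu.-integrable setT (EFin \o g) ->
  measurable_fun setT f -> (forall x, `|f x| <= M) ->
  mu.-integrable setT (EFin \o (fun x => f x * g x)).
Proof.
move=> gi mf fM; have mg : measurable_fun setT g by apply/measurable_EFinP; case/integrableP: gi.
apply: (le_integrable measurableT _ _ (integrable_scale M gi)).
  by apply/measurable_EFinP; exact: measurable_funM.
move=> x _ /=; rewrite lee_fin !normrM ler_wpM2r//.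
by apply: le_trans (fM x) _; rewrite ler_norm.
Qed.

End UnderIntegral.

Section NormalLaw.
Variable R : realType.
Local Notation TR := (measurableTypeR R).
Local Notation leb := (@lebesgue_measure R).
Implicit Types (m s u th x : R).

Lemma normal_probE m s (f : TR -> R) : bdd_meas f ->
  \int[normal_prob m s]_x f x = \int[leb]_x (f x * normal_pdf m s x).
Proof.
move=> [mf [M fM]]; rewrite /Rintegral; congr fine.
have fi : (normal_prob m s).-integrable setT (EFin \o f).
  apply: (le_integrable measurableT _ _ (finite_measure_integrable_cst (normal_prob m s) M measurableT)).
    exact/measurable_EFinP.
  by move=> x _ /=; rewrite lee_fin (le_trans (fM x))// ler_norm.
have dom := @normal_prob_dominates R m s.
rewrite -(Radon_Nikodym_change_of_variables dom measurableT fi).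
have mpdf : measurable_fun setT (EFin \o normal_pdf m s : TR -> \bar R).
  by apply/measurable_EFinP; exact: measurable_normal_pdf.
have RNi := @Radon_Nikodym_integrable _ TR R (charge_of_finite_measure (normal_prob m s)) leb dom.
have mRN : measurable_fun setT (Radon_Nikodym (charge_of_finite_measure (normal_prob m s)) leb).
  by case/integrableP: RNi.
apply: ae_eq_integral => //.
- by apply: emeasurable_funM => //; exact/measurable_EFinP.
- by apply/measurable_EFinP; apply: measurable_funM => //; exact: measurable_normal_pdf.
have : ae_eq leb setT (Radon_Nikodym (charge_of_finite_measure (normal_prob m s)) leb) (EFin \o normal_pdf m s).
  apply: integral_ae_eq => // E _ mE.
  by rewrite -Radon_Nikodym_integral.
apply: filterS => x /= h _; rewrite h//= EFinM.
Qed.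

Lemma integral_drv0 (m : R) (F dF : R -> R) : (forall x : R, is_derive x 1 F (dF x)) ->
  continuous dF -> leb.-integrable setT (EFin \o (dF : TR -> R)) ->
  F (m + n%:R) @[n --> \oo] --> 0 -> F (m - n%:R) @[n --> \oo] --> 0 ->
  \int[leb]_x dF x = 0.
Proof.
move=> dFE cdF idF Fp Fm.
have cF : continuous F by move=> x; exact: drv_continuous (dFE x).
pose I (n : nat) : set TR := `[m - n%:R, m + n%:R]%classic.
have mI n : measurable (I n) by rewrite /I; exact: measurable_itv.
have mdF : measurable_fun setT (dF : TR -> R) by apply/measurable_EFinP; case/integrableP: idF.
have H : (\int[leb]_x (EFin \o (dF \_ (I n) : TR -> R)) x)%E @[n --> \oo] --> (\int[leb]_x (EFin \o (dF : TR -> R)) x)%E.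
  apply: (@dominated_cvg _ _ _ leb setT _ _ _ (fun x => `|(dF x)%:E|)%E) => //.
  - move=> n; apply/measurable_EFinP; apply/(measurable_restrictT _ _).1; first exact: mI.
    exact: measurable_funTS.
  - move=> x _; apply: cvg_near_cst.
    exists (Num.bound `|x - m|) => // n /= hn; rewrite patchE mem_setE/= in_itv/= ifT//.
    have h := @archi_boundP R `|x - m| (normr_ge0 _).
    have : `|x - m| <= n%:R by apply: (le_trans (ltW h)); rewrite ler_nat.
    by rewrite ler_norml => /andP[]; lra.
  - by apply: integrable_abse.
  - move=> n x _ /=; rewrite lee_fin patchE; case: ifP => // _.
    by rewrite normr0.
have E n : (\int[leb]_x (EFin \o (dF \_ (I n.+1) : TR -> R)) x = (F (m + n.+1%:R) - F (m - n.+1%:R))%:E)%E.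
  under eq_integral do rewrite -restrict_EFin.
  rewrite -integral_mkcond EFinB; apply: continuous_FTC2.
  - by have : (0 : R) < n.+1%:R by []; lra.
  - exact: continuous_subspaceT.
  - split.
    + by move=> x _; have [] := dFE x.
    + by apply: cvg_at_right_filter; exact: cF.
    + by apply: cvg_at_left_filter; exact: cF.
  - by move=> x _; rewrite derive1E; have h := dFE x; rewrite derive_val.
have E0 : (\int[leb]_x (EFin \o (dF : TR -> R)) x)%E = 0%E.
  move: H Fp Fm; rewrite -cvg_shiftS -(cvg_shiftS (fun n => F (m + n%:R))) -(cvg_shiftS (fun n => F (m - n%:R))).
  rewrite /= => H Fp Fm; apply: (cvg_unique _ H) => //.
  apply: (@cvg_trans _ (((F (m + n.+1%:R) - F (m - n.+1%:R))%:E) @[n --> \oo])).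
    by apply: near_eq_cvg; near=> n; rewrite E.
  apply: cvg_EFin; first by near=> n.
  by rewrite -[X in _ --> X](subr0 0); apply: cvgB.
by rewrite /Rintegral E0.
Unshelve. all: end_near. Qed.

End NormalLaw.

Section NormalCosine.
Variable R : realType.
Local Notation TR := (measurableTypeR R).
Local Notation leb := (@lebesgue_measure R).
Variables (m s : R).
Hypothesis s0 : s != 0.
Implicit Types (u th x y : R).

Let s2 : 0 < s ^+ 2. Proof. by rewrite exprn_even_gt0. Qed.

Let pdf : TR -> R := normal_pdf m s.
Let c := s ^+ 2 *+ 2.
Let c0 : 0 < c. Proof. by rewrite /c pmulrn_lgt0. Qed.

Let pdfE x : pdf x = normal_peak s * expR (- (x - m) ^+ 2 / c).
Proof. by rewrite /pdf normal_pdfE. Qed.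

Let ipdf : leb.-integrable setT (EFin \o pdf).
Proof. exact: integrable_normal_pdf. Qed.

Let mpdf : measurable_fun setT pdf. Proof. exact: measurable_normal_pdf. Qed.

Let pdf0 x : 0 <= pdf x. Proof. exact: normal_pdf_ge0. Qed.

Let cpdf : continuous (pdf : R -> R). Proof. exact: continuous_normal_pdf. Qed.

Let dpdf x : is_derive x 1 (pdf : R -> R) (- ((x - m) / s ^+ 2) * pdf x).
Proof.
have -> : (pdf : R -> R) = fun x => normal_peak s * expR (- ((x - m) ^+ 2 * c^-1)).
  by apply/funext => y; rewrite pdfE mulNr.
have d1 := drvX2 (drvB (drv_id x) (drv_cst m x)).
apply: (drvE (drvZ (normal_peak s) (drv_exp (drvN (drvM d1 (drv_cst c^-1 x)))))).
by rewrite /c; field; rewrite ?s0 ?gt_eqF.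
Qed.

(* [|y| exp (- 2 z) <= (1 + 4 s^2) exp (- z)] for [z = y^2 / (4 s^2)] *)
Let first_moment : leb.-integrable setT (EFin \o (fun x => `|x - m| * pdf x)).
Proof.
pose s' := Num.sqrt 2 * s.
have s'0 : s' != 0 by rewrite mulf_neq0// gt_eqF// sqrtr_gt0.
have s'2 : s' ^+ 2 = 2 * s ^+ 2 by rewrite exprMn sqr_sqrtr.
pose K := (1 + 4 * s ^+ 2) * normal_peak s / normal_peak s'.
have pk : 0 < normal_peak s := normal_peak_gt0 s0.
have pk' : 0 < normal_peak s' := normal_peak_gt0 s'0.
apply: (le_integrable measurableT _ _ (integrable_scale K (integrable_normal_pdf m s'))).
  apply/measurable_EFinP; apply: measurable_funM => //.
  by apply: measurableT_comp => //; exact: measurable_funB.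
move=> x _ /=; rewrite lee_fin ger0_norm ?mulr_ge0//.
rewrite [leRHS]ger0_norm; last by rewrite mulr_ge0 ?normal_pdf_ge0// divr_ge0 ?(ltW pk')// mulr_ge0 ?(ltW pk)// addr_ge0// mulr_ge0// ltW.
rewrite pdfE (normal_pdfE m s'0) /normal_fun s'2 /K.
set y := x - m; pose z := y ^+ 2 / (4 * s ^+ 2).
have z0 : 0 <= z by rewrite divr_ge0 ?sqr_ge0// mulr_ge0// ltW.
have -> : - y ^+ 2 / c = - z - z by rewrite /c /z; field; rewrite ?s0 ?gt_eqF.
have -> : - y ^+ 2 / (2 * s ^+ 2 *+ 2) = - z by rewrite /z; field; rewrite ?s0 ?gt_eqF.
rewrite expRD [leRHS](_ : _ = normal_peak s * ((1 + 4 * s ^+ 2) * expR (- z))); last first.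
  by field; rewrite ?s0 ?gt_eqF.
rewrite mulrCA ler_wpM2l ?(ltW pk)// mulrA ler_wpM2r ?expR_ge0//.
rewrite expRN ler_pdivrMr ?expR_gt0//.
have ez := expR_ge1Dx z.
have yE : y ^+ 2 = 4 * s ^+ 2 * z by rewrite /z; field; rewrite ?s0 ?gt_eqF.
apply: (@le_trans _ _ (1 + y ^+ 2)).
  rewrite -[y ^+ 2]real_normK ?num_real//; set t := `|y|.
  by have := sqr_ge0 (t - 2^-1); rewrite sqrrB; lra.
apply: (@le_trans _ _ ((1 + 4 * s ^+ 2) * (1 + z))).
  rewrite yE -subr_ge0 (_ : _ - _ = z + 4 * s ^+ 2); last by ring.
  by rewrite addr_ge0// mulr_ge0// ltW.
by rewrite ler_wpM2l// addr_ge0// mulr_ge0// ltW.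
Qed.

Let mtrig (h : R -> R) u th : continuous h -> measurable_fun setT (fun x : TR => h (u * (x - m) + th)).
Proof.
move=> ch; apply: continuous_measurable_fun => x.
apply: continuous_comp; last exact: ch.
apply: cvgD; last exact: cvg_cst; apply: cvgM; first exact: cvg_cst.
by apply: cvgB; [exact: cvg_id|exact: cvg_cst].
Qed.

Let icos u th : leb.-integrable setT (EFin \o (fun x => cos (u * (x - m) + th) * pdf x)).
Proof.
apply: (integrable_bdd_mul ipdf (M := 1)).
  by apply: mtrig; exact: continuous_cos.
by move=> x; exact: cos_max.
Qed.

Let isin u th : leb.-integrable setT (EFin \o (fun x => sin (u * (x - m) + th) * ((x - m) * pdf x))).
Proof.
apply: (@integrable_bdd_mul _ _ _ leb _ _ 1).
- apply: (le_integrable measurableT _ _ first_moment).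
    by apply/measurable_EFinP; apply: measurable_funM => //; exact: measurable_funB.
  by move=> x _ /=; rewrite !normrM normr_id.
- by apply: mtrig; exact: continuous_sin.
- by move=> x; exact: sin_max.
Qed.

Let ibp u th : \int[leb]_x (sin (u * (x - m) + th) * ((x - m) * pdf x)) =
  s ^+ 2 * u * \int[leb]_x (cos (u * (x - m) + th) * pdf x).
Proof.
pose F x := sin (u * (x - m) + th) * pdf x.
pose dF x := u * (cos (u * (x - m) + th) * pdf x) + (- (s ^+ 2)^-1) * (sin (u * (x - m) + th) * ((x - m) * pdf x)).
have i1 := integrable_scale u (icos u th).
have i2 := integrable_scale (- (s ^+ 2)^-1) (isin u th).
have aff x : is_derive x 1 (fun x => u * (x - m) + th) u.
  apply: (drvE (drvD (drvZ u (drvB (drv_id x) (drv_cst m x))) (drv_cst th x))).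
  by rewrite subr0 mulr1 addr0.
have dFE x : is_derive x 1 F (dF x).
  apply: (drvE (drvM (drv_sin (aff x)) (dpdf x))).
  by rewrite /dF; field; rewrite ?s0 ?gt_eqF.
have caff : continuous (fun x => u * (x - m) + th) by move=> x; exact: drv_continuous (aff x).
have cdF : continuous dF.
  move=> x; apply: cvgD; apply: cvgM; try exact: cvg_cst; apply: cvgM.
  - by apply: continuous_comp; [exact: caff|exact: continuous_cos].
  - exact: cpdf.
  - by apply: continuous_comp; [exact: caff|exact: continuous_sin].
  - by apply: cvgM; [apply: cvgB; [exact: cvg_id|exact: cvg_cst]|exact: cpdf].
have pk : 0 < normal_peak s := normal_peak_gt0 s0.
have decay (y : R) n : `|y| = n%:R -> `|F (m + y)| <= normal_peak s * (1 + c) * n.+1%:R^-1.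
  move=> yn; rewrite /F normrM -[leRHS]mul1r; apply: ler_pM => //; first exact: sin_max.
  rewrite ger0_norm// pdfE -mulrA ler_wpM2l ?(ltW pk)// addrAC subrr add0r.
  rewrite -[y ^+ 2]real_normK ?num_real// yn mulNr expRN.
  rewrite -[X in X <= _]mul1r ler_pdivrMr ?expR_gt0// mulrAC ler_pdivlMr// mul1r mulrC.
  apply: (@le_trans _ _ ((1 + n%:R ^+ 2 / c) * (1 + c))); last first.
    by rewrite ler_wpM2r ?expR_ge1Dx// addr_ge0// ltW.
  rewrite mulrDl mul1r mulrDr mulr1 divfK ?gt_eqF// -natr1.
  have n2 : (n%:R : R) <= n%:R ^+ 2.
    by rewrite -natrX ler_nat; case: n {yn} => // n; rewrite expnS expn1 leq_pmulr.
  have nc : 0 <= n%:R ^+ 2 / c by rewrite divr_ge0 ?sqr_ge0// ltW.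
  by move: c0; lra.
have lim0 (y : nat -> R) : (forall n, `|y n| = n%:R) -> F (m + y n) @[n --> \oo] --> 0.
  move=> yn; apply/norm_cvg0P.
  apply: (@squeeze_cvgr _ _ _ _ (fun=> 0) (fun n => normal_peak s * (1 + c) * n.+1%:R^-1)).
  - by near=> n; rewrite normr_ge0 decay.
  - exact: cvg_cst.
  - rewrite -[X in _ --> X](mulr0 (normal_peak s * (1 + c))); apply: cvgM; first exact: cvg_cst.
    exact: cvg_harmonic.
have z0 : \int[leb]_x dF x = 0.
  apply: (integral_drv0 (m := m) dFE cdF).
  - exact: integrable_add i1 i2.
  - by apply: lim0 => n; rewrite normr_nat.
  - by apply: lim0 => n; rewrite normrN normr_nat.
move: z0; rewrite /dF (RintegralD measurableT i1 i2).
rewrite (RintegralZl _ measurableT (icos u th)) (RintegralZl _ measurableT (isin u th)).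
set X := Rintegral _ _ _; set Y := Rintegral _ _ _.
move/(congr1 (fun z => s ^+ 2 * z)); rewrite mulr0 mulrDr mulNr mulrN mulVKf ?gt_eqF// => /eqP.
by rewrite subr_eq0 mulrA => /eqP ->.
Unshelve. all: end_near. Qed.

Lemma normal_cos u th : \int[leb]_x (cos (u * x + th) * pdf x) =
  expR (- (s ^+ 2 * u ^+ 2 / 2)) * cos (u * m + th).
Proof.
pose f (ph : R) (v : R) (x : TR) := cos (v * (x - m) + ph) * pdf x.
pose J ph v := \int[leb]_x f ph v x.
have dJ ph (v : R) : is_derive v 1 (J ph) (- (s ^+ 2 * v) * J ph v).
  have aff (x w : R) : is_derive w 1 (fun w => w * (x - m) + ph) (x - m).
    apply: (drvE (drvD (drvM (drv_id w) (drv_cst (x - m) w)) (drv_cst ph w))).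
    by rewrite mul1r mulr0 !addr0.
  have h1 (w : R) (x : TR) : is_derive w 1 (f ph ^~ x) (-1 * (sin (w * (x - m) + ph) * ((x - m) * pdf x))).
    apply: (drvE (drvM (drv_cos (aff x w)) (drv_cst (pdf x) w))).
    by ring.
  have h3 w (x : TR) : `|-1 * (sin (w * (x - m) + ph) * ((x - m) * pdf x))| <= `|x - m| * pdf x.
    rewrite !normrM normrN1 mul1r (ger0_norm (pdf0 x)).
    by rewrite -[leRHS]mul1r ler_wpM2r ?mulr_ge0// sin_max.
  have D := @drv_under_integral _ TR R leb _ _ _ h1 (fun w => icos w ph) first_moment h3 v.
  apply: (@drvE _ (J ph) _ _ _ D).
  by rewrite (RintegralZl _ measurableT (isin v ph)) ibp /J /f; ring.
have Jcst ph : J ph u * expR (s ^+ 2 * u ^+ 2 / 2) = J ph 0 * expR (s ^+ 2 * 0 ^+ 2 / 2).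
  apply: (@is_derive_0_is_cst _ (fun v => J ph v * expR (s ^+ 2 * v ^+ 2 / 2))) => v.
  have de : is_derive v 1 (fun v => s ^+ 2 * v ^+ 2 / 2) (s ^+ 2 * v).
    apply: (drvE (drvM (drvZ (s ^+ 2) (drvX2 (drv_id v))) (drv_cst 2^-1 v))).
    by field.
  by apply: (drvE (drvM (dJ ph v) (drv_exp de))); ring.
have J0 ph : J ph 0 = cos ph.
  transitivity (\int[leb]_x (cos ph * pdf x)).
    by apply: eq_Rintegral => x _; rewrite /f mul0r add0r.
  by rewrite (RintegralZl _ measurableT ipdf) /Rintegral integral_normal_pdf/= mulr1.
transitivity (J (u * m + th) u).
  by apply: eq_Rintegral => x _; rewrite /f; congr (cos _ * _); ring.
have := Jcst (u * m + th); rewrite J0 expr0n mulr0 mul0r expR0 mulr1 => <-.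
by rewrite expRN [RHS]mulrC mulfK// gt_eqF// expR_gt0.
Qed.

End NormalCosine.

Section CosineUniqueness.
Context d1 (T1 : measurableType d1) d2 (T2 : measurableType d2) (R : realType).
Variables (mu1 : {measure set T1 -> \bar R}) (mu2 : {measure set T2 -> \bar R}).
Variables (V1 : T1 -> R) (V2 : T2 -> R) (Y1 : T1 -> R) (Y2 : T2 -> R).
Hypotheses (iV1 : mu1.-integrable setT (EFin \o V1)) (iV2 : mu2.-integrable setT (EFin \o V2)).
Hypotheses (mY1 : measurable_fun setT Y1) (mY2 : measurable_fun setT Y2).

Lemma integrable_weight d (T : measurableType d) (mu : {measure set T -> \bar R})
    (V Y : T -> R) (f : R -> R) : mu.-integrable setT (EFin \o V) ->
  measurable_fun setT Y -> bdd_meas f -> mu.-integrable setT (EFin \o (fun w => V w * f (Y w))).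
Proof.
move=> iV mY [mf [M fM]].
have := @integrable_bdd_mul _ _ _ mu (f \o Y) V M iV (measurableT_comp mf mY) (fun w => fM (Y w)).
by congr (integrable _ _ (EFin \o _)); apply/funext => w; rewrite mulrC.
Qed.

Lemma weight_cvg d (T : measurableType d) (mu : {measure set T -> \bar R})
    (V Y : T -> R) (F : nat -> R -> R) (f : R -> R) (M : R) : mu.-integrable setT (EFin \o V) ->
  measurable_fun setT Y -> (forall n, measurable_fun setT (F n)) ->
  (forall n x, `|F n x| <= M) -> (forall x, F n x @[n --> \oo] --> f x) ->
  \int[mu]_w (V w * F n (Y w)) @[n --> \oo] --> \int[mu]_w (V w * f (Y w)).
Proof.
move=> iV mY mF FM Ff.
have mV : measurable_fun setT V by apply/measurable_EFinP; case/integrableP: iV.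
have fM x : `|f x| <= M by apply: (cvgr_to_le (cvg_norm (Ff x))); exact: nearW.
have bf : bdd_meas f by split; [exact: (measurable_fun_cvg mF (fun x _ => Ff x))|exists M].
have bF n : bdd_meas (F n) by split; [|exists M].
have Gi : mu.-integrable setT (fun w => `|(M * V w)%:E|)%E.
  by apply: integrable_abse; exact: integrable_scale.
have H : (\int[mu]_w (V w * F n (Y w))%R%:E)%E @[n --> \oo] -->
    (\int[mu]_w (V w * f (Y w))%R%:E)%E.
  apply: (dominated_cvg measurableT (f_ := fun n => EFin \o (fun w => V w * F n (Y w)))
    (g := fun w => `|(M * V w)%:E|%E)) => //.
  - by move=> n; apply/measurable_EFinP; apply: measurable_funM => //; exact: (measurableT_comp (mF n) mY).
  - move=> w _; apply: cvg_EFin; first by apply: nearW.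
    by apply: cvgM; [exact: cvg_cst|exact: Ff].
  - move=> n w _ /=; rewrite lee_fin !normrM mulrC ler_wpM2r//.
    by apply: le_trans (FM n _) _; exact: ler_norm.
have fin : (\int[mu]_w (V w * f (Y w))%R%:E)%E \is a fin_num.
  by apply: integrable_fin_num => //; exact: integrable_weight.
rewrite -(fineK fin) in H.
exact: fine_cvg H.
Qed.

Lemma cos_moments_eq :
  (forall u phi, \int[mu1]_w (V1 w * cos (u * Y1 w + phi)) = \int[mu2]_w (V2 w * cos (u * Y2 w + phi))) ->
  forall U : set (measurableTypeR R), measurable U ->
  \int[mu1]_w (V1 w * \1_U (Y1 w)) = \int[mu2]_w (V2 w * \1_U (Y2 w)).
Proof.
move=> H U mU.
pose L (f : R -> R) := \int[mu1]_w (V1 w * f (Y1 w)) - \int[mu2]_w (V2 w * f (Y2 w)).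
suff : L (\1_U) = 0 by move/eqP; rewrite subr_eq0 => /eqP.
have lin d (T : measurableType d) (mu : {measure set T -> \bar R}) (V Y : T -> R) c (f g : R -> R) :
    mu.-integrable setT (EFin \o V) -> measurable_fun setT Y -> bdd_meas f -> bdd_meas g ->
    \int[mu]_w (V w * (c * f (Y w) + g (Y w))) =
    c * \int[mu]_w (V w * f (Y w)) + \int[mu]_w (V w * g (Y w)).
  move=> iV mY bf bg; have i1 := integrable_weight iV mY bf; have i2 := integrable_weight iV mY bg.
  rewrite -(RintegralZl _ measurableT i1) -(RintegralD measurableT (integrable_scale c i1) i2).
  by apply: eq_Rintegral => w _; ring.
apply: (@cos_moments_indic R L) => //.
- by move=> c f g bf bg; rewrite /L !lin//; ring.
- move=> F f M mF FM Ff F0.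
  have c1 := weight_cvg iV1 mY1 mF FM Ff; have c2 := weight_cvg iV2 mY2 mF FM Ff.
  have : L (F n) @[n --> \oo] --> L f by exact: (cvgB c1 c2).
  under eq_cvg do rewrite F0; move=> h.
  by apply: (cvg_unique _ h) => //; exact: cvg_cst.
- by move=> u phi; rewrite /L H subrr.
Qed.

End CosineUniqueness.

Section GaussianLaws.
Context d (T : measurableType d) (R : realType) (P : probability T R).
Local Notation TR := (measurableTypeR R).
Local Notation L2 := (Lfun P 2%:E).
Implicit Types (Y Z : T -> R) (u phi m s : R).

Lemma integrable_cst_prob (c : R) : P.-integrable setT (EFin \o (fun=> c : R)).
Proof. exact: (finite_measure_integrable_cst P c measurableT). Qed.

Lemma Rintegral_cst_prob (c : R) : \int[P]_w c = c.
Proof. by rewrite Rintegral_cst//= probability_setT mulr1. Qed.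

Lemma law_integral Y (nu : {measure set TR -> \bar R}) (f : TR -> R) : measurable_fun setT Y ->
  (forall U : set TR, measurable U -> P (Y @^-1` U) = nu U) -> bdd_meas f ->
  \int[P]_w f (Y w) = \int[nu]_x f x.
Proof.
move=> mY PY bf; have [mf _] := bf; rewrite /Rintegral; congr fine.
have i1 : P.-integrable setT (EFin \o (fun w => f (Y w))).
  have := integrable_weight (integrable_cst_prob 1) mY bf.
  by under [in X in integrable _ _ X]eq_fun do rewrite mul1r.
have mY' : measurable_fun [set: T] (Y : T -> TR) by [].
have := @integral_pushforward _ _ T TR R Y mY' P setT (EFin \o f).
rewrite preimage_setT => <- //; last exact/measurable_EFinP.
by apply: eq_measure_integral => A mA _; exact: PY.
Qed.

Lemma gaussian_cos Y m s : measurable_fun setT Y -> has_gaussian_law P Y m s ->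
  forall u phi, \int[P]_w cos (u * Y w + phi) = expR (- (s ^+ 2 * u ^+ 2 / 2)) * cos (u * m + phi).
Proof.
move=> mY lY u phi; have bc := bdd_meas_cos u phi.
have [s0|s0] := eqVneq s 0; last first.
  rewrite -normal_cos// -(normal_probE m s bc).
  apply: (law_integral (nu := normal_prob m s)) => // U mU.
  by rewrite lY// /gaussian_law (negbTE s0).
rewrite s0 expr0n !mul0r oppr0 expR0 mul1r.
have -> := law_integral (nu := \d_(m : TR)) mY _ bc.
  rewrite /Rintegral integral_dirac//; last by apply/measurable_EFinP; have [] := bc.
  by rewrite diracT mul1e.
by move=> U mU; rewrite lY// /gaussian_law s0 eqxx.
Qed.

Lemma L2_integrable Y : Y \in L2 -> P.-integrable setT (EFin \o Y).
Proof.
move=> YL; apply: (le_integrable measurableT _ _ (integrable_add (integrable_cst_prob 1) (L2_sqr YL))).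
  by apply/measurable_EFinP; exact: L2_measurable YL.
move=> w _ /=; rewrite lee_fin [leRHS]ger0_norm ?addr_ge0 ?sqr_ge0//.
rewrite -[Y w ^+ 2]real_normK ?num_real//; set t := `|Y w|.
by have := sqr_ge0 (t - 2^-1); rewrite sqrrB; lra.
Qed.

Lemma gaussian_moments Y m s : Y \in L2 -> has_gaussian_law P Y m s ->
  \int[P]_w Y w = m /\ nrm2 P Y = s ^+ 2 + m ^+ 2.
Proof.
move=> YL lY; have mY := L2_measurable YL; have iY := L2_integrable YL; have iY2 := L2_sqr YL.
have char := gaussian_cos mY lY.
have aff w (u phi : R) : is_derive u 1 (fun u => u * Y w + phi) (Y w).
  apply: (drvE (drvD (drvM (drv_id u) (drv_cst (Y w) u)) (drv_cst phi u))).
  by rewrite mul1r mulr0 !addr0.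
have absY : P.-integrable setT (EFin \o (fun w => `|Y w|)) by exact: integrable_abse iY.
have maff u phi : measurable_fun setT (fun w => u * Y w + phi).
  by apply: measurable_funD => //; exact: measurable_funM.
have mcos u phi : measurable_fun setT (fun w => cos (u * Y w + phi)).
  by apply: (measurableT_comp _ (maff u phi)); apply: continuous_measurable_fun; exact: continuous_cos.
have msin u phi : measurable_fun setT (fun w => sin (u * Y w + phi)).
  by apply: (measurableT_comp _ (maff u phi)); apply: continuous_measurable_fun; exact: continuous_sin.
have icos u phi : P.-integrable setT (EFin \o (fun w => cos (u * Y w + phi))).
  have := integrable_bdd_mul (integrable_cst_prob 1) (mcos u phi) (fun w => cos_max _).
  by under [in X in integrable _ _ X]eq_fun do rewrite mulr1.
have isin u phi : P.-integrable setT (EFin \o (fun w => sin (u * Y w + phi) * Y w)).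
  exact: (integrable_bdd_mul iY (msin u phi) (fun w => sin_max _)).
have dchar phi (u : R) : is_derive u 1 (fun u => expR (- (s ^+ 2 * u ^+ 2 / 2)) * cos (u * m + phi))
    (- (expR (- (s ^+ 2 * u ^+ 2 / 2)) * (s ^+ 2 * u * cos (u * m + phi) + m * sin (u * m + phi)))).
  have d1 := drv_exp (drvN (drvM (drvZ (s ^+ 2) (drvX2 (drv_id u))) (drv_cst 2^-1 u))).
  have d2 := drv_cos (drvD (drvM (drv_id u) (drv_cst m u)) (drv_cst phi u)).
  by apply: (drvE (drvM d1 d2)); field.
have dc phi (u : R) : is_derive u 1 (fun u => \int[P]_w cos (u * Y w + phi))
    (\int[P]_w (-1 * (sin (u * Y w + phi) * Y w))).
  apply: (drv_under_integral (G := fun w => `|Y w|) (df := fun u w => -1 * (sin (u * Y w + phi) * Y w))) => //.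
  - by move=> v w; apply: (drvE (drv_cos (aff w v phi))); ring.
  - move=> v w; rewrite !normrM normrN1 mul1r -[leRHS]mul1r ler_wpM2r//.
    exact: sin_max.
have first phi u : \int[P]_w (sin (u * Y w + phi) * Y w) =
    expR (- (s ^+ 2 * u ^+ 2 / 2)) * (s ^+ 2 * u * cos (u * m + phi) + m * sin (u * m + phi)).
  have h1 := dc phi u; have h2 := dchar phi u.
  have e : (fun u => \int[P]_w cos (u * Y w + phi)) = (fun u => expR (- (s ^+ 2 * u ^+ 2 / 2)) * cos (u * m + phi)).
    by apply/funext => v; exact: char.
  rewrite e in h1.
  have : - (\int[P]_w (sin (u * Y w + phi) * Y w)) =
    - (expR (- (s ^+ 2 * u ^+ 2 / 2)) * (s ^+ 2 * u * cos (u * m + phi) + m * sin (u * m + phi))).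
    transitivity (\int[P]_w (-1 * (sin (u * Y w + phi) * Y w))).
      by rewrite (RintegralZl _ measurableT (isin u phi)) mulN1r.
    by have [_ k1] := h1; have [_ k2] := h2; rewrite -k1 -k2.
  by move/oppr_inj.
split.
  have := first (pi / 2) 0.
  rewrite expr0n !(mulr0, mul0r, oppr0, expR0, mul1r, add0r) sin_pihalf mulr1 => <-.
  by apply: eq_Rintegral => w _; rewrite mul0r add0r sin_pihalf mul1r.
have ds : is_derive (0 : R) 1 (fun u => \int[P]_w (sin (u * Y w + 0) * Y w))
    (\int[P]_w (cos (0 * Y w + 0) * Y w * Y w)).
  apply: (drv_under_integral (G := fun w => Y w ^+ 2) (df := fun u w => cos (u * Y w + 0) * Y w * Y w)) => //.
  - move=> v w; apply: (drvE (drvM (drv_sin (aff w v 0)) (drv_cst (Y w) v))).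
    by ring.
  - move=> v w; rewrite -mulrA normrM -expr2 (ger0_norm (sqr_ge0 _)).
    by rewrite -[leRHS]mul1r ler_wpM2r ?sqr_ge0// cos_max.
have e : (fun u => \int[P]_w (sin (u * Y w + 0) * Y w)) =
   (fun u => expR (- (s ^+ 2 * u ^+ 2 / 2)) * (s ^+ 2 * u * cos (u * m + 0) + m * sin (u * m + 0))).
  by apply/funext => u; exact: first.
rewrite e in ds.
have dr : is_derive (0 : R) 1 (fun u => expR (- (s ^+ 2 * u ^+ 2 / 2)) * (s ^+ 2 * u * cos (u * m + 0) + m * sin (u * m + 0)))
    (s ^+ 2 + m ^+ 2).
  have z := drv_id (0 : R).
  have d1 := drv_exp (drvN (drvM (drvZ (s ^+ 2) (drvX2 z)) (drv_cst 2^-1 (0:R)))).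
  have d2 := drvD (drvM z (drv_cst m (0:R))) (drv_cst (0:R) (0:R)).
  have d3 := drvD (drvM (drvZ (s ^+ 2) z) (drv_cos d2)) (drvZ m (drv_sin d2)).
  apply: (drvE (drvM d1 d3)).
  by rewrite !(mul0r, mulr0, add0r, addr0, expr0n, sin0, cos0, oppr0, expR0, mulr1, mul1r)/=; ring.
have [_ e1] := ds; have [_ e2] := dr; rewrite -e2 e1.
by apply: eq_Rintegral => w _; rewrite mul0r addr0 cos0 mul1r expr2.
Qed.

Lemma gaussian_law_cos Y s : s != 0 -> measurable_fun setT Y ->
  (forall u phi, \int[P]_w cos (u * Y w + phi) = expR (- (s ^+ 2 * u ^+ 2 / 2)) * cos phi) ->
  has_gaussian_law P Y 0 s.
Proof.
move=> s0 mY char U mU.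
have iN : (normal_prob 0 s).-integrable setT (EFin \o (fun=> 1 : R)).
  exact: (finite_measure_integrable_cst (normal_prob 0 s) 1 measurableT).
have mid : measurable_fun setT (id : TR -> R) by exact: measurable_id.
have := @cos_moments_eq _ T _ TR R P (normal_prob 0 s) (fun=> 1) (fun=> 1) Y id
  (integrable_cst_prob 1) iN mY mid.
move=> /(_ _ U mU) H.
have {}H : \int[P]_w (1 * \1_U (Y w)) = \int[normal_prob 0 s]_x (1 * \1_U x).
  apply: H => u phi.
  under eq_Rintegral do rewrite mul1r.
  under [RHS]eq_Rintegral do rewrite mul1r.
  by rewrite char (normal_probE 0 s (bdd_meas_cos u phi)) normal_cos// mulr0 add0r.
rewrite /gaussian_law (negbTE s0).
have mYU : measurable (Y @^-1` U) by rewrite -[X in measurable X]setTI; exact: mY.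
have e1 : (\int[P]_w (\1_(Y @^-1` U) w)%:E = P (Y @^-1` U))%E by rewrite integral_indic// setIT.
have e2 : (\int[normal_prob 0 s]_x (\1_U x)%:E = normal_prob 0 s U)%E by rewrite integral_indic// setIT.
have f1 : fine (P (Y @^-1` U)) = \int[P]_w (1 * \1_U (Y w)).
  by rewrite -e1; congr fine; apply: eq_integral => w _; rewrite mul1r.
have f2 : fine (normal_prob 0 s U) = \int[normal_prob 0 s]_x (1 * \1_U x).
  by rewrite -e2; congr fine; apply: eq_integral => w _; rewrite mul1r.
rewrite -[LHS](fineK (fin_num_measure P _ mYU)) -[RHS](fineK (fin_num_measure (normal_prob 0 s) _ mU)).
congr (_%:E); apply: (etrans f1); apply: (etrans H); exact: (esym f2).
Qed.

End GaussianLaws.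

Section GaussianSpace.
Context d (T : measurableType d) (R : realType) (P : probability T R).
Local Notation L2 := (Lfun P 2%:E).
Implicit Types (Y Z : T -> R) (u phi : R).

Lemma Rintegral_sqr_le Y : Y \in L2 -> (\int[P]_w Y w) ^+ 2 <= nrm2 P Y.
Proof.
move=> YL; set m := \int[P]_w Y w; have iY := L2_integrable YL.
have : 0 <= \int[P]_w ((Y w - m) ^+ 2) by apply: Rintegral_ge0 => w _; exact: sqr_ge0.
have i1 := integrable_scale (-2 * m) iY; have i2 := integrable_cst_prob P (m ^+ 2).
have -> : \int[P]_w ((Y w - m) ^+ 2) = \int[P]_w (Y w ^+ 2 + (-2 * m * Y w + m ^+ 2)).
  by apply: eq_Rintegral => w _; ring.
rewrite (RintegralD measurableT (L2_sqr YL) (integrable_add i1 i2)) (RintegralD measurableT i1 i2).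
by rewrite (RintegralZl _ measurableT iY) Rintegral_cst_prob -/m /nrm2; lra.
Qed.

Definition centred_normal Z := [/\ Z \in L2, \int[P]_w Z w = 0 &
  forall u phi, \int[P]_w cos (u * Z w + phi) = expR (- (u ^+ 2 * nrm2 P Z / 2)) * cos phi].

Lemma cosB_le (x y : R) : `|cos x - cos y| <= `|x - y|.
Proof.
wlog xy : x y / x <= y.
  move=> H; have [/H//|/ltW/H] := leP x y.
  by rewrite distrC (distrC y).
have h1 : cos x - cos y <= y - x.
  have := @ndecr_drv R (fun t => cos t + t) (fun t => - 1 * sin t + 1) x y xy.
  move=> H; suff : cos x + x <= cos y + y by lra.
  apply: H => t _; first exact: (drvD (drv_cos (drv_id t)) (drv_id t)).
  by have := sin_le1 t; lra.
have h2 : cos y - cos x <= y - x.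
  have := @ndecr_drv R (fun t => t - cos t) (fun t => 1 - - 1 * sin t) x y xy.
  move=> H; suff : x - cos x <= y - cos y by lra.
  apply: H => t _; first exact: (drvB (drv_id t) (drv_cos (drv_id t))).
  by have := sin_geN1 t; lra.
by rewrite (distrC x) (@ger0_norm _ (y - x)) ?subr_ge0// ler_norml; apply/andP; split; lra.
Qed.

Lemma L2_bounded Y (M : R) : measurable_fun setT Y -> (forall w, `|Y w| <= M) -> Y \in L2.
Proof.
move=> mY YM; apply: (L2_dom mY (integrable_cst_prob P (M ^+ 2))) => w.
by rewrite -[Y w ^+ 2]real_normK ?num_real// ler_pXn2r ?nnegrE ?normr_ge0// (le_trans _ (YM w)).
Qed.

Lemma measurable_cos_affine Z u phi : measurable_fun setT Z ->
  measurable_fun setT (fun w => cos (u * Z w + phi)).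
Proof.
move=> mZ; apply: (@measurableT_comp _ _ _ _ _ _ (@cos R)).
  by apply: continuous_measurable_fun; exact: continuous_cos.
by apply: measurable_funD => //; exact: measurable_funM.
Qed.

Lemma cos_moment_lip Y Z u phi : Y \in L2 -> Z \in L2 ->
  (\int[P]_w cos (u * Y w + phi) - \int[P]_w cos (u * Z w + phi)) ^+ 2 <=
  u ^+ 2 * nrm2 P (fun w => Y w - Z w).
Proof.
move=> YL ZL.
have cL V : V \in L2 -> (fun w => cos (u * V w + phi)) \in L2.
  move=> VL; apply: (@L2_bounded _ 1); last by move=> w; exact: cos_max.
  exact: measurable_cos_affine (L2_measurable VL).
rewrite -(RintegralB measurableT (L2_integrable (cL _ YL)) (L2_integrable (cL _ ZL))).
apply: le_trans (Rintegral_sqr_le (L2B (cL _ YL) (cL _ ZL))) _.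
rewrite -(nrm2Z u (L2B YL ZL)).
apply: nrm2_le; first exact: (L2B (cL _ YL) (cL _ ZL)).
  exact: (L2_sqr (L2Z u (L2B YL ZL))).
move=> w; rewrite -real_normK ?num_real// -[leRHS]real_normK ?num_real//.
rewrite ler_pXn2r ?nnegrE ?normr_ge0//; apply: le_trans (cosB_le _ _) _.
by rewrite le_eqVlt; apply/orP; left; apply/eqP; congr `| _ |; ring.
Qed.

Lemma cvg_sqr_le (F e : nat -> R) (v : R) : (forall n, (v - F n) ^+ 2 <= e n) ->
  e n @[n --> \oo] --> (0 : R) -> F n @[n --> \oo] --> v.
Proof.
move=> Fv /cvgrPdist_lt e0; apply/cvgrPdist_lt => x x0; near=> n.
have : `|0 - e n| < x ^+ 2 by near: n; apply: e0; exact: exprn_gt0.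
rewrite sub0r normrN => /(le_lt_trans (ler_norm _)) /(le_lt_trans (Fv n)).
by rewrite -real_normK ?num_real// ltr_pXn2r ?nnegrE ?normr_ge0// ltW.
Unshelve. all: by end_near. Qed.

Lemma centred_normal_lim Z : Z \in L2 ->
  (forall e, 0 < e -> exists2 h, centred_normal h & nrm2 P (fun w => Z w - h w) < e) ->
  centred_normal Z.
Proof.
move=> ZL H.
have /choice[h hP] : forall n : nat, exists h, centred_normal h /\ nrm2 P (fun w => Z w - h w) < n.+1%:R^-1.
  by move=> n; have [|h h1 h2] := H (n.+1%:R^-1); [rewrite invr_gt0|exists h].
have hL n : h n \in L2 by have [[]] := hP n.
have c0 : nrm2 P (fun w => Z w - h n w) @[n --> \oo] --> (0 : R).
  apply: (@squeeze_cvgr _ _ _ _ (fun=> 0) (fun n => n.+1%:R^-1)); first last.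
  - exact: cvg_harmonic.
  - exact: cvg_cst.
  - by apply: nearW => n; rewrite nrm2_ge0 ltW//; have [] := hP n.
have sq0 (F : nat -> R) (v k : R) : (forall n, (v - F n) ^+ 2 <= k * nrm2 P (fun w => Z w - h n w)) ->
    F n @[n --> \oo] --> v.
  move=> Fv; apply: (cvg_sqr_le Fv).
  by rewrite -(mulr0 k); apply: cvgM c0; exact: cvg_cst.
split=> //.
  have : (fun=> 0) @ \oo --> \int[P]_w Z w.
    apply: (sq0 (fun=> 0) _ 1) => n; rewrite subr0 mul1r.
    have [[_ h0 _] _] := hP n.
    apply: le_trans (Rintegral_sqr_le (L2B ZL (hL n))).
    by rewrite (RintegralB measurableT (L2_integrable ZL) (L2_integrable (hL n))) h0 subr0.
  by move=> l; apply: (cvg_unique _ l) => //; exact: cvg_cst.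
move=> u phi.
have l1 : \int[P]_w cos (u * h n w + phi) @[n --> \oo] --> \int[P]_w cos (u * Z w + phi).
  by apply: (sq0 _ _ (u ^+ 2)) => n; exact: cos_moment_lip.
apply: (cvg_unique _ l1) => //.
have -> : (fun n => \int[P]_w cos (u * h n w + phi)) =
    (fun n => expR (- (u ^+ 2 * nrm2 P (h n) / 2)) * cos phi).
  by apply/funext => n; have [[_ _ ->]] := hP n.
apply: cvgM; last exact: cvg_cst.
apply: (@continuous_cvg _ _ _ _ _ _ (@expR R)); first exact: continuous_expR.
apply: cvgN; apply: cvgM; last exact: cvg_cst.
by apply: cvgM; [exact: cvg_cst|exact: nrm2_cvg].
Qed.

Lemma centred_normal_law Z s : centred_normal Z -> s != 0 -> nrm2 P Z = s ^+ 2 ->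
  has_gaussian_law P Z 0 s.
Proof.
move=> [ZL _ Zc] s0 Zs; apply: gaussian_law_cos => //; first exact: L2_measurable ZL.
by move=> u phi; rewrite Zc Zs [u ^+ 2 * _]mulrC.
Qed.

Lemma gaussian_span (X : R -> {RV P >-> R}) : gaussian_process X ->
  (forall t, (X t : T -> R) \in L2) -> (forall t, ('E_P[X t] = 0)%E) ->
  forall Z, closed_span P [set (X t : T -> R) | t in [set: R]] Z -> centred_normal Z.
Proof.
move=> gX XL X0.
have SL g : [set (X t : T -> R) | t in [set: R]] g -> g \in L2 by move=> [t _ <-].
move=> Z /(closed_spanP (mu := P) SL)[ZL Zl]; apply: centred_normal_lim => // e /Zl[h hc he].
exists h => //; case: hc => n [c [g [gS hE]]].
have /choice[t tP] : forall i, exists t, (X t : T -> R) = g i.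
  by move=> i; have [t _ tg] := gS i; exists t.
have {}hE : h = (fun w => \sum_(i < n) c i * X (t i) w).
  by rewrite hE; apply/funext => w; apply: eq_bigr => i _; rewrite -tP.
have hL : h \in L2 by rewrite hE; apply: L2_sum => i; apply: L2Z.
have h0 : \int[P]_w h w = 0.
  rewrite hE; elim: n c t {g gS tP hE hL} => [|n IH] c t.
    by rewrite (eq_Rintegral _ (g := fun=> 0)) ?Rintegral_cst_prob// => w _; rewrite big_ord0.
  have iX i : P.-integrable setT (EFin \o (fun w => c i * X (t i) w)).
    by apply: integrable_scale; exact: L2_integrable.
  rewrite (eq_Rintegral _ (g := fun w => \sum_(i < n) c (widen_ord (leqnSn n) i) * X (t (widen_ord (leqnSn n) i)) w
     + c ord_max * X (t ord_max) w)); last by move=> w _; rewrite big_ord_recr.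
  rewrite RintegralD//; last first.
    by apply: L2_integrable; apply: L2_sum => i; apply: L2Z.
  rewrite (IH (fun i => c (widen_ord (leqnSn n) i)) (fun i => t (widen_ord (leqnSn n) i))) add0r.
  rewrite (RintegralZl _ measurableT (L2_integrable (XL _))).
  have := X0 (t ord_max); rewrite unlock => e0.
  by rewrite /Rintegral e0 mulr0.
have [m [s [s0 ms]]] := gX n t c; rewrite -hE in ms.
have [] := gaussian_moments hL ms; rewrite h0 => m0 v.
split=> // u phi; rewrite (gaussian_cos (L2_measurable hL) ms) -m0 mulr0 add0r v -m0.
by rewrite expr0n addr0 mulrC [s ^+ 2 * _]mulrC mulrC.
Qed.

End GaussianSpace.

Section Independence.
Context d (T : measurableType d) (R : realType) (P : probability T R).
Variables (xi : nat -> {RV P >-> R}) (v : R).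
Hypothesis xi_cos : forall (s : seq nat) (c : nat -> R) (phi : R), uniq s ->
  \int[P]_w cos (\sum_(i <- s) c i * xi i w + phi) =
  expR (- (v * (\sum_(i <- s) c i ^+ 2) / 2)) * cos phi.

Lemma measurable_xi_sum (s : seq nat) (c : nat -> R) :
  measurable_fun setT (fun w => \sum_(i <- s) c i * xi i w).
Proof. by apply: measurable_sum => i; exact: measurable_funM. Qed.

Variables (U : nat -> set (measurableTypeR R)).
Hypothesis mU : forall n, measurable (U n).
Let Ind (l : seq nat) w : R := \prod_(i <- l) \1_(U i) (xi i w).

Let mInd l : measurable_fun setT (Ind l).
Proof.
apply: measurable_prod => i _.
have mI : measurable_fun [set: measurableTypeR R] (\1_(U i) : measurableTypeR R -> R).
  exact: measurable_indic.
have mx : measurable_fun setT (xi i : T -> measurableTypeR R) by move=> mT V mV; rewrite setTI; exact: (measurable_funPTI (xi i) mV).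
exact: (measurableT_comp mI mx).
Qed.

Let Ind_le1 l w : `|Ind l w| <= 1.
Proof.
rewrite /Ind; elim: l => [|i l IH]; first by rewrite big_nil normr1.
rewrite big_cons normrM indicE; case: (_ \in _); last by rewrite normr0 mul0r.
by rewrite normr1 mul1r.
Qed.

Lemma independence_step (l : seq nat) : uniq l -> forall (s : seq nat) (c : nat -> R) (phi : R),
  uniq (l ++ s) ->
  \int[P]_w (Ind l w * cos (\sum_(i <- s) c i * xi i w + phi)) =
  (\prod_(i <- l) \int[P]_w \1_(U i) (xi i w)) *
  (expR (- (v * (\sum_(i <- s) c i ^+ 2) / 2)) * cos phi).
Proof.
elim: l => [_ s c phi us|n l IH /= /andP[nl ul] s c phi /andP[nls uls]].
  rewrite big_nil mul1r -xi_cos//; apply: eq_Rintegral => w _.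
  by rewrite /Ind big_nil mul1r.
have ns : n \notin s by apply: contra nls; rewrite mem_cat orbC => ->.
have uls' : uniq (l ++ n :: s) by rewrite (perm_uniq (_ : perm_eq _ (n :: l ++ s))) ?perm_catCA//= ?nls// -cat1s perm_catCA.
pose Z w := \sum_(i <- s) c i * xi i w.
pose K := (\prod_(i <- l) \int[P]_w \1_(U i) (xi i w)) *
  (expR (- (v * (\sum_(i <- s) c i ^+ 2) / 2)) * cos phi).
pose V w := Ind l w * cos (Z w + phi).
have mZ : measurable_fun setT Z := measurable_xi_sum s c.
have mcZ ph : measurable_fun setT (fun w => cos (Z w + ph)).
  by have := measurable_cos_affine 1 ph mZ; under [X in measurable_fun _ X -> _]eq_fun do rewrite mul1r.
have iV ph : P.-integrable setT (EFin \o (fun w => Ind l w * cos (Z w + ph))).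
  apply: L2_integrable; apply: (@L2_bounded _ _ _ _ _ 1).
    exact: measurable_funM (mInd l) (mcZ ph).
  by move=> w; rewrite normrM mulr_ile1 ?normr_ge0// ?Ind_le1// cos_max.
have key : \int[P]_w (V w * \1_(U n) (xi n w)) = \int[P]_w (K * \1_(U n) (xi n w)).
  apply: (@cos_moments_eq _ T _ T R P P V (fun=> K) (xi n) (xi n)) => //.
  - exact: iV.
  - exact: integrable_cst_prob.
  move=> u psi.
  have mcu : measurable_fun setT (fun w => cos (u * xi n w + psi)) by exact: measurable_cos_affine.
  have icu : P.-integrable setT (EFin \o (fun w => cos (u * xi n w + psi))).
    by apply: L2_integrable; apply: (@L2_bounded _ _ _ _ _ 1) => // w; exact: cos_max.
  rewrite (RintegralZl _ measurableT icu).
  have -> : \int[P]_w cos (u * xi n w + psi) = expR (- (v * u ^+ 2 / 2)) * cos psi.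
    have := xi_cos (fun=> u) psi (isT : uniq [:: n]); rewrite big_seq1 => <-.
    by apply: eq_Rintegral => w _; rewrite big_seq1.
  pose c' (e : R) i := if i == n then e else c i.
  have c's e (F : nat -> R -> R) : \sum_(i <- n :: s) F i (c' e i) = F n e + \sum_(i <- s) F i (c i).
    rewrite big_cons /c' eqxx; congr (_ + _); apply: eq_big_seq => i si.
    by case: eqP => // ein; rewrite ein (negbTE ns) in si.
  have I1 := IH ul (n :: s) (c' u) (phi + psi) uls'.
  have I2 := IH ul (n :: s) (c' (- u)) (phi - psi) uls'.
  rewrite (c's u (fun=> fun x => x ^+ 2)) in I1; rewrite (c's (- u) (fun=> fun x => x ^+ 2)) in I2.
  have e1 w : \sum_(i <- n :: s) c' u i * xi i w = u * xi n w + Z w.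
    by rewrite (c's u (fun i x => x * xi i w)).
  have e2 w : \sum_(i <- n :: s) c' (- u) i * xi i w = - u * xi n w + Z w.
    by rewrite (c's (- u) (fun i x => x * xi i w)).
  have E w : V w * cos (u * xi n w + psi) =
     2^-1 * (Ind l w * cos (\sum_(i <- n :: s) c' u i * xi i w + (phi + psi))) +
     2^-1 * (Ind l w * cos (\sum_(i <- n :: s) c' (- u) i * xi i w + (phi - psi))).
    rewrite e1 e2 /V.
    have -> : u * xi n w + Z w + (phi + psi) = (Z w + phi) + (u * xi n w + psi) by ring.
    have -> : - u * xi n w + Z w + (phi - psi) = (Z w + phi) - (u * xi n w + psi) by ring.
    by rewrite (cosB (Z w + phi)) (cosD (Z w + phi)); field.
  rewrite (eq_Rintegral _ (fun w _ => E w)).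
  have ii e ph : P.-integrable setT (EFin \o
      (fun w => Ind l w * cos (\sum_(i <- n :: s) c' e i * xi i w + ph))).
    apply: L2_integrable; apply: (@L2_bounded _ _ _ _ _ 1).
      apply: measurable_funM; first exact: mInd.
      have := measurable_cos_affine 1 ph (measurable_xi_sum (n :: s) (c' e)).
      by under [X in measurable_fun _ X -> _]eq_fun do rewrite mul1r.
    by move=> w; rewrite normrM mulr_ile1 ?normr_ge0// ?Ind_le1// cos_max.
  rewrite RintegralD//; try exact: integrable_scale (ii _ _).
  rewrite !(RintegralZl _ measurableT (ii _ _)) I1 I2 /K sqrrN.
  have -> : expR (- (v * (u ^+ 2 + \sum_(i <- s) c i ^+ 2) / 2)) =
    expR (- (v * u ^+ 2 / 2)) * expR (- (v * (\sum_(i <- s) c i ^+ 2) / 2)).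
    by rewrite -expRD; congr expR; ring.
  by rewrite cosD cosB; field.
transitivity (\int[P]_w (V w * \1_(U n) (xi n w))).
  by apply: eq_Rintegral => w _; rewrite /V /Ind big_cons; ring.
have i1 : P.-integrable setT (EFin \o (fun w => \1_(U n) (xi n w) : R)).
  apply: L2_integrable; apply: (@L2_bounded _ _ _ _ _ 1).
    by have := mInd [:: n]; rewrite /Ind; under [X in measurable_fun _ X -> _]eq_fun do rewrite big_seq1.
  by move=> w; have := Ind_le1 [:: n] w; rewrite /Ind big_seq1.
by rewrite key (RintegralZl _ measurableT i1) big_cons /K; ring.
Qed.

End Independence.

Lemma independent_of_cos d (T : measurableType d) (R : realType) (P : probability T R)
    (xi : nat -> {RV P >-> R}) (v : R) :
  (forall (s : seq nat) (c : nat -> R) (phi : R), uniq s ->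
    \int[P]_w cos (\sum_(i <- s) c i * xi i w + phi) =
    expR (- (v * (\sum_(i <- s) c i ^+ 2) / 2)) * cos phi) ->
  mutually_independent xi.
Proof.
move=> H s U us mU.
have mxU i : measurable (xi i @^-1` U i).
  exact: (measurable_funPTI (xi i) (mU i)).
have PU V : measurable V -> \int[P]_w \1_V w = fine (P V).
  by move=> mV; rewrite /Rintegral integral_indic// setIT.
have := @independence_step _ T R P xi v H U mU s us [::] (fun=> 0) 0.
rewrite cats0 => /(_ us); rewrite big_nil mulr0 mul0r oppr0 expR0 cos0 !mulr1.
have -> : \int[P]_w (\prod_(i <- s) \1_(U i) (xi i w) * cos (\sum_(i <- [::]) 0 * xi i w + 0)) =
    fine (P [set w | forall n, n \in s -> U n (xi n w)]).
  rewrite -PU.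
    apply: eq_Rintegral => w _; rewrite big_nil addr0 cos0 mulr1 indicE.
    elim: s {us} => [|i s IH].
      by rewrite big_nil (_ : (w \in _) = true)//; apply/idP; rewrite inE => n; rewrite in_nil.
    rewrite big_cons IH indicE; have [Ui|Ui] := boolP (xi i w \in U i); last first.
      rewrite mul0r memNset// => /(_ i (mem_head _ _)) h; by rewrite mem_set in Ui.
    rewrite mul1r; congr (_ _)%:R; apply/idP/idP; rewrite !inE => h.
      by move=> n; rewrite inE => /orP[/eqP->|]; [exact: set_mem Ui|exact: h].
    by move=> n ns; apply: h; rewrite inE ns orbT.
  have -> : [set w | forall n, n \in s -> U n (xi n w)] = \bigcap_(n in [set` s]) (xi n @^-1` U n).
    by apply/seteqP; split.
  by apply: fin_bigcap_measurable => //; exact: finite_seq.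
move=> E; rewrite -[LHS]fineK; last first.
  apply: fin_num_measure.
  have -> : [set w | forall n, n \in s -> U n (xi n w)] = \bigcap_(n in [set` s]) (xi n @^-1` U n).
    by apply/seteqP; split.
  by apply: fin_bigcap_measurable => //; exact: finite_seq.
rewrite E; elim: s {us E} => [|i s IH]; first by rewrite !big_nil.
rewrite !big_cons EFinM IH; congr (_ * _)%E.
have -> : \int[P]_w \1_(U i) (xi i w) = fine (P (xi i @^-1` U i)) by rewrite -PU.
by rewrite fineK// fin_num_measure.
Qed.

Lemma nrm2_sum d (T : measurableType d) (R : realType) (mu : {measure set T -> \bar R}) n
    (k : 'I_n -> R) (F : 'I_n -> T -> R) : (forall i, F i \in Lfun mu 2%:E) ->
  nrm2 mu (fun x => \sum_(i < n) k i * F i x) =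
  \sum_(i < n) \sum_(j < n) k i * k j * \int[mu]_x (F i x * F j x).
Proof.
move=> FL.
have isum m (G : 'I_m -> T -> R) : (forall i, mu.-integrable setT (EFin \o G i)) ->
    mu.-integrable setT (EFin \o (fun x => \sum_(i < m) G i x)) /\
    \int[mu]_x (\sum_(i < m) G i x) = \sum_(i < m) \int[mu]_x G i x.
  elim: m G => [|m IH] G iG.
    rewrite big_ord0 (_ : (fun x => _) = fun=> 0); last by apply/funext => x; rewrite big_ord0.
    split; last by rewrite /Rintegral integral0.
    exact: integrable0.
  have [i1 i2] := IH (fun i => G (widen_ord (leqnSn m) i)) (fun i => iG _).
  rewrite (_ : (fun x => _) = fun x => \sum_(i < m) G (widen_ord (leqnSn m) i) x + G ord_max x); last first.
    by apply/funext => x; rewrite big_ord_recr.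
  split; first exact: integrable_add.
  by rewrite RintegralD// big_ord_recr/= i2.
have iF i j : mu.-integrable setT (EFin \o (fun x => k i * k j * (F i x * F j x))).
  by apply: integrable_scale; exact: L2M.
transitivity (\int[mu]_x (\sum_(i < n) \sum_(j < n) k i * k j * (F i x * F j x))).
  apply: eq_Rintegral => x _; rewrite expr2 mulr_suml; apply: eq_bigr => i _.
  by rewrite mulr_sumr; apply: eq_bigr => j _; ring.
rewrite (isum _ _ _).2; last by move=> i; exact: (isum _ _ (iF i)).1.
apply: eq_bigr => i _; rewrite (isum _ _ (iF i)).2; apply: eq_bigr => j _.
by rewrite (RintegralZl _ measurableT (L2M (FL _) (FL _))).
Qed.

Section IsometricPairs.
Context d1 (T1 : measurableType d1) d2 (T2 : measurableType d2) (R : realType).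
Variables (mu : {measure set T1 -> \bar R}) (nu : {measure set T2 -> \bar R}) (I : Type).
Variables (M : I -> T1 -> R) (N : I -> T2 -> R) (c : R).
Hypotheses (ML : forall i, M i \in Lfun mu 2%:E) (NL : forall i, N i \in Lfun nu 2%:E).
Hypothesis c0 : 0 <= c.
Hypothesis MN : forall i j, \int[mu]_w (M i w * M j w) = c * \int[nu]_x (N i x * N j x).

Let comb T n (k : 'I_n -> R) (s : 'I_n -> I) (F : I -> T -> R) x := \sum_(i < n) k i * F (s i) x.

Let comb_L2 d (T : measurableType d) (la : {measure set T -> \bar R}) n (k : 'I_n -> R) (s : 'I_n -> I)
    (F : I -> T -> R) : (forall i, F i \in Lfun la 2%:E) -> comb k s F \in Lfun la 2%:E.
Proof. by move=> FL; apply: L2_sum => i; exact: L2Z. Qed.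

Let comb_nrm2 d (T : measurableType d) (la : {measure set T -> \bar R}) n (k : 'I_n -> R) (s : 'I_n -> I)
    (F : I -> T -> R) : (forall i, F i \in Lfun la 2%:E) ->
  nrm2 la (comb k s F) = \sum_(i < n) \sum_(j < n) k i * k j * \int[la]_x (F (s i) x * F (s j) x).
Proof. by move=> FL; exact: (@nrm2_sum _ _ _ _ _ k (fun i => F (s i))). Qed.

Let comb_isometry n (k : 'I_n -> R) (s : 'I_n -> I) : nrm2 mu (comb k s M) = c * nrm2 nu (comb k s N).
Proof.
rewrite !comb_nrm2// mulr_sumr; apply: eq_bigr => i _; rewrite mulr_sumr; apply: eq_bigr => j _.
by rewrite MN; ring.
Qed.

Definition isometric_pair (Z : T1 -> R) (G : T2 -> R) :=
  [/\ Z \in Lfun mu 2%:E, G \in Lfun nu 2%:E & forall e : R, 0 < e ->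
    exists n (k : 'I_n -> R) (s : 'I_n -> I),
      nrm2 mu (fun w => Z w - \sum_(i < n) k i * M (s i) w) < e /\
      nrm2 nu (fun x => G x - \sum_(i < n) k i * N (s i) x) < e].

Lemma isometric_pair_norm Z G : isometric_pair Z G -> nrm2 mu Z = c * nrm2 nu G.
Proof.
move=> [ZL GL ZG].
have /choice[q qP] : forall m : nat, exists q : {n & ('I_n -> R) * ('I_n -> I)}%type,
    nrm2 mu (fun w => Z w - comb (projT2 q).1 (projT2 q).2 M w) < m.+1%:R^-1 /\
    nrm2 nu (fun w => G w - comb (projT2 q).1 (projT2 q).2 N w) < m.+1%:R^-1.
  move=> m; have [|n [k [s H]]] := ZG (m.+1%:R^-1); first by rewrite invr_gt0.
  by exists (existT _ n (k, s)).
pose h m := comb (projT2 (q m)).1 (projT2 (q m)).2 M.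
pose H m := comb (projT2 (q m)).1 (projT2 (q m)).2 N.
have to0 (u : nat -> R) : (forall m, 0 <= u m) -> (forall m, u m < m.+1%:R^-1) -> u m @[m --> \oo] --> (0 : R).
  move=> u0 uS; apply: (@squeeze_cvgr _ _ _ _ (fun=> 0) (fun n => n.+1%:R^-1)); first last.
  - exact: cvg_harmonic.
  - exact: cvg_cst.
  - by apply: nearW => n; rewrite u0 ltW.
have l1 : nrm2 mu (h m) @[m --> \oo] --> nrm2 mu Z.
  apply: nrm2_cvg => //; first by move=> m; exact: comb_L2.
  by apply: to0 => m; [exact: nrm2_ge0|have [] := qP m].
have l2 : nrm2 nu (H m) @[m --> \oo] --> nrm2 nu G.
  apply: nrm2_cvg => //; first by move=> m; exact: comb_L2.
  by apply: to0 => m; [exact: nrm2_ge0|have [] := qP m].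
have l3 : nrm2 mu (h m) @[m --> \oo] --> c * nrm2 nu G.
  under eq_cvg do rewrite comb_isometry.
  by apply: cvgM l2; exact: cvg_cst.
exact: (cvg_unique _ l1 l3).
Qed.

Lemma isometric_pair_incl i : isometric_pair (M i) (N i).
Proof.
split=> // e e0; exists 1%N, (fun=> 1), (fun=> i); split.
  by rewrite nrm2_0// => w; rewrite big_ord1 mul1r subrr.
by rewrite nrm2_0// => w; rewrite big_ord1 mul1r subrr.
Qed.

Lemma isometric_pair_lin a Z G Z' G' : isometric_pair Z G -> isometric_pair Z' G' ->
  isometric_pair (fun w => Z w + a * Z' w) (fun x => G x + a * G' x).
Proof.
move=> [ZL GL ZG] [ZL' GL' ZG']; split; [exact: (L2D ZL (L2Z a ZL'))|exact: (L2D GL (L2Z a GL'))|].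
move=> e e0; set e1 := e / (4 * (1 + a ^+ 2)).
have a1 : 0 < 1 + a ^+ 2 by rewrite ltr_wpDr ?sqr_ge0.
have e10 : 0 < e1 by rewrite divr_gt0// mulr_gt0.
have e1e : e1 * (1 + a ^+ 2) = e / 4 by rewrite /e1; field; rewrite gt_eqF.
have [n [k [s [h1 h2]]]] := ZG e1 e10; have [n' [k' [s' [h1' h2']]]] := ZG' e1 e10.
pose K (i : 'I_(n + n')) := match fintype.split i with inl j => k j | inr j => a * k' j end.
pose S (i : 'I_(n + n')) := match fintype.split i with inl j => s j | inr j => s' j end.
have E T (F : I -> T -> R) x : \sum_(i < n + n') K i * F (S i) x =
    comb k s F x + a * comb k' s' F x.
  rewrite big_split_ord/= mulr_sumr; congr (_ + _); apply: eq_bigr => i _.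
    by rewrite /K /S (unsplitK (inl i)).
  by rewrite /K /S (unsplitK (inr i)) mulrA.
have key d (T : measurableType d) (la : {measure set T -> \bar R}) (F : I -> T -> R) (Y Y' : T -> R) :
    (forall i, F i \in Lfun la 2%:E) -> Y \in Lfun la 2%:E -> Y' \in Lfun la 2%:E ->
    nrm2 la (fun x => Y x - comb k s F x) < e1 -> nrm2 la (fun x => Y' x - comb k' s' F x) < e1 ->
    nrm2 la (fun x => (Y x + a * Y' x) - \sum_(i < n + n') K i * F (S i) x) < e.
  move=> FL YL YL' y1 y2.
  have L1 := L2B YL (comb_L2 k s FL); have L2 := L2B YL' (comb_L2 k' s' FL).
  have -> : (fun x => Y x + a * Y' x - \sum_(i < n + n') K i * F (S i) x) =
      (fun x => (Y x - comb k s F x) + a * (Y' x - comb k' s' F x)).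
    by apply/funext => x; rewrite E; ring.
  apply: le_lt_trans (nrm2D L1 (L2Z a L2)) _; rewrite nrm2Z//.
  have := ler_wpM2l (sqr_ge0 a) (ltW y2); lra.
exists (n + n')%N, K, S; split; exact: key.
Qed.

Lemma isometric_pair_sum n (k : 'I_n -> R) (Z : 'I_n -> T1 -> R) (G : 'I_n -> T2 -> R) Z0 G0 :
  isometric_pair Z0 G0 -> (forall i, isometric_pair (Z i) (G i)) ->
  isometric_pair (fun w => Z0 w + \sum_(i < n) k i * Z i w) (fun x => G0 x + \sum_(i < n) k i * G i x).
Proof.
move=> P0; elim: n k Z G => [|n IH] k Z G PZ.
  by under eq_fun do rewrite big_ord0 addr0; under [X in isometric_pair _ X]eq_fun do rewrite big_ord0 addr0.
have := isometric_pair_lin (k ord_max) (IH (fun i => k (widen_ord (leqnSn n) i))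
  (fun i => Z (widen_ord (leqnSn n) i)) (fun i => G (widen_ord (leqnSn n) i)) (fun i => PZ _)) (PZ ord_max).
by congr isometric_pair; apply/funext => x; rewrite big_ord_recr/= addrA.
Qed.

Lemma isometric_pair_span Z G : isometric_pair Z G -> closed_span mu (range M) Z.
Proof.
move=> [ZL GL ZG].
have SL g : range M g -> g \in Lfun mu 2%:E by move=> [i _ <-].
apply/(closed_spanP SL); split=> // e /ZG[n [k [s [h _]]]].
exists (fun w => \sum_(i < n) k i * M (s i) w) => //.
by exists n, k, (fun i => M (s i)); split=> // i; exists (s i).
Qed.

(* Approximants of [G] by combinations of the [N i] that are [8 ^ - n]-close have
   Cauchy images, whose limit exists by Riesz-Fischer. *)
Lemma isometric_pair_exists G : closed_span nu (range N) G -> exists Z, isometric_pair Z G.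
Proof.
have SL g : range N g -> g \in Lfun nu 2%:E by move=> [i _ <-].
move=> /(closed_spanP SL)[GL HG].
pose dl n : R := 8^-1 ^+ n / (4 * (c + 1)).
have c1 : 0 < c + 1 by rewrite ltr_wpDl.
have dl0 n : 0 < dl n by rewrite divr_gt0 ?exprn_gt0 ?invr_gt0// mulr_gt0.
have /choice[q qP] : forall m : nat, exists q : {n & ('I_n -> R) * ('I_n -> I)}%type,
    nrm2 nu (fun w => G w - comb (projT2 q).1 (projT2 q).2 N w) < dl m.
  move=> m; have [H [n [k [g [gN HE]]]] Hm] := HG (dl m) (dl0 m).
  have /choice[s sP] : forall i, exists s, N s = g i by move=> i; have [s _ <-] := gN i; exists s.
  exists (existT _ n (k, s)) => /=; move: Hm; rewrite HE.
  by congr (nrm2 nu _ < _); apply/funext => x; congr (_ - _); apply: eq_bigr => i _; rewrite sP.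
pose h m := comb (projT2 (q m)).1 (projT2 (q m)).2 M.
pose H m := comb (projT2 (q m)).1 (projT2 (q m)).2 N.
have hL m : h m \in Lfun mu 2%:E by exact: comb_L2.
have HL m : H m \in Lfun nu 2%:E by exact: comb_L2.
have diff m m' : nrm2 mu (fun w => h m w - h m' w) = c * nrm2 nu (fun x => H m x - H m' x).
  rewrite /h /H; case: (q m) => n [k s]; case: (q m') => n' [k' s'] /=.
  pose K (i : 'I_(n + n')) := match fintype.split i with inl j => k j | inr j => - k' j end.
  pose S (i : 'I_(n + n')) := match fintype.split i with inl j => s j | inr j => s' j end.
  have E T (F : I -> T -> R) : (fun x => comb k s F x - comb k' s' F x) = comb K S F.
    apply/funext => x; rewrite /comb big_split_ord/= -sumrN; congr (_ + _); apply: eq_bigr => i _.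
      by rewrite /K /S (unsplitK (inl i)).
    by rewrite /K /S (unsplitK (inr i)) mulNr.
  by rewrite !E comb_isometry.
have Hd n : nrm2 mu (fun w => h n.+1 w - h n w) <= 8^-1 ^+ n.
  rewrite diff.
  have e1 : nrm2 nu (fun x => H n.+1 x - H n x) <= 2 * dl n.+1 + 2 * dl n.
    apply: le_trans (nrm2B (HL _) GL (HL _)) _; rewrite [in X in X + _]nrm2N.
    by apply: lerD; rewrite ler_wpM2l// ltW// qP.
  have e2 : dl n.+1 <= dl n.
    rewrite /dl exprS ler_wpM2r ?invr_ge0 ?mulr_ge0 ?(ltW c1)//.
    rewrite ler_piMl// ?exprn_ge0 ?invr_ge0//; lra.
  have e3 : 4 * dl n * (c + 1) = 8^-1 ^+ n by rewrite /dl; field; rewrite gt_eqF.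
  apply: le_trans (ler_wpM2l c0 e1) _; rewrite -e3.
  have := dl0 n; have := ler_wpM2l c0 e2; lra.
have [Z ZL Zc] := riesz_fischer hL Hd.
exists Z; split=> // e e0.
have Gc : dl n @[n --> \oo] --> (0 : R).
  rewrite -(mul0r (4 * (c + 1))^-1); apply: cvgM; last exact: cvg_cst.
  by apply: cvg_expr; rewrite ger0_norm ?invr_ge0//; lra.
have ev : \forall n \near \oo, `|0 - nrm2 mu (fun w => Z w - h n w)| < e /\ `|0 - dl n| < e.
  by apply: filterI; [move/cvgrPdist_lt : Zc|move/cvgrPdist_lt : Gc]; exact.
have [m _ /(_ m (leqnn m)) [m1 m2]] := ev.
exists (projT1 (q m)), (projT2 (q m)).1, (projT2 (q m)).2; split.
  by apply: le_lt_trans (ler_norm _) _; rewrite -normrN -sub0r.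
apply: lt_le_trans (qP m) _; apply: ltW; apply: le_lt_trans (ler_norm _) _.
by rewrite -normrN -sub0r.
Qed.

End IsometricPairs.

Section Expansion.
Variables (R : realType) (p : R -> R) (a b : R -> R -> R).
Hypothesis S : sturm p a b.
Variables (r : R) (lam : nat -> R).
Hypothesis r0 : 0 < r.
Hypothesis lamP : forall n, 0 < lam n /\ pruefer_angle p a b (lam n) r = pi / 2 + n%:R * pi.
Hypothesis lamH : {homo lam : m n / (m < n)%N >-> m < n}.
Hypothesis lam_ar : forall n, a (lam n) r = 0.
Implicit Types (s t : R) (n : nat).
Local Notation TR := (measurableTypeR R).
Local Notation leb := (@lebesgue_measure R).
Local Notation J := (`[0, r]%classic : set TR).
Local Notation Q := (sturm_norm p b r lam).
Local Notation A n := (a (lam n)).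
Local Notation B n := (b (lam n)).
Local Notation al := (prim0y p).

Let p0 t : 0 <= t -> 0 < p t. Proof. exact: (sturm_gt0 S). Qed.
Let cp : cnn p. Proof. exact: (sturm_cont S). Qed.
Let ca n : cnn (A n). Proof. exact: (@sturm_ca _ _ _ _ S (lam n)). Qed.
Let csq : cnn (fun t => Num.sqrt (p t)).
Proof. by apply: cnn_comp => //; exact: sqrt_continuous. Qed.
Let sqp t : 0 <= t -> Num.sqrt (p t) ^+ 2 = p t.
Proof. by move=> t0; rewrite sqr_sqrtr// ltW// p0. Qed.
Let Q0 n : 0 < Q n. Proof. exact: (sturm_norm_gt0 S r0 lamP). Qed.
Let psi : TR -> R := (fun t => Num.sqrt (p t)) \_ J.
Let psiL : psi \in Lfun leb 2%:E. Proof. exact: restrict_L2. Qed.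

Definition step s : TR -> R := (fun t => (t <= s)%R%:R * Num.sqrt (p t)) \_ J.
Definition mode n : TR -> R := (fun t => (Num.sqrt (Q n))^-1 * (A n t * Num.sqrt (p t))) \_ J.

Let stepE s x : step s x = (x <= s)%R%:R * psi x.
Proof. by rewrite /step /psi !patchE; case: ifP => // _; rewrite mulr0. Qed.

Lemma step_L2 s : step s \in Lfun leb 2%:E.
Proof.
apply: (L2_dom _ (L2_sqr psiL)).
  rewrite (_ : step s = fun x => \1_(`]-oo, s]%classic) x * psi x).
    by apply: measurable_funM; [exact: measurable_indic|exact: L2_measurable psiL].
  by apply/funext => x; rewrite stepE indicE mem_setE/= in_itv.
move=> x; rewrite stepE exprMn; case: (x <= s)%R; first by rewrite expr1n mul1r.
by rewrite expr0n mul0r sqr_ge0.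
Qed.

Lemma mode_L2 n : mode n \in Lfun leb 2%:E.
Proof. by apply: restrict_L2; apply: cnnM; [exact: cnn_cst|exact: cnnM]. Qed.

Let restrict_int (f : R -> R) u : 0 <= u -> \int[leb]_x ((f : TR -> R) \_ `[0, u]%classic) x = prim0y f u.
Proof. by move=> u0; rewrite prim0yE// [RHS]Rintegral_mkcond. Qed.

Lemma step_gram s t : 0 <= s <= r -> 0 <= t <= r ->
  \int[leb]_x (step s x * step t x) = al (Num.min s t).
Proof.
move=> /andP[s0 sr] /andP[t0 tr]; rewrite -restrict_int ?le_min ?s0//.
apply: eq_Rintegral => x _; rewrite !stepE /psi !patchE !mem_setE/= !in_itv/=.
rewrite le_min; have [x0|x0] := leP 0 x; last by rewrite mulr0 mul0r.
have [xs|xs] := leP x s; last by rewrite mul0r mul0r.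
have [xt|xt] := leP x t; last by rewrite mul0r mulr0.
by rewrite (le_trans xs sr) !mul1r -expr2 sqp.
Qed.

Lemma mode_gram m n : \int[leb]_x (mode m x * mode n x) = (m == n)%:R.
Proof.
transitivity (\int[leb]_x (((fun t => ((Num.sqrt (Q m))^-1 * (Num.sqrt (Q n))^-1) *
    (p t * (A m t * A n t))) : TR -> R) \_ J) x).
  apply: eq_Rintegral => x _; rewrite /mode !patchE mem_setE/= in_itv/=.
  case: ifP => [/andP[x0 _]|_]; last by rewrite mulr0.
  by have := sqp x0; set q := Num.sqrt (p x) => <-; ring.
rewrite restrict_int ?(ltW r0)// prim0yZ ?(ltW r0)//; last by apply: cnnM => //; exact: cnnM.
rewrite (sturm_orthogonal_dual S r0 lamP lamH lam_ar); case: eqP => [<-|_]; last by rewrite mul0r mulr0.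
have q0 : Num.sqrt (Q m) != 0 by rewrite gt_eqF// sqrtr_gt0.
have qq : Num.sqrt (Q m) * Num.sqrt (Q m) = Q m by rewrite -expr2 sqr_sqrtr// ltW.
by rewrite mul1r -{3}qq mulrACA mulVf// mulr1.
Qed.

Lemma step_dense (f : R -> R) : cnn f ->
  closed_span leb [set step s | s in [set s | 0 <= s <= r]] ((fun t => f t * Num.sqrt (p t)) \_ J : TR -> R).
Proof.
move=> cf; set SS := [set step s | s in _].
have SL g : SS g -> g \in Lfun leb 2%:E by move=> [s _ <-]; exact: step_L2.
have stepC s : 0 <= s <= r -> closed_span leb SS (step s).
  by move=> sr; apply: (closed_span_incl SL); exists s.
have psir : psi = step r.
  apply/funext => x; rewrite stepE /psi patchE; case: ifP; rewrite ?mulr0// mem_setE/= in_itv/=.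
  by move=> /andP[_ ->]; rewrite mul1r.
have r0r : 0 <= r <= r by rewrite ltW/=.
have psiC : closed_span leb SS psi by rewrite psir; exact: stepC.
have rayC (s : R) : closed_span leb SS (fun x => \1_(`]s, +oo[%classic) x * psi x).
  have E (x : R) : \1_(`]s, +oo[%classic) x = 1 - (x <= s)%R%:R :> R.
    rewrite indicE mem_setE/= in_itv/= andbT.
    by case: leP => _; rewrite ?subrr ?subr0.
  have [s0|s0] := ltP s 0.
    rewrite (_ : (fun x => _) = psi)//; apply/funext => x; rewrite E.
    rewrite /psi patchE; case: ifP; rewrite ?mulr0// mem_setE/= in_itv/= => /andP[x0 _].
    by rewrite leNgt (lt_le_trans s0 x0) subr0 mul1r.
  have [rs|sr] := leP r s.
    rewrite (_ : (fun x => _) = fun=> 0); first exact: closed_span0 psiC.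
    apply/funext => x; rewrite E /psi patchE; case: ifP; rewrite ?mulr0// mem_setE/= in_itv/= => /andP[_ xr].
    by rewrite (le_trans xr rs) subrr mul0r.
  rewrite (_ : (fun x => _) = fun x => psi x - step s x).
    by apply: (closed_spanB SL) => //; apply: stepC; rewrite s0 ltW.
  by apply/funext => x; rewrite E stepE mulrBl mul1r.
have E : ((fun t => f t * Num.sqrt (p t)) \_ J : TR -> R) = fun x => (f \_ J : TR -> R) x * psi x.
  by apply/funext => x; rewrite /psi !patchE; case: ifP => // _; rewrite mulr0.
have L2f : ((fun t => f t * Num.sqrt (p t)) \_ J : TR -> R) \in Lfun leb 2%:E.
  by apply: restrict_L2; exact: cnnM.
rewrite E in L2f *.
by apply: (closed_span_weight SL) => //; exact: restrict_measurable.
Qed.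

Context d (T : measurableType d) (P : probability T R).
Variables (M : R -> T -> R) (c : R).
Hypothesis c0 : 0 <= c.
Hypothesis ML : forall t, 0 <= t -> M t \in Lfun P 2%:E.
Hypothesis MM : forall s t, 0 <= s -> 0 <= t -> \int[P]_w (M s w * M t w) = c * al (Num.min s t).

Definition kl_coef n t := B n t / (lam n * Num.sqrt (Q n)).

Lemma kl_expansion : exists xi : nat -> T -> R,
  [/\ forall n, closed_span P [set M t | t in [set t | 0 <= t]] (xi n),
      forall (s : seq nat) (k : nat -> R), uniq s ->
        nrm2 P (fun w => \sum_(i <- s) k i * xi i w) = c * \sum_(i <- s) k i ^+ 2 &
      forall t N, 0 <= t <= r ->
        nrm2 P (fun w => M t w - \sum_(n < N) kl_coef n t * xi n w) = c * mercer_rem p b r lam t N t].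
Proof.
pose I := {s : R | 0 <= s <= r}.
have I0 (i : I) : 0 <= sval i by case: i => s /= /andP[].
pose MI (i : I) := M (sval i); pose NI (i : I) := step (sval i).
have MIL i : MI i \in Lfun P 2%:E by exact: ML.
have NIL i : NI i \in Lfun leb 2%:E by exact: step_L2.
have MN i j : \int[P]_w (MI i w * MI j w) = c * \int[leb]_x (NI i x * NI j x).
  by rewrite MM// step_gram//; case: i; case: j.
have NIS : range NI = [set step s | s in [set s | 0 <= s <= r]].
  apply/seteqP; split=> [_ [[s sr] _ <-]|_ [s sr <-]]; first by exists s.
  by exists (exist _ s sr).
have modeC n : closed_span leb (range NI) (mode n).
  rewrite NIS.
  have := step_dense (cnnM (@cnn_cst R (Num.sqrt (Q n))^-1) (@ca n)).
  by congr (closed_span _ _ _); apply/funext => x; rewrite /mode !patchE; case: ifP => // _; rewrite mulrA.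
have /choice[xi xiP] : forall n, exists Z, isometric_pair P leb MI NI Z (mode n).
  by move=> n; apply: (isometric_pair_exists MIL NIL c0 MN).
exists xi; split.
- move=> n; have := isometric_pair_span MIL (xiP n).
  have SL g : [set M t | t in [set t | 0 <= t]] g -> g \in Lfun P 2%:E by move=> [t t0 <-]; exact: ML.
  have SL' g : range MI g -> g \in Lfun P 2%:E by move=> [i _ <-].
  move=> /(closed_spanP SL')[xL xA]; apply/(closed_spanP SL); split=> // e /xA[h [m [k [g [gS hE]]]] he].
  exists h => //; exists m, k, g; split=> // i; have [j _ <-] := gS i.
  by exists (sval j) => //; exact: I0.
- move=> s k us.
  have pz : isometric_pair P leb MI NI (fun=> 0) (fun=> 0).
    have sr : 0 <= (0 : R) <= r by rewrite lexx ltW.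
    have i0 := isometric_pair_incl MIL NIL (exist _ 0 sr : I).
    have := isometric_pair_lin MIL NIL (-1) i0 i0.
    by congr isometric_pair; apply/funext => x; rewrite mulN1r subrr.
  have := isometric_pair_norm MIL NIL MN (isometric_pair_sum MIL NIL (fun i : 'I_(size s) => k (nth 0%N s i)) pz
     (fun i => xiP (nth 0%N s i))).
  rewrite (_ : (fun w => 0 + _) = fun w => \sum_(i <- s) k i * xi i w); last first.
    by apply/funext => w; rewrite add0r (big_nth 0%N) big_mkord.
  move=> ->; congr (_ * _).
  under eq_fun do rewrite add0r.
  rewrite nrm2_sum => [|i]; last exact: mode_L2.
  rewrite (big_nth 0%N) big_mkord; apply: eq_bigr => i _.
  rewrite (bigD1 i)//= mode_gram eqxx mulr1 big1 ?addr0 ?expr2// => j ji.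
  by rewrite mode_gram nth_uniq// eq_sym val_eqE (negbTE ji) mulr0.
move=> t N tr; have /andP[t0 _] := tr.
have := isometric_pair_norm MIL NIL MN (isometric_pair_sum MIL NIL (fun i : 'I_N => - kl_coef i t)
   (isometric_pair_incl MIL NIL (exist _ t tr : I)) (fun i => xiP i)).
rewrite (_ : (fun w => _ + _) = fun w => M t w - \sum_(n < N) kl_coef n t * xi n w); last first.
  apply/funext => w; rewrite -sumrN; congr (_ + _); apply: eq_bigr => i _; by rewrite mulNr.
move=> ->; congr (_ * _).
rewrite -(mercer_energyE S r0 lamP lamH lam_ar tr N) [RHS]Rintegral_mkcond.
apply: eq_Rintegral => x _; rewrite /NI /= /step /mode !patchE.
case: ifPn => [xJ|xJ]; last first.
  by rewrite add0r big1 ?expr0n// => i _; rewrite patchE (negbTE xJ) mulr0.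
have x0 : 0 <= x by move: xJ; rewrite mem_setE/= in_itv/= => /andP[].
have := sqp x0; set q := Num.sqrt (p x) => <-; rewrite -exprMn; congr (_ ^+ 2).
rewrite mulrBr mulrC; congr (_ + _); rewrite mulr_sumr -sumrN; apply: eq_bigr => i _.
rewrite patchE xJ /kl_coef /mercer_coef -/q.
have qq : Num.sqrt (Q i) * Num.sqrt (Q i) = Q i by rewrite -expr2 sqr_sqrtr// ltW.
have q0 : Num.sqrt (Q i) != 0 by rewrite gt_eqF// sqrtr_gt0.
have l0 : lam i != 0 by rewrite gt_eqF//; have [] := lamP i.
by move: qq q0; set y := Num.sqrt (Q i) => <- y0; field; rewrite y0 l0.
Qed.

End Expansion.

Section ComplexParts.
Variable R : realType.
Local Notation C := ((R[i])^o).

Lemma cvg_Re (T : Type) (F : set_system T) {FF : Filter F} (f : T -> R[i]) (l : R[i]) :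
  (f : T -> C) @ F --> (l : C) -> (fun t => complex.Re (f t)) @ F --> complex.Re l.
Proof.
move=> /cvgrPdist_lt H; apply/cvgrPdist_lt => e e0.
have : (0 : R[i]) < e%:C%C by rewrite ltcR.
move=> /H; apply: filterS => t ft.
have := le_lt_trans (normc_ge_Re _) ft; rewrite ltcR.
by rewrite raddfB.
Qed.

Lemma normc_ge_Im (z : R[i]) : (`|complex.Im z|)%:C%C <= `|z|.
Proof.
case: z => u v; rewrite normc_def lecR /= -sqrtr_sqr ler_wsqrtr// lerDr.
exact: sqr_ge0.
Qed.

Lemma cvg_Im (T : Type) (F : set_system T) {FF : Filter F} (f : T -> R[i]) (l : R[i]) :
  (f : T -> C) @ F --> (l : C) -> (fun t => complex.Im (f t)) @ F --> complex.Im l.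
Proof.
move=> /cvgrPdist_lt H; apply/cvgrPdist_lt => e e0.
have : (0 : R[i]) < e%:C%C by rewrite ltcR.
move=> /H; apply: filterS => t ft.
have := le_lt_trans (normc_ge_Im _) ft; rewrite ltcR.
by rewrite raddfB.
Qed.

Lemma cvg_real_complex : (fun h : R => h%:C%C : C) @ 0^' --> (0 : C)^'.
Proof.
move=> U [/= e e0 eU].
have [ei er] : complex.Im e = 0 /\ 0 < complex.Re e by move: e0; rewrite ltcE/= => /andP[/eqP-> ->].
exists (complex.Re e) => //= h he h0; apply: eU.
  rewrite /ball/= in he *; rewrite sub0r normrN in he; rewrite sub0r normrN.
  by rewrite normc_def/= expr0n addr0 sqrtr_sqr ltcE/= ei eqxx.
by apply: contra_neq h0 => /(congr1 (@complex.Re R)).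
Qed.

Lemma Re_cderive (f : R[i] -> R[i]) (z : R[i]) : derivable (f : C -> C) z 1 ->
  h^-1 * (complex.Re (f (z + h%:C%C)) - complex.Re (f z)) @[h --> (0 : R)^'] --> complex.Re (cderive f z).
Proof.
move=> df.
have H : (fun h : C => h^-1 *: ((f : C -> C) (h + z) - f z)) @ 0^' --> (cderive f z : C).
  rewrite /cderive /derive1.
  have := df; rewrite /derivable.
  rewrite (_ : (fun h : C => h^-1 *: (((f : C -> C) \o shift z) (h *: 1) - f z)) =
    (fun h : C => h^-1 *: ((f : C -> C) (h + z) - f z))) //.
  by apply/funext => h /=; rewrite [h%:A]mulr1.
have {}H : (fun h : R => (h%:C%C)^-1 * (f (z + h%:C%C) - f z) : C) @ 0^' --> (cderive f z : C).
  have := cvg_comp _ _ cvg_real_complex H.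
  by apply: cvg_trans; apply: near_eq_cvg; near=> h; rewrite /= [h%:C%C + z]addrC.
rewrite (_ : (fun h => _) = fun h : R => complex.Re ((h%:C%C)^-1 * (f (z + h%:C%C) - f z))).
  exact: cvg_Re H.
apply/funext => h; rewrite -(fmorphV (real_complex R)) -raddfB /=.
by case: (f _ - f z) => u v /=; rewrite mul0r subr0.
Unshelve. all: by end_near. Qed.

End ComplexParts.

Section ChainOnRealLine.
Variables (R : realType) (alpha dalpha : R -> R) (A B : R -> R[i] -> R[i]).
Hypothesis H : diagonal_chain alpha dalpha A B.
Implicit Types (x y t u : R).
Local Notation leb := (@lebesgue_measure R).

Lemma continuous_fold (f : R -> R) : {within `[0, +oo[, continuous f} -> continuous (fun t => f `|t|).
Proof.
move=> /subspace_continuousP cf t.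
have : f @ within `[0, +oo[ (nbhs `|t|) --> f `|t|.
  by apply: cf; rewrite /= in_itv/= andbT normr_ge0.
move=> h; apply: (cvg_comp (fun s : R => `|s|) f _ h) => U HU.
have : nbhs t ((fun s : R => `|s|) @^-1` [set s | `[0, +oo[%classic s -> U s]).
  exact: (@norm_continuous _ R t _ HU).
by apply: filterS => s /=; apply; rewrite in_itv/= andbT normr_ge0.
Qed.

Definition density t := dalpha `|t|.
Local Notation p := density.

Lemma density_continuous : continuous p.
Proof. exact: continuous_fold (dalpha_continuous H). Qed.

Lemma density_gt0 t : 0 < p t.
Proof. by apply: (dalpha_gt0 H). Qed.

Let pn0 t : p t != 0. Proof. by rewrite gt_eqF// density_gt0. Qed.
Let cp : cnn p. Proof. exact: cnn_cont density_continuous. Qed.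
Let cVp : cnn (fun t => (p t)^-1). Proof. exact: cnnV. Qed.
Let pE t : 0 <= t -> p t = dalpha t. Proof. by move=> t0; rewrite /p ger0_norm. Qed.

Let part_continuous (F : R -> R[i] -> R[i]) (z : R[i]) :
  {within `[0, +oo[, continuous (fun t => F t z : (R[i])^o)} ->
  cnn (fun t => complex.Re (F `|t| z)) /\ cnn (fun t => complex.Im (F `|t| z)).
Proof.
move=> /subspace_continuousP cF; split; apply: cnn_cont.
  apply: (@continuous_fold (fun t => complex.Re (F t z))).
  by apply/subspace_continuousP => t t0; exact: cvg_Re (cF t t0).
apply: (@continuous_fold (fun t => complex.Im (F t z))).
by apply/subspace_continuousP => t t0; exact: cvg_Im (cF t t0).
Qed.

Let rA x t := complex.Re (A `|t| x%:C%C).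
Let iA x t := complex.Im (A `|t| x%:C%C).
Let rB x t := complex.Re (B `|t| x%:C%C).
Let iB x t := complex.Im (B `|t| x%:C%C).

Let cA x : cnn (rA x) /\ cnn (iA x).
Proof. by apply: part_continuous; have [] := chain_continuous H x%:C%C. Qed.
Let cB x : cnn (rB x) /\ cnn (iB x).
Proof. by apply: part_continuous; have [] := chain_continuous H x%:C%C. Qed.

Definition cos_part x t := 1 - x * prim0y (fun u => rB x u / p u) t.
Definition sin_part x t := x * prim0y (fun u => p u * rA x u) t.
Local Notation a := cos_part.
Local Notation b := sin_part.

Let integral_prim (F : R -> R) (w : R -> R) t : 0 <= t ->
  \int[leb]_(u in `[0, t]) (F u * w u) = prim0y (fun u => F `|u| * w `|u|) t.
Proof.
move=> t0; rewrite prim0yE//; apply: eq_Rintegral => u.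
by rewrite mem_setE/= in_itv/= => /andP[u0 _]; rewrite ger0_norm.
Qed.

Let eqs x t : 0 <= t -> [/\ rA x t = a x t, iA x t = - (x * prim0y (fun u => iB x u / p u) t),
  rB x t = b x t & iB x t = x * prim0y (fun u => p u * iA x u) t].
Proof.
move=> t0; have := chain_eqA H x%:C%C t0; have := chain_eqB H x%:C%C t0.
rewrite /cintegral_density !integral_prim// /rA /iA /rB /iB (ger0_norm t0).
case: (A t x%:C%C) => u v; case: (B t x%:C%C) => u' v' /= [e1 e2] [e3 e4].
move: e1 e2 e3 e4; rewrite !mul0r !subr0 !addr0 sub0r => -> -> e3 e4.
split.
- by rewrite /a -e3; ring.
- by rewrite -e4 opprK.
- by congr (_ * _); apply: prim0y_eq => // s _; exact: mulrC.
- by congr (_ * _); apply: prim0y_eq => // s _; exact: mulrC.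
Qed.

Lemma chain_sturm : sturm p a b.
Proof.
have [cr cr'] : (forall x, cnn (rA x)) /\ (forall x, cnn (rB x)) by split=> x; [have [] := cA x|have [] := cB x].
split=> //.
- by move=> t _; exact: density_gt0.
- move=> x t t0.
  have d := prim0y_derive (cnnM (cr' x) cVp) t0.
  by apply: (drvE (drvB (drv_cst 1 t) (drvZ x d))); have [_ _ -> _] := eqs x t0; ring.
- move=> x t t0.
  have d := prim0y_derive (cnnM cp (cr x)) t0.
  by apply: (drvE (drvZ x d)); have [-> _ _ _] := eqs x t0.
- by move=> x; rewrite /a prim0y0 mulr0 subr0.
- by move=> x; rewrite /b prim0y0 mulr0.
Qed.

Let im0 x t : 0 <= t -> iA x t = 0 /\ iB x t = 0.
Proof.
move=> t0; have [_ ciA] := cA x; have [_ ciB] := cB x.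
pose v s := - (x * prim0y (fun u => iB x u / p u) s).
pose w s := x * prim0y (fun u => p u * iA x u) s.
have dv (s : R) : 0 <= s -> is_derive s 1 v (- (x * (w s / p s))).
  move=> s0; have d := prim0y_derive (cnnM ciB cVp) s0.
  by apply: (drvE (drvN (drvZ x d))); have [_ _ _ ->] := eqs x s0.
have dw (s : R) : 0 <= s -> is_derive s 1 w (x * (p s * v s)).
  move=> s0; have d := prim0y_derive (cnnM cp ciA) s0.
  by apply: (drvE (drvZ x d)); have [_ -> _ _] := eqs x s0.
pose e (s : R) := v s ^+ 2 + w s ^+ 2.
have de (s : R) : 0 <= s -> is_derive s 1 e (2 * v s * (- (x * (w s / p s))) + 2 * w s * (x * (p s * v s))).
  by move=> s0; exact: (drvD (drvX2 (dv s s0)) (drvX2 (dw s s0))).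
have ck : cnn (fun s => `|x| * (p s + (p s)^-1)) by apply: cnnM; [exact: cnn_cst|exact: cnnD].
have [_ iAE _ iBE] := eqs x t0.
have e0 : e t <= 0.
  apply: le_trans (gronwall ck (@cnn_cst R 0) _ _ de _ t0) _ => //.
  - by move=> s _; rewrite mulr_ge0// addr_ge0 ?invr_ge0 ?(ltW (density_gt0 _)).
  - move=> s s0; rewrite addr0.
    have -> : 2 * v s * (- (x * (w s / p s))) + 2 * w s * (x * (p s * v s)) =
      (x * (2 * v s * w s)) * (p s - (p s)^-1) by ring.
    apply: le_trans (ler_norm _) _; rewrite (normrM (x * _)) (normrM x) -[leLHS]mulrA -[leRHS]mulrA.
    apply: ler_wpM2l => //; rewrite [leRHS]mulrC; apply: ler_pM => //.
      have := sqr_ge0 (v s - w s); have := sqr_ge0 (v s + w s); rewrite sqrrB sqrrD /e => h1 h2.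
      by rewrite ler_norml; apply/andP; split; lra.
    apply: le_trans (ler_normB _ _) _.
    by rewrite !ger0_norm// ?invr_ge0; exact: ltW (density_gt0 _).
  - rewrite /e /v /w !prim0y0 !mulr0 oppr0 expr0n addr0 add0r.
    rewrite [prim0y _ t](_ : _ = 0) ?mul0r//.
    transitivity (prim0y (fun _ : R => 0 * 0 : R) t); first by apply: prim0y_eq => // s _; rewrite mul0r.
    by rewrite (prim0yZ 0 t0 (@cnn_cst R 0)) mul0r.
have := sqr_ge0 (v t); have := sqr_ge0 (w t); rewrite /e in e0 => w2 v2.
have v0 : v t ^+ 2 = 0 by apply/eqP; rewrite eq_le v2 andbT; lra.
have w0 : w t ^+ 2 = 0 by apply/eqP; rewrite eq_le w2 andbT; lra.
rewrite iAE iBE; split; [move/eqP : v0|move/eqP : w0]; by rewrite sqrf_eq0 => /eqP.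
Qed.

Lemma chain_realA x t : 0 <= t -> A t x%:C%C = (a x t)%:C%C.
Proof.
move=> t0; have [i0 _] := im0 x t0; have [e _ _ _] := eqs x t0.
by rewrite -e; move: i0; rewrite /iA /rA ger0_norm//; case: (A t _) => u v /= ->.
Qed.

Lemma chain_realB x t : 0 <= t -> B t x%:C%C = (b x t)%:C%C.
Proof.
move=> t0; have [_ i0] := im0 x t0; have [_ _ e _] := eqs x t0.
by rewrite -e; move: i0; rewrite /iB /rB ger0_norm//; case: (B t _) => u v /= ->.
Qed.

Lemma alphaE t : 0 <= t -> alpha t = prim0y p t.
Proof.
move=> t0; pose D s := alpha s - prim0y p s.
have D0 : D 0 = 0 by rewrite /D (alpha_0 H) prim0y0 subr0.
suff Dt : D t = 0 by apply/eqP; rewrite -subr_eq0; apply/eqP.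
move: t0; rewrite le_eqVlt => /orP[/eqP<-//|t0].
have cst s : 0 < s -> D s = D t.
  have key u v : 0 < u -> u <= v -> D u = D v.
    move=> u0 uv; apply: (drv0_cst uv) => w /andP[uw _].
    have w0 : 0 < w := lt_le_trans u0 uw.
    have d1 := alpha_derive H w0; have d2 := prim0y_derive cp (ltW w0).
    by apply: (drvE (drvB d1 d2)); rewrite pE ?subrr// ltW.
  by move=> s0; have [st|ts] := leP s t; [exact: key|apply/esym; apply: key => //; exact: ltW].
have la : alpha h @[h --> 0^'+] --> 0.
  have c := alpha_derive_0 H.
  have : h * (h^-1 * (alpha h - alpha 0)) @[h --> 0^'+] --> 0 * dalpha 0.
    apply: cvgM c; apply: cvg_at_right_filter; exact: cvg_id.
  rewrite mul0r; apply: cvg_trans; apply: near_eq_cvg; near=> h.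
  by rewrite mulVKf ?(alpha_0 H) ?subr0// gt_eqF.
have lp : prim0y p h @[h --> 0^'+] --> 0.
  by rewrite -[X in _ --> X](prim0y0 p); apply: cvg_at_right_filter; exact: (cnn_prim0y cp (lexx 0)).
have lD : D h @[h --> 0^'+] --> 0 by rewrite -[X in _ --> X](subr0 0); exact: cvgB la lp.
apply: (cvg_unique _ _ lD) => //; apply: cvg_near_cst; near=> h.
by apply/eqP; rewrite cst.
Unshelve. all: by end_near. Qed.

End ChainOnRealLine.

Section DiagonalKernel.
Variables (R : realType) (p : R -> R) (a b : R -> R -> R).
Hypothesis S : sturm p a b.
Implicit Types (x y t : R).

Let p0 t : 0 <= t -> 0 < p t. Proof. exact: (sturm_gt0 S). Qed.
Let cp : cnn p := sturm_cont S.
Let ca x : cnn (a x). Proof. exact: (@sturm_ca _ _ _ _ S x). Qed.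
Let cb x : cnn (b x). Proof. exact: (@sturm_cb _ _ _ _ S x). Qed.
Let cVp : cnn (fun t => (p t)^-1). Proof. exact: (@sturm_cVp _ _ _ _ S). Qed.

Definition gram_density x y t := p t * (a x t * a y t) + b x t * b y t / p t.

Let cg x y : cnn (gram_density x y).
Proof. by apply: cnnD; apply: cnnM => //; exact: cnnM. Qed.

Lemma sturm_wronskian x y t : 0 <= t ->
  a x t * b y t - b x t * a y t = (y - x) * prim0y (gram_density x y) t.
Proof.
move=> t0; rewrite -prim0yZ//.
rewrite (prim0y_unique (F := fun t => a x t * b y t - b x t * a y t) _ _ t0).
- by rewrite !(sturm_b0 S) mul0r mulr0 !subr0.
- by apply: cnnM => //; exact: cnn_cst.
move=> u u0; have dax := sturm_da S x u0; have day := sturm_da S y u0.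
have dbx := sturm_db S x u0; have dby := sturm_db S y u0.
apply: (drvE (drvB (drvM dax dby) (drvM dbx day))).
by rewrite /gram_density; field; rewrite gt_eqF// p0.
Qed.

Lemma sturm_gram_lip x r : 0 <= r -> exists2 K, 0 <= K & forall y, `|y - x| <= 1 ->
  `|prim0y (gram_density x y) r - prim0y (gram_density x x) r| <= K * `|y - x|.
Proof.
move=> r0; pose q t := p t + (p t)^-1.
have q0 t : 0 <= t -> 0 < q t by move=> t0; rewrite addr_gt0 ?invr_gt0 ?p0.
have cq : cnn q by exact: cnnD.
pose f t := (p t * a x t) ^+ 2 + (b x t / p t) ^+ 2.
have cf : cnn f by apply: cnnD; apply: cnnX2; exact: cnnM.
have f0 t : 0 <= f t by rewrite addr_ge0 ?sqr_ge0.
pose kk t := (`|x| + 1) * q t + 1.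
have ck : cnn kk by apply: cnnD; [apply: cnnM => //|]; exact: cnn_cst.
have kk0 t : 0 <= t -> 0 <= kk t.
  by move=> t0; apply: addr_ge0 => //; apply: mulr_ge0; [exact: addr_ge0|exact: ltW (q0 t t0)].
pose L := prim0y f r * expR (prim0y kk r).
have F0 : 0 <= prim0y f r by exact: prim0y_ge0.
have L0 : 0 <= L by rewrite mulr_ge0// expR_ge0.
pose K := prim0y (gram_density x x) r + L * prim0y q r.
have G0 : 0 <= prim0y (gram_density x x) r.
  apply: prim0y_ge0 => // u /andP[u0 _]; rewrite /gram_density -!expr2.
  by apply: addr_ge0; rewrite mulr_ge0 ?sqr_ge0 ?invr_ge0// ltW// p0.
have Q0 : 0 <= prim0y q r by apply: prim0y_ge0 => // u /andP[u0 _]; exact: ltW (q0 _ u0).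
have K0 : 0 <= K by rewrite addr_ge0// mulr_ge0.
exists K => // y; set h := y - x => h1.
have yx : y = x + h by rewrite /h; ring.
have y1 : `|y| <= `|x| + 1 by rewrite yx; apply: le_trans (ler_normD _ _) _; rewrite lerD2l.
pose u t := a y t - a x t; pose v t := b y t - b x t.
pose e t := u t ^+ 2 + v t ^+ 2.
have cu : cnn u by exact: cnnB.
have cv : cnn v by exact: cnnB.
have eL t : 0 <= t <= r -> e t <= h ^+ 2 * L.
  move=> /andP[t0 tr].
  have de (s : R) : 0 <= s -> is_derive s 1 e
     (2 * u s * (- (y * b y s / p s) - - (x * b x s / p s)) + 2 * v s * (y * (p s * a y s) - x * (p s * a x s))).
    move=> s0; have du := drvB (sturm_da S y s0) (sturm_da S x s0).
    have dv := drvB (sturm_db S y s0) (sturm_db S x s0).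
    exact: (drvD (drvX2 du) (drvX2 dv)).
  have cw : cnn (fun t => h ^+ 2 * f t) by apply: cnnM => //; exact: cnn_cst.
  apply: le_trans (gronwall ck cw _ _ de _ t0) _.
  - exact: kk0.
  - by move=> s s0; rewrite mulr_ge0 ?sqr_ge0.
  - move=> s s0; have ps := p0 s0; have pn : p s != 0 by rewrite gt_eqF.
    have -> : 2 * u s * (- (y * b y s / p s) - - (x * b x s / p s)) + 2 * v s * (y * (p s * a y s) - x * (p s * a x s))
       = (y * (2 * u s * v s)) * (p s - (p s)^-1) + (2 * (v s * (h * (p s * a x s))) - 2 * (u s * (h * (b x s / p s)))).
      by rewrite /u /v /h; field.
    have b1 : (y * (2 * u s * v s)) * (p s - (p s)^-1) <= (`|x| + 1) * q s * e s.
      apply: le_trans (ler_norm _) _; rewrite (normrM (y * _)) (normrM y) -[leLHS]mulrA -[leRHS]mulrA.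
      apply: ler_pM => //; rewrite ?mulr_ge0// [leRHS]mulrC; apply: ler_pM => //.
        have := sqr_ge0 (u s - v s); have := sqr_ge0 (u s + v s); rewrite sqrrB sqrrD /e => g1 g2.
        by rewrite ler_norml; apply/andP; split; lra.
      apply: le_trans (ler_normB _ _) _.
      by rewrite !ger0_norm// ?invr_ge0; exact: ltW.
    have := sqr_ge0 (v s - h * (p s * a x s)); have := sqr_ge0 (u s + h * (b x s / p s)).
    rewrite sqrrB sqrrD !(exprMn _ h).
    have eE : e s = u s ^+ 2 + v s ^+ 2 by [].
    have kE : kk s * e s = (`|x| + 1) * q s * e s + e s by rewrite mulrDl mul1r.
    by rewrite kE /f; move: b1 eE; set E := e s; set k1 := _ * E; lra.
  have e0 : e 0 = 0 by rewrite /e /u /v !(sturm_a0 S) !(sturm_b0 S) !subrr expr0n addr0.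
  rewrite e0 add0r prim0yZ// /L mulrA; apply: ler_pM; rewrite ?expR_ge0//.
  - by rewrite mulr_ge0 ?sqr_ge0//; exact: prim0y_ge0.
  - rewrite ler_wpM2l ?sqr_ge0//.
    by apply: (ndecr_drv (df := f)) tr _ _ => s /andP[ts _]; [apply: prim0y_derive => //; exact: le_trans ts|].
  rewrite ler_expR; apply: (ndecr_drv (df := kk)) tr _ _ => s /andP[ts _].
    by apply: prim0y_derive => //; exact: le_trans ts.
  by apply: kk0; exact: le_trans ts.
have [h0|hn0] := eqVneq h 0.
  by have -> : y = x; [rewrite yx h0 addr0|rewrite subrr normr0 mulr_ge0].
set dl := `|h|; have dl0 : 0 < dl by rewrite normr_gt0.
pose w t := dl * (gram_density x x t + L * q t).
have cw : cnn w by apply: cnnM; [exact: cnn_cst|apply: cnnD => //; apply: cnnM => //; exact: cnn_cst].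
have wE : prim0y w r = dl * K.
  have cLq : cnn (fun t => L * q t) by apply: cnnM => //; exact: cnn_cst.
  rewrite prim0yZ//; last exact: cnnD.
  by rewrite prim0yD// prim0yZ.
have pw t : 0 <= t <= r -> `|gram_density x y t - gram_density x x t| <= w t.
  move=> tr; have /andP[t0 _] := tr; have pt := p0 t0; have pn : p t != 0 by rewrite gt_eqF.
  have -> : gram_density x y t - gram_density x x t = p t * (a x t * u t) + (b x t * v t) / p t.
    by rewrite /gram_density /u /v; field.
  have et := eL t tr.
  have e1 : dl^-1 * (q t * e t) <= dl * (L * q t).
    have : dl^-1 * (q t * e t) <= dl^-1 * (q t * (h ^+ 2 * L)).
      by apply: ler_wpM2l; [rewrite invr_ge0 ltW|apply: ler_wpM2l => //; exact: ltW (q0 t t0)].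
    move=> h2; apply: le_trans h2 _; rewrite -(real_normK (num_real h)) -/dl.
    by rewrite le_eqVlt; apply/orP; left; apply/eqP; field; rewrite gt_eqF.
  have am (m z z' : R) : 0 <= m -> `|m * (z * z')| <= dl * (m * z ^+ 2) + dl^-1 * (m * z' ^+ 2).
    move=> m0; rewrite normrM (ger0_norm m0).
    have -> : dl * (m * z ^+ 2) + dl^-1 * (m * z' ^+ 2) = m * (dl * z ^+ 2 + dl^-1 * z' ^+ 2) by ring.
    apply: ler_wpM2l => //.
    have g1 : 0 <= dl * (z - dl^-1 * z') ^+ 2 by apply: mulr_ge0; [exact: ltW|exact: sqr_ge0].
    have g2 : 0 <= dl * (z + dl^-1 * z') ^+ 2 by apply: mulr_ge0; [exact: ltW|exact: sqr_ge0].
    have g3 : dl * (z - dl^-1 * z') ^+ 2 = dl * z ^+ 2 + dl^-1 * z' ^+ 2 - 2 * (z * z').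
      by field; rewrite gt_eqF.
    have g4 : dl * (z + dl^-1 * z') ^+ 2 = dl * z ^+ 2 + dl^-1 * z' ^+ 2 + 2 * (z * z').
      by field; rewrite gt_eqF.
    have g5 : 0 <= dl * z ^+ 2 + dl^-1 * z' ^+ 2.
      by apply: addr_ge0; apply: mulr_ge0; rewrite ?sqr_ge0 ?invr_ge0 ?ltW.
    by rewrite ler_norml; apply/andP; split; lra.
  have m1 := am (p t) (a x t) (u t) (ltW pt).
  have m2 := am (p t)^-1 (b x t) (v t) (_ : 0 <= (p t)^-1).
  rewrite [b x t * v t / p t]mulrC; apply: le_trans (ler_normD _ _) _.
  apply: le_trans (lerD m1 (m2 _)) _; first by rewrite invr_ge0 ltW.
  have e2 : dl^-1 * (p t * u t ^+ 2) + dl^-1 * ((p t)^-1 * v t ^+ 2) <= dl^-1 * (q t * e t).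
    rewrite -mulrDr; apply: ler_wpM2l; first by rewrite invr_ge0 ltW.
    have : 0 <= p t * v t ^+ 2 by rewrite mulr_ge0 ?sqr_ge0// ltW.
    have : 0 <= (p t)^-1 * u t ^+ 2 by rewrite mulr_ge0 ?sqr_ge0 ?invr_ge0// ltW.
    by rewrite /q /e mulrDl !mulrDr; lra.
  have -> : w t = (dl * (p t * a x t ^+ 2) + dl * ((p t)^-1 * b x t ^+ 2)) + dl * (L * q t).
    by rewrite /w /gram_density; ring.
  lra.
rewrite [leRHS]mulrC -wE ler_norml; apply/andP; split.
  have : prim0y (gram_density x x) r <= prim0y (fun t => gram_density x y t + w t) r.
    apply: prim0y_le => //; first exact: cnnD.
    by move=> t tr; have := pw t tr; rewrite ler_norml => /andP[]; lra.
  by rewrite (prim0yD r0 (@cg x y) cw) lerNl opprB lerBlDl.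
have : prim0y (gram_density x y) r <= prim0y (fun t => gram_density x x t + w t) r.
  apply: prim0y_le => //; first exact: cnnD.
  by move=> t tr; have := pw t tr; rewrite ler_norml => /andP[]; lra.
by rewrite (prim0yD r0 (@cg x x) cw) lerBlDl.
Qed.

Lemma sturm_cos_derive x r : 0 <= r -> a x r = 0 ->
  - b x r * (h^-1 * (a (x + h) r - a x r)) @[h --> (0 : R)^'] --> prim0y (gram_density x x) r.
Proof.
move=> r0 ar0; have [K K0 HK] := sturm_gram_lip x r0.
apply/cvgrPdist_lt => e e0; near=> h.
have hn0 : h != 0 by near: h; exact: nbhs_dnbhs_neq.
have h1 : `|h| <= 1.
  near: h; apply: nbhs_dnbhs; exists 1 => //= h /=.
  by rewrite sub0r normrN => /ltW.
have h2 : `|h| < e / (K + 1).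
  near: h; apply: nbhs_dnbhs; exists (e / (K + 1)); rewrite /= ?divr_gt0 ?ltr_wpDl// => h /=.
  by rewrite sub0r normrN.
have := sturm_wronskian x (x + h) r0; rewrite ar0 mul0r sub0r addrAC subrr add0r => W.
have -> : - b x r * (h^-1 * (a (x + h) r - 0)) = prim0y (gram_density x (x + h)) r.
  by rewrite subr0 mulrCA mulNr W mulKf.
rewrite distrC; apply: le_lt_trans (HK _ _) _; first by rewrite addrAC subrr add0r.
rewrite addrAC subrr add0r; move: h2; rewrite ltr_pdivlMr ?ltr_wpDl// => h2.
by apply: le_lt_trans h2; rewrite mulrC ler_wpM2l// lerDl.
Unshelve. all: by end_near. Qed.

End DiagonalKernel.

Section ChainKernel.
Variables (R : realType) (alpha dalpha : R -> R) (A B : R -> R[i] -> R[i]).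
Hypothesis H : diagonal_chain alpha dalpha A B.
Local Notation p := (density dalpha).
Local Notation a := (cos_part dalpha B).
Local Notation b := (sin_part dalpha A).

Lemma kernel_diagonal (r x : R) : 0 <= r -> a x r = 0 ->
  complex.Re (deBranges_kernel A B r x%:C%C x%:C%C) = prim0y (gram_density p a b x x) r / pi.
Proof.
move=> r0 ar0; have S := chain_sturm H.
have dA := (chain_entire H r0).1 x%:C%C.
have c1 := Re_cderive dA.
have c2 := sturm_cos_derive S r0 ar0.
have {}c1 : - b x r * (h^-1 * (a (x + h) r - a x r)) @[h --> (0 : R)^'] -->
    - b x r * complex.Re (cderive (A r) x%:C%C).
  apply: cvgM; first exact: cvg_cst.
  apply: cvg_trans c1; apply: near_eq_cvg; near=> h.
  by rewrite -raddfD/= !(chain_realA H).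
have e := cvg_unique _ c1 c2.
rewrite /deBranges_kernel.
have -> : conjc x%:C%C = x%:C%C by rewrite /= oppr0.
rewrite eqxx (chain_realA H)// (chain_realB H)// ar0 mul0r sub0r.
rewrite -(fmorphV (real_complex R)) -e.
by case: (cderive _ _) => u v /=; ring.
Unshelve. all: by end_near. Qed.

End ChainKernel.

Section Moments.
Context d (T : measurableType d) (R : realType) (P : probability T R).
Local Notation L2 := (Lfun P 2%:E).

Lemma expectationE (f : T -> R) : P.-integrable setT (EFin \o f) -> ('E_P[f] = (\int[P]_w f w)%:E)%E.
Proof. by move=> fi; rewrite unlock /Rintegral fineK// integrable_fin_num. Qed.

Lemma expectation_sqr (f : T -> R) : f \in L2 -> ('E_P[fun w => (f w ^+ 2)%R] = (nrm2 P f)%:E)%E.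
Proof. by move=> fL; rewrite expectationE//; exact: L2_sqr. Qed.

Lemma nrm2_lin (a b : R) (f g : T -> R) : f \in L2 -> g \in L2 ->
  nrm2 P (fun w => a * f w + b * g w) =
  a ^+ 2 * nrm2 P f + 2 * a * b * \int[P]_w (f w * g w) + b ^+ 2 * nrm2 P g.
Proof.
move=> fL gL; pose k (i : 'I_2) := if val i == 0%N then a else b.
pose F (i : 'I_2) := if val i == 0%N then f else g.
have FL i : F i \in L2 by rewrite /F; case: ifP.
transitivity (nrm2 P (fun w => \sum_(i < 2) k i * F i w)).
  by congr nrm2; apply/funext => w; rewrite big_ord_recr/= big_ord1.
rewrite nrm2_sum// big_ord_recr/= big_ord1 !(big_ord_recr 1)/= !big_ord1 /k /F/=.
have -> : \int[P]_w (g w * f w) = \int[P]_w (f w * g w).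
  by apply: eq_Rintegral => w _; rewrite mulrC.
have sq (h : T -> R) : \int[P]_w (h w * h w) = nrm2 P h.
  by apply: eq_Rintegral => w _; rewrite expr2.
by rewrite !sq; ring.
Qed.

End Moments.

Lemma orthonormal_basis_ext (R : realType) (r : R) (phi psi : nat -> R -> R) :
  (forall n t, 0 <= t <= r -> psi n t = phi n t) -> orthonormal_basis r phi -> orthonormal_basis r psi.
Proof.
move=> pp [h1 h2 h3].
have rE n : (psi n \_ `[0, r]%classic : measurableTypeR R -> R) = phi n \_ `[0, r]%classic.
  by apply/funext => x; rewrite !patchE mem_setE/= in_itv/=; case: ifP => // xr; rewrite pp.
split.
- by move=> n; rewrite rE; exact: h1.
- move=> m n; rewrite -h2; apply: eq_Rintegral => t; rewrite mem_setE/= in_itv/= => tr.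
  by rewrite !pp.
move=> f fL; have := h3 f fL; congr (closed_span _ _ _).
by apply/seteqP; split=> g [n _ <-]; exists n; rewrite ?rE.
Qed.

Section KarhunenLoeveExpansion.
Variables (R : realType) (p : R -> R) (a b : R -> R -> R).
Hypothesis S : sturm p a b.
Variables (r : R) (lam : nat -> R).
Hypothesis r0 : 0 < r.
Hypothesis lamP : forall n, 0 < lam n /\ pruefer_angle p a b (lam n) r = pi / 2 + n%:R * pi.
Hypothesis lamH : {homo lam : m n / (m < n)%N >-> m < n}.
Hypothesis lam_ar : forall n, a (lam n) r = 0.
Hypothesis lam_large : forall n, pi * n%:R <= lam n * prim0y (sturm_bound p) r.
Implicit Types (s t : R) (n : nat).
Local Notation leb := (@lebesgue_measure R).
Local Notation Q := (sturm_norm p b r lam).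
Local Notation B n := (b (lam n)).
Local Notation al := (prim0y p).

Context d (T : measurableType d) (P : probability T R).
Variables (M : R -> T -> R) (c : R).
Hypothesis c0 : 0 < c.
Hypothesis ML : forall t, 0 <= t -> M t \in Lfun P 2%:E.
Hypothesis MM : forall s t, 0 <= s -> 0 <= t -> \int[P]_w (M s w * M t w) = c * al (Num.min s t).
Hypothesis M_gauss : forall Z, closed_span P [set M t | t in [set t | 0 <= t]] Z -> centred_normal P Z.
Variable xi : nat -> {RV P >-> R}.
Hypothesis xi_span : forall n, closed_span P [set M t | t in [set t | 0 <= t]] (xi n).
Hypothesis xi_norm : forall (s : seq nat) (k : nat -> R), uniq s ->
  nrm2 P (fun w => \sum_(i <- s) k i * xi i w) = c * \sum_(i <- s) k i ^+ 2.
Hypothesis xi_err : forall t N, 0 <= t <= r ->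
  nrm2 P (fun w => M t w - \sum_(n < N) kl_coef p b r lam n t * xi n w) = c * mercer_rem p b r lam t N t.

Let p0 t : 0 <= t -> 0 < p t. Proof. exact: (sturm_gt0 S). Qed.
Let cp : cnn p := sturm_cont S.
Let Q0 n : 0 < Q n. Proof. exact: (sturm_norm_gt0 S r0 lamP). Qed.
Let xiL n : (xi n : T -> R) \in Lfun P 2%:E. Proof. by have [] := M_gauss (xi_span n). Qed.
Let SL g : [set M t | t in [set t | 0 <= t]] g -> g \in Lfun P 2%:E.
Proof. by move=> [t t0 <-]; exact: ML. Qed.

Lemma kl_comb_normal (s : seq nat) (k : nat -> R) :
  centred_normal P (fun w => \sum_(i <- s) k i * xi i w).
Proof.
apply: M_gauss; apply: (closed_span_sum SL); first exact: closed_span0 (xi_span 0%N).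
by move=> i; exact: closed_spanZ.
Qed.

Lemma kl_independent : mutually_independent xi.
Proof.
apply: (@independent_of_cos _ _ _ _ _ c) => s k phi us.
have [_ _ /(_ 1 phi)] := kl_comb_normal s k.
rewrite xi_norm// expr1n mul1r => <-; apply: eq_Rintegral => w _.
by rewrite mul1r.
Qed.

Lemma kl_xi_norm n : nrm2 P (xi n) = c.
Proof.
have := xi_norm (fun=> 1) (isT : uniq [:: n]); rewrite big_seq1 expr1n mulr1 => <-.
by congr nrm2; apply/funext => w; rewrite big_seq1 mul1r.
Qed.

Lemma kl_law n : has_gaussian_law P (xi n) 0 (Num.sqrt c).
Proof.
apply: centred_normal_law; first exact: M_gauss (xi_span n).
  by rewrite gt_eqF// sqrtr_gt0.
by rewrite kl_xi_norm sqr_sqrtr// ltW.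
Qed.

Lemma kl_xi_gram m n : \int[P]_w (xi m w * xi n w) = c * (m == n)%:R.
Proof.
case: eqP => [->|/eqP mn].
  by rewrite mulr1 -(kl_xi_norm n); apply: eq_Rintegral => w _; rewrite expr2.
have u : uniq [:: m; n] by rewrite /= inE mn.
have := xi_norm (fun=> 1) u; rewrite big_cons big_seq1 expr1n.
under [X in nrm2 _ X]eq_fun do rewrite big_cons big_seq1.
by rewrite nrm2_lin// !kl_xi_norm !expr1n mulr0; lra.
Qed.

Variable Y : R -> T -> R.
Hypothesis YE : forall t, 0 <= t <= r -> Y t = (fun w => (Num.sqrt (p t))^-1 * M t w).

Let YL t : 0 <= t <= r -> Y t \in Lfun P 2%:E.
Proof. by move=> tr; have /andP[t0 _] := tr; rewrite YE//; apply: L2Z; exact: ML. Qed.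

Let isq t := (Num.sqrt (p t))^-1.
Let isq2 t : 0 <= t -> isq t ^+ 2 = (p t)^-1.
Proof. by move=> t0; rewrite /isq exprVn sqr_sqrtr// ltW// p0. Qed.
Let cisq : cnn isq.
Proof.
apply: cnnV; first by move=> t t0; rewrite gt_eqF// sqrtr_gt0 p0.
by apply: cnn_comp => //; exact: sqrt_continuous.
Qed.

Lemma kl_uniform (omega : nat -> R) (phi : nat -> R -> R) (zeta : nat -> T -> R) :
  (forall n t w, 0 <= t <= r -> omega n * phi n t * zeta n w =
    (lam n)^-1 * eigenfun p b r lam n t * xi n w) ->
  ms_uniform_series P r Y omega phi zeta.
Proof.
move=> E e e0; have [C C0 pC] := sturm_bounded S r0.
have [N HN] := eigen_unbounded S r0 lamP lam_large (2 * c * C ^+ 2 / e).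
exists N => // m /= Nm t tr; have /andP[t0 _] := tr; have [pC1 pC2] := pC t tr.
have lm : 2 * c * C ^+ 2 / e < lam m.
  apply: lt_le_trans HN _; move: Nm; rewrite leq_eqVlt => /orP[/eqP->//|].
  by move=> /lamH /ltW.
have -> : (fun w => (Y t w - \sum_(n < m) omega n * phi n t * zeta n w) ^+ 2) =
    (fun w => (isq t * (M t w - \sum_(n < m) kl_coef p b r lam n t * xi n w)) ^+ 2).
  apply/funext => w; rewrite YE// mulrBr; congr ((_ - _) ^+ 2).
  rewrite mulr_sumr; apply: eq_bigr => i _; rewrite E// /eigenfun /kl_coef /isq invfM.
  by ring.
have EL : (fun w => M t w - \sum_(n < m) kl_coef p b r lam n t * xi n w) \in Lfun P 2%:E.
  by apply: L2B; [exact: ML|apply: L2_sum => i; exact: L2Z].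
rewrite expectation_sqr; last exact: L2Z.
rewrite nrm2Z// xi_err// isq2// lte_fin.
have U := mercer_rem_le S r0 lamP lamH lam_ar tr m (fun t tr => proj1 (pC t tr)).
have U0 := mercer_rem_ge0 S r0 lamP lamH lam_ar tr m.
have l0 : 0 < lam m by have [] := lamP m.
apply: (@le_lt_trans _ _ (C * (c * (2 * C / lam m)))).
  apply: ler_pM => //; first by rewrite invr_ge0 ltW// p0.
    by rewrite mulr_ge0// ltW.
  by rewrite ler_wpM2l// ltW.
rewrite (_ : C * _ = 2 * c * C ^+ 2 / lam m); last by field; rewrite gt_eqF.
by rewrite ltr_pdivrMr// [ltRHS]mulrC -ltr_pdivrMr.
Qed.

Let EM s t : 0 <= s <= r -> 0 <= t <= r ->
  \int[P]_w (Y s w * Y t w) = isq s * isq t * (c * al (Num.min s t)).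
Proof.
move=> sr tr; have /andP[s0 _] := sr; have /andP[t0 _] := tr.
rewrite -MM// -(RintegralZl _ measurableT (L2M (ML s0) (ML t0))).
by apply: eq_Rintegral => w _; rewrite !YE// /isq; ring.
Qed.

Let Ymean t : 0 <= t <= r -> ('E_P[Y t] = 0)%E.
Proof.
move=> tr; have /andP[t0 _] := tr; rewrite expectationE; last exact: L2_integrable (YL tr).
rewrite YE// (RintegralZl _ measurableT (L2_integrable (ML t0))).
have [_ -> _] : centred_normal P (M t).
  by apply: M_gauss; apply: (closed_span_incl SL); exists t.
by rewrite mulr0.
Qed.

Lemma kl_covariance s t : 0 <= s <= r -> 0 <= t <= r ->
  fine (covariance P (Y s) (Y t)) = isq s * isq t * (c * al (Num.min s t)).
Proof.
move=> sr tr; rewrite unlock !Ymean//= -EM//.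
have -> : ((Y s \- cst 0) * (Y t \- cst 0))%R = (fun w => Y s w * Y t w).
  by apply/funext => w; rewrite /GRing.mul/= !subr0.
by rewrite expectationE//; exact: L2M (YL sr) (YL tr).
Qed.

Lemma kl_karhunen_loeve (phi : nat -> R -> R) :
  (forall n t, 0 <= t <= r -> phi n t = eigenfun p b r lam n t) ->
  karhunen_loeve P r Y (fun n => Num.sqrt c / lam n) phi (fun n w => xi n w / Num.sqrt c).
Proof.
move=> phiE; have sc0 : Num.sqrt c != 0 by rewrite gt_eqF// sqrtr_gt0.
have scc : Num.sqrt c * Num.sqrt c = c by rewrite -expr2 sqr_sqrtr// ltW.
have zE n : (fun w => xi n w / Num.sqrt c) = (fun w => (Num.sqrt c)^-1 * xi n w).
  by apply/funext => w; rewrite mulrC.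
split.
- exact: YL.
- move=> t tr; have /andP[t0 _] := tr.
  pose f s := isq s ^+ 2 * (c * al s) - 2 * (isq s * isq t * (c * al (Num.min t s))) + isq t ^+ 2 * (c * al t).
  have cal : cnn al by exact: cnn_prim0y.
  have cf : cnn f.
    have cc (k : R) : cnn (fun=> k) by exact: cnn_cst.
    apply: cnnD => //; apply: cnnB; first by apply: cnnM; [exact: cnnX2|exact: cnnM].
    apply: cnnM => //; apply: cnnM; first exact: cnnM.
    by apply: cnnM => //; exact: cnn_min.
  have ft : f t = 0 by rewrite /f minxx; ring.
  have fE s : 0 <= s <= r -> ('E_P[fun w => ((Y s w - Y t w) ^+ 2)%R] = (f s)%:E)%E.
    move=> sr; have /andP[s0 _] := sr.
    rewrite expectation_sqr; last exact: (L2B (YL sr) (YL tr)).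
    have -> : (fun w => Y s w - Y t w) = (fun w => 1 * Y s w + (-1) * Y t w).
      by apply/funext => w; rewrite mul1r mulN1r.
    have sq u : 0 <= u <= r -> nrm2 P (Y u) = isq u * isq u * (c * al (Num.min u u)).
      by move=> ur; rewrite -EM//; apply: eq_Rintegral => w _; rewrite expr2.
    by rewrite nrm2_lin ?YL// !sq// EM// !minxx (minC s) /f; congr (_%:E); ring.
  have lf : f s @[s --> within `[0, r] (nbhs t)] --> 0.
    by rewrite -[X in _ --> X]ft; apply: cvg_within_filter; exact: cf.
  have lE : (f s)%:E @[s --> within `[0, r] (nbhs t)] --> 0%E by apply: cvg_EFin lf; exact: nearW.
  apply: cvg_trans lE; apply: near_eq_cvg; rewrite near_withinE; apply: nearW => s.
  by rewrite /= in_itv/= => sr; rewrite fE.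
- by move=> n; rewrite zE; exact: L2Z.
- move=> n; rewrite zE expectationE; last exact: L2_integrable (L2Z _ (xiL n)).
  rewrite (RintegralZl _ measurableT (L2_integrable (xiL n))).
  by have [_ -> _] := M_gauss (xi_span n); rewrite mulr0.
- move=> m n; rewrite expectationE; last first.
    have := L2M (L2Z (Num.sqrt c)^-1 (xiL m)) (L2Z (Num.sqrt c)^-1 (xiL n)).
    by congr (integrable _ _ (EFin \o _)); apply/funext => w; rewrite ![_^-1 * _]mulrC.
  congr (_%:E); transitivity (\int[P]_w (c^-1 * (xi m w * xi n w))).
    by apply: eq_Rintegral => w _; rewrite -{3}scc; field.
  by rewrite (RintegralZl _ measurableT (L2M (xiL m) (xiL n))) kl_xi_gram mulKf// gt_eqF.
- exact: (orthonormal_basis_ext phiE (eigen_basis S r0 lamP lamH lam_ar lam_large)).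
- move=> n s sr; have /andP[s0 _] := sr.
  have ln0 : lam n != 0 by rewrite gt_eqF//; have [] := lamP n.
  pose k := isq s * c * (Num.sqrt (Q n))^-1.
  transitivity (k * prim0y (fun t => green p s t * B n t / p t) r); last first.
    rewrite (green_eigen S r0 lamP lam_ar sr n) phiE// /eigenfun exprMn (expr2 (Num.sqrt c)) scc.
    rewrite /k /isq; field; rewrite ln0 !gt_eqF// sqrtr_gt0//; exact: p0.
  have cint : cnn (fun t => green p s t * B n t / p t).
    apply: cnnM; last exact: (@sturm_cVp _ _ _ _ S).
    by apply: cnnM; [exact: (cnn_green S sr)|exact: (@sturm_cb _ _ _ _ S)].
  rewrite prim0yE ?(ltW r0)// -RintegralZl//; last exact: cont_integrable (cnn_within cint).
  apply: eq_Rintegral => t; rewrite mem_setE/= in_itv/= => tr; have /andP[t0 _] := tr.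
  rewrite kl_covariance// phiE// /eigenfun /k /green -isq2// -/(isq t).
  by rewrite expr2; ring.
- apply: kl_uniform => n t w tr; rewrite phiE//; move: sc0 scc; set q := Num.sqrt c => q0 _.
  by field; rewrite q0 gt_eqF//; have [] := lamP n.
Qed.

End KarhunenLoeveExpansion.

Section ClosedSpanMore.
Context d (T : measurableType d) (R : realType).
Variable mu : {measure set T -> \bar R}.
Variables S S' : set (T -> R).
Hypothesis S_L2 : forall g, S g -> g \in Lfun mu 2%:E.
Hypothesis S'_L2 : forall g, S' g -> g \in Lfun mu 2%:E.

Lemma closed_span_trans f : (exists g, S' g) -> (forall g, S g -> closed_span mu S' g) ->
  closed_span mu S f -> closed_span mu S' f.
Proof.
move=> [g0 g0S] SS' /(closed_spanP S_L2)[fL fS]; apply: (closed_span_lim S'_L2) => // e /fS[h [n [c [g [gS hE]]]] he].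
exists h => //; rewrite hE; apply: (closed_span_sum S'_L2).
  exact: closed_span0 (closed_span_incl S'_L2 g0S).
by move=> i; apply: closed_spanZ => //; exact: SS'.
Qed.

Lemma closed_span_ae f g : f \in Lfun mu 2%:E -> {ae mu, forall w, f w = g w} ->
  closed_span mu S' g -> closed_span mu S' f.
Proof.
move=> fL fg gS; have gL := closed_span_L2 gS; apply: (closed_span_lim S'_L2) => // e e0; exists g => //.
have mfg : measurable_fun setT (fun w => ((f w - g w) ^+ 2)%:E).
  by apply/measurable_EFinP; apply: measurable_funX; apply: measurable_funB; [exact: L2_measurable fL|exact: L2_measurable gL].
suff -> : nrm2 mu (fun w => f w - g w) = 0 by [].
transitivity (fine (\int[mu]_w cst 0%E w)%E); last by rewrite integral0.
rewrite /nrm2 /Rintegral; congr fine; apply: ae_eq_integral => //.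
by apply: filterS fg => w fgw _; rewrite fgw subrr expr0n.
Qed.

End ClosedSpanMore.

Lemma random_variable_exists d (T : measurableType d) (R : realType) (P : probability T R) (f : T -> R) :
  measurable_fun setT f -> exists X : {RV P >-> R}, (X : T -> R) = f.
Proof.
move=> mf; pose m : {mfun T >-> R} := HB.pack f (isMeasurableFun.Build _ _ _ _ f mf).
by exists m.
Qed.

Lemma martingale_gaussian d (T : measurableType d) (R : realType) (P : probability T R)
    (mu : {measure set (measurableTypeR R) -> \bar R}) (B : R -> R[i] -> R[i]) (X M : R -> {RV P >-> R}) :
  si_process mu X -> even_fundamental_martingale mu B X M ->
  (forall t, 0 <= t -> (M t : T -> R) \in Lfun P 2%:E) ->
  forall Z, closed_span P [set (M t : T -> R) | t in [set t | 0 <= t]] Z -> centred_normal P Z.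
Proof.
move=> HX [I [[Iinto _ _ _] _ IM]] ML Z ZM.
apply: (gaussian_span (X_gaussian HX) (X_L2 HX) (X_centred HX)).
have XL g : [set (X t : T -> R) | t in [set: R]] g -> g \in Lfun P 2%:E.
  by move=> [t _ <-]; exact: X_L2 HX t.
have Xne : exists g, [set (X t : T -> R) | t in [set: R]] g by exists (X 0); exists 0.
have XC t : closed_span P [set (X t : T -> R) | t in [set: R]] (X t).
  by apply: (closed_span_incl XL); exists t.
have SL g : [set (M t : T -> R) | t in [set t | 0 <= t]] g -> g \in Lfun P 2%:E.
  by move=> [t t0 <-]; exact: ML.
apply: (closed_span_trans SL XL Xne) ZM => _ [t t0 <-].
have [Dt Mt] := IM t t0.
apply: (closed_span_ae XL (ML t t0) Mt).
have even_C u : closed_span P [set (X t : T -> R) | t in [set: R]] (even_part X u).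
  have := closed_spanZ XL 2^-1 (closed_spanB XL (XC u) (XC (- u))).
  by congr (closed_span _ _ _); apply/funext => w; rewrite /even_part mulrC.
apply: (closed_span_trans _ XL Xne) (Iinto _ Dt) => g [u u0 <-]; last exact: even_C.
exact: closed_span_L2 (even_C u).
Qed.

Theorem theorem4p14 (R : realType) (d : measure_display) (T : measurableType d)
    (P : probability T R) (mu : {measure set (measurableTypeR R) -> \bar R})
    (alpha dalpha : R -> R) (A B : R -> R[i] -> R[i])
    (X M : R -> {RV P >-> R}) (r : R) :
  diagonal_chain alpha dalpha A B ->
  si_process mu X ->
  determined_by_chain mu A B ->
  even_fundamental_martingale mu B X M ->
  (forall s t : R, 0 <= s -> 0 <= t ->
    'E_P[(fun w => M s w * M t w)%R]%E = (pi * alpha (Num.min s t))%:E) ->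
  0 < r ->
  exists (lambda : nat -> R) (xi : nat -> {RV P >-> R}),
    let K n := complex.Re (deBranges_kernel A B r (lambda n)%:C%C (lambda n)%:C%C) in
    let omega n := (lambda n)^-1 * Num.sqrt (2 / (pi * K n)) in
    let phi n t := complex.Re (B t (lambda n)%:C%C) / Num.sqrt (dalpha t) in
    let Y t w := (Num.sqrt (dalpha t))^-1 * M t w in
    [/\ {homo lambda : m n / (m < n)%N >-> m < n} /\
        (forall x : R, (0 < x /\ A r x%:C%C = 0) <-> exists n, lambda n = x),
        mutually_independent xi /\
        (forall n, has_gaussian_law P (xi n) 0 (Num.sqrt pi)),
        ms_uniform_series P r Y omega phi xi,
        orthonormal_basis r (fun n t => Num.sqrt (2 / (pi * K n)) * phi n t)
      & karhunen_loeve P r Y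
          (fun n => Num.sqrt pi / lambda n)
          (fun n t => Num.sqrt (2 / (pi * K n)) * phi n t)
          (fun n w => xi n w / Num.sqrt pi)].
Proof.
move=> H HX _ HM MM0 r0; have S := chain_sturm H.
have [lam lamP [lamH zeros lam_large]] := sturm_eigenvalues S r0.
have lam_ar n : cos_part dalpha B (lam n) r = 0 by have [_] := (zeros (lam n)).2 (ex_intro _ n erefl).
have pE t : 0 <= t -> density dalpha t = dalpha t by move=> t0; rewrite /density ger0_norm.
have ML t : 0 <= t -> (M t : T -> R) \in Lfun P 2%:E.
  move=> t0; apply/L2P; split; first exact: measurable_funP.
  have := MM0 t t t0 t0; rewrite unlock => e.
  by under eq_integral do rewrite expr2; rewrite e ltry.
have MM s t : 0 <= s -> 0 <= t ->
    \int[P]_w (M s w * M t w) = pi * prim0y (density dalpha) (Num.min s t).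
  move=> s0 t0; have := MM0 s t s0 t0; rewrite unlock /Rintegral => ->.
  by rewrite /= (alphaE H)// le_min s0.
have MG := martingale_gaussian HX HM ML.
have [xi0 [xi0S xi0N xi0E]] := kl_expansion S r0 lamP lamH lam_ar (pi_ge0 R) ML MM.
have /choice[xi xiE] : forall n, exists Z : {RV P >-> R}, (Z : T -> R) = xi0 n.
  by move=> n; apply: random_variable_exists; exact: L2_measurable (closed_span_L2 (xi0S n)).
have xiE' : xi0 = (fun n => xi n) by apply/funext => n; rewrite xiE.
rewrite {}xiE' in xi0S xi0N xi0E.
exists lam, xi => K omega phi Y.
pose Q n := sturm_norm (density dalpha) (sin_part dalpha A) r lam n.
have Q0 n : 0 < Q n by exact: (sturm_norm_gt0 S r0 lamP).
have r0' := ltW r0.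
have KE n : Num.sqrt (2 / (pi * K n)) = (Num.sqrt (Q n))^-1.
  have -> : K n = (2 * Q n) / pi.
    rewrite /K (kernel_diagonal H r0' (lam_ar n)); congr (_ / _).
    have -> : 2 * Q n = Q n + Q n by ring.
    have c1 : cnn (cos_part dalpha B (lam n)) by exact: (@sturm_ca _ _ _ _ S).
    have c2 : cnn (sin_part dalpha A (lam n)) by exact: (@sturm_cb _ _ _ _ S).
    have c3 : cnn (density dalpha) := sturm_cont S.
    have c4 : cnn (fun t => (density dalpha t)^-1) by exact: (@sturm_cVp _ _ _ _ S).
    rewrite /gram_density prim0yD//; first last.
    - by apply: cnnM => //; exact: cnnM.
    - by apply: cnnM => //; exact: cnnM.
    rewrite (sturm_orthogonal_dual S r0 lamP lamH lam_ar).
    by rewrite (sturm_orthogonal S r0 lamP lamH lam_ar) eqxx mul1r.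
  rewrite -sqrtrV ?(ltW (Q0 n))//; congr Num.sqrt.
  have pin : pi != 0 :> R by rewrite gt_eqF// pi_gt0.
  have qn : Q n != 0 by rewrite gt_eqF.
  by rewrite [pi * _]mulrC divfK//; field.
have YE t : 0 <= t <= r -> Y t = (fun w => (Num.sqrt (density dalpha t))^-1 * M t w).
  by move=> /andP[t0 _]; rewrite pE.
have phiE n t : 0 <= t <= r -> Num.sqrt (2 / (pi * K n)) * phi n t =
    eigenfun (density dalpha) (sin_part dalpha A) r lam n t.
  by move=> /andP[t0 _]; rewrite KE /phi /eigenfun pE// (chain_realB H).
have EK := kl_karhunen_loeve S r0 lamP lamH lam_ar lam_large (pi_gt0 R) ML MM MG xi0S xi0N xi0E YE phiE.
split.
- split=> // x; rewrite -zeros (chain_realA H)//; split=> -[x0].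
    by move=> /(congr1 (@complex.Re R)).
  by move=> ->.
- split; first exact: (kl_independent ML MG xi0S xi0N).
  exact: (kl_law (pi_gt0 R) MG xi0S xi0N).
- apply: (kl_uniform S r0 lamP lamH lam_ar lam_large (pi_gt0 R) ML MG xi0S xi0E YE).
  by move=> n t w tr; rewrite -phiE// /omega; ring.
- exact: (orthonormal_basis_ext phiE (eigen_basis S r0 lamP lamH lam_ar lam_large)).
- exact: EK.
Qed.
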